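(* The 2-functor $\Omega\colon \mathbf{ClIdl}\to\mathbf{ClIdl}$, $(\mathcal{C},\mathcal{N})\mapsto(\mathrm{Ses}(\mathcal{C}),[\mathcal{N}])$, $G\mapsto G$ (applied levelwise), $\alpha\mapsto[\alpha]$, extends to a pseudo-comonad on the 2-category $\mathbf{ClIdl}$, with counit $\epsilon$ and comultiplication $\delta$ as described in the context (i.e. there is an invertible modification $\Xi\colon \Omega\delta\circ\delta\cong\delta\Omega\circ\delta$ such that $(\Omega,\delta,\epsilon,\Xi)$, with identity counit comparisons, is a pseudo-comonad). Moreover, the 2-category of (normal) pseudo-coalgebras for $\Omega$ is 2-isomorphic, over $\mathbf{ClIdl}$ (i.e. compatibly with the forgetful 2-functors to $\mathbf{ClIdl}$), to the 2-category $\mathbf{BiHPTors}$ of bihereditary pretorsion theories.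
   Context: **Ideals, kernels, short exact sequences.** An ideal $\mathcal{N}$ of null morphisms in a category $\mathcal{C}$ is a class of morphisms closed under pre- and post-composition with arbitrary morphisms. A null object is an object whose identity is null. $\mathcal{N}$ is closed if every null morphism factors through a null object. An $\mathcal{N}$-kernel of $f\colon A\to B$ is a morphism $k\colon K\to A$ with $fk\in\mathcal{N}$ such that every $h$ with codomain $A$ and $fh\in\mathcal{N}$ factors uniquely through $k$; $\mathcal{N}$-cokernels are dual. $K(f)$, $C(f)$ denote the kernel and cokernel objects, $\ker(f)$, $\mathrm{coker}(f)$ the (chosen) kernel and cokernel morphisms. A sequence $X\xrightarrow{f}Y\xrightarrow{g}Z$ is short exact if $f$ is an $\mathcal{N}$-kernel of $g$ and $g$ is an $\mathcal{N}$-cokernel of $f$. **$\mathrm{Ses}(\mathcal{C})$.** Objects are short exact sequences in $\mathcal{C}$; morphisms from $X\xrightarrow{f}Y\xrightarrow{g}Z$ to $X'\xrightarrow{f'}Y'\xrightarrow{g'}Z'$ are triples $(u,v,w)$ with $vf=f'u$, $wg=g'v$. The closed ideal $[\mathcal{N}]$ on $\mathrm{Ses}(\mathcal{C})$ consists of the morphisms that factor through a short exact sequence both of whose morphisms are isomorphisms in $\mathcal{C}$. An object of $\mathrm{Ses}(\mathrm{Ses}(\mathcal{C}))$ is viewed as a $3\times3$ diagram whose rows are objects of $\mathrm{Ses}(\mathcal{C})$ and whose columns are the components of the morphisms of $\mathrm{Ses}(\mathcal{C})$. **$\mathbf{ClIdl}$.** Objects: pairs $(\mathcal{C},\mathcal{N})$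 with $\mathcal{N}$ a closed ideal of $\mathcal{C}$ such that all $\mathcal{N}$-kernels and $\mathcal{N}$-cokernels exist. Morphisms $(\mathcal{C},\mathcal{N})\to(\mathcal{D},\mathcal{M})$: functors sending $\mathcal{N}$-kernels to $\mathcal{M}$-kernels and $\mathcal{N}$-cokernels to $\mathcal{M}$-cokernels. 2-cells: natural transformations. **The 2-functor $\Omega$.** On objects $(\mathcal{C},\mathcal{N})\mapsto(\mathrm{Ses}(\mathcal{C}),[\mathcal{N}])$; a morphism $G\colon\mathcal{C}\to\mathcal{D}$ is sent to the functor applying $G$ to all components of short exact sequences and of their morphisms; a 2-cell $\alpha\colon G\Rightarrow H$ is sent to $[\alpha]$ with component $(\alpha_X,\alpha_Y,\alpha_Z)$ at $X\to Y\to Z$. **Counit and comultiplication.** $\epsilon_{\mathcal{C}}\colon\mathrm{Ses}(\mathcal{C})\to\mathcal{C}$ sends $X\to Y\to Z$ to $Y$ and $(u,v,w)$ to $v$. $\delta_{\mathcal{C}}\colon\mathrm{Ses}(\mathcal{C})\to\mathrm{Ses}(\mathrm{Ses}(\mathcal{C}))$ sends $X\xrightarrow{f}Y\xrightarrow{g}Z$ to the $3\times3$ diagram with rows $$X\xrightarrow{\mathrm{id}}X\xrightarrow{\mathrm{coker}(\mathrm{id}_X)}C(\mathrm{id}_X),\qquad X\xrightarrow{f}Y\xrightarrow{g}Z,\qquad K(\mathrm{id}_Z)\xrightarrow{\ker(\mathrm{id}_Z)}Z\xrightarrow{\mathrm{id}}Z,$$ with vertical morphisms $(\mathrm{id}_X,f,w_0)$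 from the first to the second row and $(u_0,g,\mathrm{id}_Z)$ from the second to the third, where $w_0,u_0$ are the unique morphisms with $w_0\,\mathrm{coker}(\mathrm{id}_X)=gf$ and $\ker(\mathrm{id}_Z)\,u_0=gf$. On a morphism $(u,v,w)$, $\delta_{\mathcal{C}}$ acts by $(u,u,\bar u)$ on top rows, $(u,v,w)$ on middle rows and $(\bar w,w,w)$ on bottom rows, with $\bar u,\bar w$ induced by universal properties. $\delta$ is pseudo-natural: its structure isomorphism at $G\colon\mathcal{C}\to\mathcal{D}$ has identity components in all positions except $(1,3)$ and $(3,1)$, where it is given by the canonical isomorphisms $G(C(\mathrm{id}_X))\cong C(\mathrm{id}_{G(X)})$ and $G(K(\mathrm{id}_Z))\cong K(\mathrm{id}_{G(Z)})$. **Pseudo-comonads and pseudo-coalgebras.** A pseudo-comonad on a 2-category consists of a pseudofunctor $\Omega$, pseudo-natural transformations $\epsilon\colon\Omega\Rightarrow\mathrm{Id}$, $\delta\colon\Omega\Rightarrow\Omega\Omega$ and invertible modifications $\Xi\colon\Omega\delta\circ\delta\cong\delta\Omega\circ\delta$, $\epsilon\Omega\circ\delta\cong\mathrm{id}$, $\Omega\epsilon\circ\delta\cong\mathrm{id}$ satisfying the usual coherence axioms. Throughout, ''pseudo-coalgebra'' means normal pseudo-coalgebra: an object $\mathcal{C}$, a 1-cell $\lambda\colon\mathcal{C}\to\Omega\mathcal{C}$ with $\epsilon_{\mathcal{C}}\circ\lambda=\mathrm{id}$ strictly, and an invertible 2-cell $\lambda_\delta\colon\Omega(\lambda)\circ\lambda\cong\delta_{\mathcal{C}}\circ\lambda$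 satisfying the usual coherence axioms with the counit and with $\Xi$. Morphisms $(\mathcal{C},\lambda,\lambda_\delta)\to(\mathcal{D},\mu,\mu_\delta)$ of pseudo-coalgebras are pseudo-morphisms: pairs $(G,\overline G)$ of a 1-cell $G\colon\mathcal{C}\to\mathcal{D}$ and an invertible 2-cell $\overline G\colon\mu\circ G\cong\Omega(G)\circ\lambda$ compatible with counit and comultiplication in the usual sense. 2-cells $(G,\overline G)\Rightarrow(H,\overline H)$ are 2-cells $\alpha\colon G\Rightarrow H$ with $\overline H\cdot(\mu\alpha)=(\Omega(\alpha)\lambda)\cdot\overline G$. **Pretorsion theories.** A pretorsion theory $(\mathcal{C},\mathcal{T},\mathcal{F})$ is a category $\mathcal{C}$ with full replete subcategories $\mathcal{T}$ (torsion objects), $\mathcal{F}$ (torsion-free objects) such that, with $\mathcal{N}$ the ideal of morphisms factoring through an object of $\mathcal{T}\cap\mathcal{F}$: (T1) every morphism from an object of $\mathcal{T}$ to an object of $\mathcal{F}$ is in $\mathcal{N}$; (T2) every object $X$ admits an $\mathcal{N}$-short exact sequence $T^X\xrightarrow{\ell^X}X\xrightarrow{r^X}F^X$ with $T^X\in\mathcal{T}$, $F^X\in\mathcal{F}$. Convention: a pretorsion theory always comes with a fixed choice of such a short exact sequence for every object. This yields functors $T\colon\mathcal{C}\to\mathcal{T}$, $X\mapsto T^X$, and $F\colon\mathcal{C}\to\mathcal{F}$, $X\mapsto F^X$ (on $h\colon X\to Y$: the unique $h^T,h^F$ with $\ell^Yh^T=h\ell^X$, $h^Fr^X=r^Yh$).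 The theory is hereditary if $\mathcal{C}\xrightarrow{T}\mathcal{T}\hookrightarrow\mathcal{C}$ preserves $\mathcal{N}$-kernels, cohereditary if $\mathcal{C}\xrightarrow{F}\mathcal{F}\hookrightarrow\mathcal{C}$ preserves $\mathcal{N}$-cokernels, bihereditary if both. **$\mathbf{BiHPTors}$.** Objects: bihereditary pretorsion theories $(\mathcal{C},\mathcal{T},\mathcal{F})$ such that $\mathcal{C}$ has all kernels and cokernels with respect to the closed ideal of morphisms factoring through $\mathcal{T}\cap\mathcal{F}$ (with chosen short exact sequences as in the convention). Morphisms: functors preserving (relative) kernels, cokernels, torsion objects and torsion-free objects. 2-cells: natural transformations. The forgetful 2-functor to $\mathbf{ClIdl}$ sends $(\mathcal{C},\mathcal{T},\mathcal{F})$ to $\mathcal{C}$ with the closed ideal determined by $\mathcal{T}\cap\mathcal{F}$. *)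

(* Defs.v *)
From Corelib Require Import ssreflect ssrfun ssrbool.
From Stdlib Require Import FunctionalExtensionality PropExtensionality.
From Stdlib Require Import ProofIrrelevance IndefiniteDescription.

Set Implicit Arguments.
Unset Strict Implicit.
Unset Printing Implicit Defensive.

(** * Categories, functors, natural transformations

    Morphisms are compared by Leibniz equality, and so are objects where the
    mathematics asks for strict equality of functors. *)

Record category := Category {
  ob :> Type;
  hom : ob -> ob -> Type;
  idm : forall A, hom A A;
  mcomp : forall A B C, hom B C -> hom A B -> hom A C;
  mcomp1m : forall A B (f : hom A B), mcomp (idm B) f = f;
  mcompm1 : forall A B (f : hom A B), mcomp f (idm A) = f;
  mcompA : forall A B C D (h : hom C D) (g : hom B C) (f : hom A B),
    mcomp h (mcomp g f) = mcomp (mcomp h g) f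
}.
Arguments hom {c} A B.
Arguments idm {c} A.
Arguments mcomp {c A B C} g f.
Notation "g ∘ f" := (mcomp g f) (at level 40, left associativity).

Record functor (C D : category) := Functor {
  fob :> C -> D;
  fmap : forall A B, hom A B -> hom (fob A) (fob B);
  fmap1 : forall A, fmap (idm A) = idm (fob A);
  fmapM : forall A B E (g : hom B E) (f : hom A B),
    fmap (g ∘ f) = fmap g ∘ fmap f
}.
Arguments fmap {C D} F {A B} f : rename.

Record nattrans (C D : category) (F G : functor C D) := NatTrans {
  nt :> forall X, hom (F X) (G X);
  nt_nat : forall X Y (f : hom X Y), nt Y ∘ fmap F f = fmap G f ∘ nt X
}.

Definition id_functor (C : category) : functor C C :=
  @Functor C C (fun X => X) (fun A B f => f)
    (fun A => erefl) (fun A B E g f => erefl).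

Lemma comp_functor1 (C D E : category) (G : functor D E) (F : functor C D) A :
  fmap G (fmap F (idm A)) = idm (G (F A)).
Proof. by rewrite !fmap1. Qed.

Lemma comp_functorM (C D E : category) (G : functor D E) (F : functor C D)
    X Y Z (g : hom Y Z) (f : hom X Y) :
  fmap G (fmap F (g ∘ f)) = fmap G (fmap F g) ∘ fmap G (fmap F f).
Proof. by rewrite !fmapM. Qed.

Definition comp_functor (C D E : category) (G : functor D E) (F : functor C D) :
    functor C E :=
  @Functor C E (fun X => G (F X)) (fun A B f => fmap G (fmap F f))
    (comp_functor1 G F) (comp_functorM G F).

Lemma id_nattrans_nat (C D : category) (F : functor C D) X Y (f : hom X Y) :
  idm (F Y) ∘ fmap F f = fmap F f ∘ idm (F X).
Proof. by rewrite mcomp1m mcompm1. Qed.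

Definition id_nattrans (C D : category) (F : functor C D) : nattrans F F :=
  NatTrans (@id_nattrans_nat C D F).

Lemma comp_nattrans_nat (C D : category) (F G H : functor C D)
    (b : nattrans G H) (a : nattrans F G) X Y (f : hom X Y) :
  (b Y ∘ a Y) ∘ fmap F f = fmap H f ∘ (b X ∘ a X).
Proof. by rewrite -mcompA nt_nat mcompA nt_nat mcompA. Qed.

Definition comp_nattrans (C D : category) (F G H : functor C D)
    (b : nattrans G H) (a : nattrans F G) : nattrans F H :=
  NatTrans (comp_nattrans_nat b a).

Lemma whisker_l_nat (C D E : category) (H : functor D E) (F G : functor C D)
    (a : nattrans F G) X Y (f : hom X Y) :
  fmap H (a Y) ∘ fmap (comp_functor H F) f =
  fmap (comp_functor H G) f ∘ fmap H (a X).
Proof. by rewrite /= -!fmapM nt_nat. Qed.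

Definition whisker_l (C D E : category) (H : functor D E) (F G : functor C D)
    (a : nattrans F G) : nattrans (comp_functor H F) (comp_functor H G) :=
  @NatTrans C E (comp_functor H F) (comp_functor H G)
    (fun X => fmap H (a X)) (whisker_l_nat H a).

Definition whisker_r (C D E : category) (F G : functor D E)
    (a : nattrans F G) (H : functor C D) :
    nattrans (comp_functor F H) (comp_functor G H) :=
  @NatTrans C E (comp_functor F H) (comp_functor G H)
    (fun X => a (H X)) (fun X Y f => nt_nat a (fmap H f)).

Definition is_iso (C : category) (A B : C) (f : hom A B) : Prop :=
  exists g : hom B A, g ∘ f = idm A /\ f ∘ g = idm B.

(** * Ideals, relative kernels and cokernels *)

Definition mor_class (C : category) := forall A B : C, hom A B -> Prop.

Definition is_ideal (C : category) (N : mor_class C) : Prop :=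
  (forall (A B D : C) (g : hom B D) (f : hom A B), N A B f -> N A D (g ∘ f)) /\
  (forall (A B D : C) (g : hom B D) (f : hom A B), N B D g -> N A D (g ∘ f)).

(** The class of morphisms factoring through an object satisfying [P]. *)
Definition factors_through (C : category) (P : C -> Prop) : mor_class C :=
  fun A B f => exists D : C, P D /\
    exists (h : hom D B) (g : hom A D), f = h ∘ g.

Definition null_object (C : category) (N : mor_class C) (A : C) : Prop :=
  N A A (idm A).

Definition is_closed_ideal (C : category) (N : mor_class C) : Prop :=
  is_ideal N /\
  forall (A B : C) (f : hom A B), N A B f ->
    factors_through (null_object N) f.

Definition is_kernel (C : category) (N : mor_class C) (A B K : C)
    (f : hom A B) (k : hom K A) : Prop :=
  N K B (f ∘ k) /\
  forall (H : C) (h : hom H A), N H B (f ∘ h) -> exists! h', k ∘ h' = h.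

Definition is_cokernel (C : category) (N : mor_class C) (A B Q : C)
    (f : hom A B) (c : hom B Q) : Prop :=
  N A Q (c ∘ f) /\
  forall (H : C) (h : hom B H), N A H (h ∘ f) -> exists! h', h' ∘ c = h.

Definition has_kernels (C : category) (N : mor_class C) : Prop :=
  forall (A B : C) (f : hom A B), exists (K : C) (k : hom K A), is_kernel N f k.

Definition has_cokernels (C : category) (N : mor_class C) : Prop :=
  forall (A B : C) (f : hom A B), exists (Q : C) (c : hom B Q),
    is_cokernel N f c.

Definition is_short_exact (C : category) (N : mor_class C) (X Y Z : C)
    (f : hom X Y) (g : hom Y Z) : Prop :=
  is_kernel N g f /\ is_cokernel N f g.

Definition preserves_kernels (C D : category) (N : mor_class C)
    (M : mor_class D) (F : functor C D) : Prop :=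
  forall (A B K : C) (f : hom A B) (k : hom K A),
    is_kernel N f k -> is_kernel M (fmap F f) (fmap F k).

Definition preserves_cokernels (C D : category) (N : mor_class C)
    (M : mor_class D) (F : functor C D) : Prop :=
  forall (A B Q : C) (f : hom A B) (c : hom B Q),
    is_cokernel N f c -> is_cokernel M (fmap F f) (fmap F c).

(** Factorizations through kernels and cokernels, as functions. *)

Lemma kernel_factor_sig (C : category) (N : mor_class C) (A B K : C)
    (f : hom A B) (k : hom K A) (kP : is_kernel N f k)
    (H : C) (h : hom H A) (hP : N H B (f ∘ h)) : {h' | k ∘ h' = h}.
Proof.
by apply: constructive_indefinite_description; case: (kP.2 _ _ hP) => u [? _]; exists u.
Qed.

Definition kernel_factor C N A B K f k kP H h hP : hom H K :=
  proj1_sig (@kernel_factor_sig C N A B K f k kP H h hP).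

Lemma kernel_factorE C N A B K f k kP H h hP :
  k ∘ @kernel_factor C N A B K f k kP H h hP = h.
Proof. exact: proj2_sig (kernel_factor_sig _ _). Qed.

Lemma cokernel_factor_sig (C : category) (N : mor_class C) (A B Q : C)
    (f : hom A B) (c : hom B Q) (cP : is_cokernel N f c)
    (H : C) (h : hom B H) (hP : N A H (h ∘ f)) : {h' | h' ∘ c = h}.
Proof.
by apply: constructive_indefinite_description; case: (cP.2 _ _ hP) => u [? _]; exists u.
Qed.

Definition cokernel_factor C N A B Q f c cP H h hP : hom Q H :=
  proj1_sig (@cokernel_factor_sig C N A B Q f c cP H h hP).

Lemma cokernel_factorE C N A B Q f c cP H h hP :
  @cokernel_factor C N A B Q f c cP H h hP ∘ c = h.
Proof. exact: proj2_sig (cokernel_factor_sig _ _). Qed.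

Lemma kernel_mono (C : category) (N : mor_class C) (A B K : C)
    (f : hom A B) (k : hom K A) : is_ideal N -> is_kernel N f k ->
  forall (H : C) (u v : hom H K), k ∘ u = k ∘ v -> u = v.
Proof.
move=> [_ NR] [fk kU] H u v e.
have fku : N H B (f ∘ (k ∘ u)) by rewrite mcompA; apply: NR.
by case: (kU _ _ fku) => w [_ wU]; rewrite -(wU u erefl) (wU v (esym e)).
Qed.

Lemma cokernel_epi (C : category) (N : mor_class C) (A B Q : C)
    (f : hom A B) (c : hom B Q) : is_ideal N -> is_cokernel N f c ->
  forall (H : C) (u v : hom Q H), u ∘ c = v ∘ c -> u = v.
Proof.
move=> [NL _] [cf cU] H u v e.
have ucf : N A H (u ∘ c ∘ f) by rewrite -mcompA; apply: NL.
by case: (cU _ _ ucf) => w [_ wU]; rewrite -(wU u erefl) (wU v (esym e)).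
Qed.

(** * 2-categories *)

Record twocat_data := TwocatData {
  ob2 :> Type;
  hom1 : ob2 -> ob2 -> Type;
  cell : forall A B, hom1 A B -> hom1 A B -> Type;
  id1 : forall A, hom1 A A;
  comp1 : forall A B C, hom1 B C -> hom1 A B -> hom1 A C;
  id2 : forall A B (f : hom1 A B), cell f f;
  vcomp : forall A B (f g h : hom1 A B), cell g h -> cell f g -> cell f h;
  lwhisk : forall A B C (h : hom1 B C) (f g : hom1 A B),
    cell f g -> cell (comp1 h f) (comp1 h g);
  rwhisk : forall A B C (f g : hom1 B C),
    cell f g -> forall e : hom1 A B, cell (comp1 f e) (comp1 g e)
}.
Arguments hom1 {t} A B.
Arguments cell {t A B} f g.
Arguments id1 {t} A.
Arguments comp1 {t A B C} g f.
Arguments id2 {t A B} f.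
Arguments vcomp {t A B f g h} b a.
Arguments lwhisk {t A B C} h {f g} a.
Arguments rwhisk {t A B C f g} a e.
Notation "g ⊚ f" := (comp1 g f) (at level 40, left associativity).
Notation "b • a" := (vcomp b a) (at level 46, left associativity).
Notation "h ◁ a" := (lwhisk h a) (at level 42, right associativity).
Notation "a ▷ e" := (rwhisk a e) (at level 43, left associativity).

(** The identity 2-cell along an equality of 1-cells. *)
Definition idcell (B : twocat_data) (X Y : B) (f g : hom1 X Y) (e : f = g) :
    cell f g :=
  match e with erefl => id2 f end.

(** Strict 2-categories; the equations of 1-cells enter the laws of 2-cells
    through [idcell]. *)
Record twocat := Twocat {
  tdata :> twocat_data;
  assoc1 : forall (X Y Z W : tdata) (h : hom1 Z W) (g : hom1 Y Z) (f : hom1 X Y),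
    h ⊚ (g ⊚ f) = h ⊚ g ⊚ f;
  unit1l : forall (X Y : tdata) (f : hom1 X Y), id1 Y ⊚ f = f;
  unit1r : forall (X Y : tdata) (f : hom1 X Y), f ⊚ id1 X = f;
  vcomp1c : forall (X Y : tdata) (f g : hom1 X Y) (a : cell f g),
    id2 g • a = a;
  vcompc1 : forall (X Y : tdata) (f g : hom1 X Y) (a : cell f g),
    a • id2 f = a;
  vcompA : forall (X Y : tdata) (f g h k : hom1 X Y)
    (c : cell h k) (b : cell g h) (a : cell f g), c • (b • a) = c • b • a;
  lwhisk1 : forall (X Y Z : tdata) (h : hom1 Y Z) (f : hom1 X Y),
    h ◁ id2 f = id2 (h ⊚ f);
  lwhiskV : forall (X Y Z : tdata) (k : hom1 Y Z) (f g h : hom1 X Y)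
    (b : cell g h) (a : cell f g), k ◁ (b • a) = (k ◁ b) • (k ◁ a);
  rwhisk1 : forall (X Y Z : tdata) (h : hom1 Y Z) (f : hom1 X Y),
    id2 h ▷ f = id2 (h ⊚ f);
  rwhiskV : forall (X Y Z : tdata) (f g h : hom1 Y Z) (e : hom1 X Y)
    (b : cell g h) (a : cell f g), (b • a) ▷ e = (b ▷ e) • (a ▷ e);
  whisk_exchange : forall (X Y Z : tdata) (f f' : hom1 X Y) (g g' : hom1 Y Z)
    (a : cell f f') (b : cell g g'), (b ▷ f') • (g ◁ a) = (g' ◁ a) • (b ▷ f);
  lwhisk_id1 : forall (X Y : tdata) (f g : hom1 X Y) (a : cell f g),
    idcell (unit1l g) • (id1 Y ◁ a) = a • idcell (unit1l f);
  rwhisk_id1 : forall (X Y : tdata) (f g : hom1 X Y) (a : cell f g),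
    idcell (unit1r g) • (a ▷ id1 X) = a • idcell (unit1r f);
  lwhisk_comp1 : forall (X Y Z W : tdata) (k : hom1 Z W) (h : hom1 Y Z)
    (f g : hom1 X Y) (a : cell f g),
    idcell (assoc1 k h g) • (k ◁ h ◁ a) = (k ⊚ h ◁ a) • idcell (assoc1 k h f);
  rwhisk_comp1 : forall (X Y Z W : tdata) (f g : hom1 Z W) (h : hom1 Y Z)
    (e : hom1 X Y) (a : cell f g),
    idcell (assoc1 g h e) • (a ▷ (h ⊚ e)) = (a ▷ h ▷ e) • idcell (assoc1 f h e);
  lrwhisk : forall (X Y Z W : tdata) (h : hom1 Z W) (f g : hom1 Y Z)
    (e : hom1 X Y) (a : cell f g),
    idcell (assoc1 h g e) • (h ◁ (a ▷ e)) = ((h ◁ a) ▷ e) • idcell (assoc1 h f e)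
}.

Definition assoc_l (B : twocat) (X Y Z W : B)
    (h : hom1 Z W) (g : hom1 Y Z) (f : hom1 X Y) :
    cell (h ⊚ (g ⊚ f)) (h ⊚ g ⊚ f) := idcell (assoc1 h g f).

Definition assoc_r (B : twocat) (X Y Z W : B)
    (h : hom1 Z W) (g : hom1 Y Z) (f : hom1 X Y) :
    cell (h ⊚ g ⊚ f) (h ⊚ (g ⊚ f)) := idcell (esym (assoc1 h g f)).

Definition invertible (B : twocat_data) (X Y : B) (f g : hom1 X Y)
    (a : cell f g) : Prop :=
  exists b : cell g f, b • a = id2 f /\ a • b = id2 g.

Definition is_identity_cell (B : twocat_data) (X Y : B) (f g : hom1 X Y)
    (a : cell f g) : Prop :=
  exists e : f = g, a = idcell e.

(** ** 2-functors and 2-isomorphisms *)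

(** The underlying action of a (pseudo)functor on objects, 1-cells and 2-cells.
    Primitive projections make the composition of such actions strictly unital
    and associative up to conversion. *)
Set Primitive Projections.
Record map2 (B C : twocat_data) := Map2 {
  m0 : B -> C;
  m1 : forall X Y : B, hom1 X Y -> hom1 (m0 X) (m0 Y);
  m2 : forall (X Y : B) (f g : hom1 X Y), cell f g -> cell (m1 f) (m1 g)
}.
Unset Primitive Projections.
Arguments m0 {B C} F X : rename.
Arguments m1 {B C} F {X Y} f : rename.
Arguments m2 {B C} F {X Y f g} a : rename.

Definition id_map (B : twocat_data) : map2 B B :=
  @Map2 B B (fun X => X) (fun X Y f => f) (fun X Y f g a => a).

Definition comp_map (B C D : twocat_data) (G : map2 C D) (F : map2 B C) :
    map2 B D :=
  @Map2 B D (fun X => m0 G (m0 F X)) (fun X Y f => m1 G (m1 F f))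
    (fun X Y f g a => m2 G (m2 F a)).

Record is_2functor (B C : twocat) (F : map2 B C) : Prop := Is2Functor {
  tf_id1 : forall X, m1 F (id1 X) = id1 (m0 F X);
  tf_comp1 : forall (X Y Z : B) (g : hom1 Y Z) (f : hom1 X Y),
    m1 F (g ⊚ f) = m1 F g ⊚ m1 F f;
  tf_id2 : forall (X Y : B) (f : hom1 X Y), m2 F (id2 f) = id2 (m1 F f);
  tf_vcomp : forall (X Y : B) (f g h : hom1 X Y) (b : cell g h) (a : cell f g),
    m2 F (b • a) = m2 F b • m2 F a;
  tf_lwhisk : forall (X Y Z : B) (h : hom1 Y Z) (f g : hom1 X Y) (a : cell f g),
    idcell (tf_comp1 h g) • m2 F (h ◁ a) =
    (m1 F h ◁ m2 F a) • idcell (tf_comp1 h f);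
  tf_rwhisk : forall (X Y Z : B) (f g : hom1 Y Z) (e : hom1 X Y) (a : cell f g),
    idcell (tf_comp1 g e) • m2 F (a ▷ e) =
    (m2 F a ▷ m1 F e) • idcell (tf_comp1 f e)
}.

Definition is_2isomorphism (B C : twocat) (F : map2 B C) : Prop :=
  is_2functor F /\
  exists G : map2 C B, is_2functor G /\
    comp_map G F = id_map B /\ comp_map F G = id_map C.

(** ** Pseudofunctors, pseudo-natural transformations, modifications *)

(** The data of a pseudofunctor; [ps_compV] is the inverse of [ps_comp]. *)
Record psfunctor (B C : twocat) := PsFunctor {
  ps_map :> map2 B C;
  ps_id : forall X : B, cell (id1 (m0 ps_map X)) (m1 ps_map (id1 X));
  ps_comp : forall (X Y Z : B) (g : hom1 Y Z) (f : hom1 X Y),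
    cell (m1 ps_map g ⊚ m1 ps_map f) (m1 ps_map (g ⊚ f));
  ps_compV : forall (X Y Z : B) (g : hom1 Y Z) (f : hom1 X Y),
    cell (m1 ps_map (g ⊚ f)) (m1 ps_map g ⊚ m1 ps_map f)
}.
Arguments ps_id {B C} F X : rename.
Arguments ps_comp {B C} F {X Y Z} g f : rename.
Arguments ps_compV {B C} F {X Y Z} g f : rename.

Record is_psfunctor (B C : twocat) (F : psfunctor B C) : Prop := IsPsFunctor {
  ps_id2 : forall (X Y : B) (f : hom1 X Y), m2 F (id2 f) = id2 (m1 F f);
  ps_vcomp : forall (X Y : B) (f g h : hom1 X Y) (b : cell g h) (a : cell f g),
    m2 F (b • a) = m2 F b • m2 F a;
  ps_id_inv : forall X : B, invertible (ps_id F X);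
  ps_compK : forall (X Y Z : B) (g : hom1 Y Z) (f : hom1 X Y),
    ps_compV F g f • ps_comp F g f = id2 _;
  ps_compVK : forall (X Y Z : B) (g : hom1 Y Z) (f : hom1 X Y),
    ps_comp F g f • ps_compV F g f = id2 _;
  ps_lwhisk : forall (X Y Z : B) (h : hom1 Y Z) (f g : hom1 X Y) (a : cell f g),
    m2 F (h ◁ a) • ps_comp F h f = ps_comp F h g • (m1 F h ◁ m2 F a);
  ps_rwhisk : forall (X Y Z : B) (f g : hom1 Y Z) (e : hom1 X Y) (a : cell f g),
    m2 F (a ▷ e) • ps_comp F f e = ps_comp F g e • (m2 F a ▷ m1 F e);
  ps_unitl : forall (X Y : B) (f : hom1 X Y),
    m2 F (idcell (unit1l f)) • ps_comp F (id1 Y) f • (ps_id F Y ▷ m1 F f) =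
    idcell (unit1l (m1 F f));
  ps_unitr : forall (X Y : B) (f : hom1 X Y),
    m2 F (idcell (unit1r f)) • ps_comp F f (id1 X) • (m1 F f ◁ ps_id F X) =
    idcell (unit1r (m1 F f));
  ps_assoc : forall (X Y Z W : B) (h : hom1 Z W) (g : hom1 Y Z) (f : hom1 X Y),
    m2 F (assoc_l h g f) • ps_comp F h (g ⊚ f) • (m1 F h ◁ ps_comp F g f) =
    ps_comp F (h ⊚ g) f • (ps_comp F h g ▷ m1 F f) •
      assoc_l (m1 F h) (m1 F g) (m1 F f)
}.

Definition id_psfunctor (B : twocat) : psfunctor B B :=
  @PsFunctor B B (id_map B) (fun X => id2 (id1 X))
    (fun X Y Z g f => id2 (g ⊚ f)) (fun X Y Z g f => id2 (g ⊚ f)).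

Definition comp_psfunctor (B C D : twocat) (G : psfunctor C D)
    (F : psfunctor B C) : psfunctor B D :=
  @PsFunctor B D (comp_map G F)
    (fun X => m2 G (ps_id F X) • ps_id G (m0 F X))
    (fun X Y Z g f => m2 G (ps_comp F g f) • ps_comp G (m1 F g) (m1 F f))
    (fun X Y Z g f => ps_compV G (m1 F g) (m1 F f) • m2 G (ps_compV F g f)).

(** The data of a pseudo-natural transformation. *)
Record pstrans (B C : twocat) (F G : map2 B C) := PsTrans {
  t1 :> forall X : B, hom1 (m0 F X) (m0 G X);
  t2 : forall (X Y : B) (f : hom1 X Y), cell (m1 G f ⊚ t1 X) (t1 Y ⊚ m1 F f)
}.
Arguments t2 {B C F G} s {X Y} f : rename.

Record is_pstrans (B C : twocat) (F G : psfunctor B C) (s : pstrans F G) :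
    Prop := IsPsTrans {
  t2_inv : forall (X Y : B) (f : hom1 X Y), invertible (t2 s f);
  t2_nat : forall (X Y : B) (f g : hom1 X Y) (a : cell f g),
    t2 s g • (m2 G a ▷ s X) = (s Y ◁ m2 F a) • t2 s f;
  t2_id1 : forall X : B,
    t2 s (id1 X) • (ps_id G X ▷ s X) =
    (s X ◁ ps_id F X) • idcell (etrans (unit1l (s X)) (esym (unit1r (s X))));
  t2_comp1 : forall (X Y Z : B) (g : hom1 Y Z) (f : hom1 X Y),
    t2 s (g ⊚ f) • (ps_comp G g f ▷ s X) =
    (s Z ◁ ps_comp F g f) • assoc_r (s Z) (m1 F g) (m1 F f) •
    (t2 s g ▷ m1 F f) • assoc_l (m1 G g) (s Y) (m1 F f) •
    (m1 G g ◁ t2 s f) • assoc_r (m1 G g) (m1 G f) (s X)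
}.

Definition id_pstrans (B C : twocat) (F : map2 B C) : pstrans F F :=
  @PsTrans B C F F (fun X => id1 (m0 F X))
    (fun X Y f => idcell (etrans (unit1r (m1 F f)) (esym (unit1l (m1 F f))))).

Definition comp_pstrans (B C : twocat) (F G H : map2 B C)
    (t : pstrans G H) (s : pstrans F G) : pstrans F H :=
  @PsTrans B C F H (fun X => t X ⊚ s X)
    (fun X Y f =>
      assoc_l (t Y) (s Y) (m1 F f) • (t Y ◁ t2 s f) •
      assoc_r (t Y) (m1 G f) (s X) • (t2 t f ▷ s X) •
      assoc_l (m1 H f) (t X) (s X)).

Definition lwhisk_pstrans (A B C : twocat) (K : psfunctor B C)
    (F G : map2 A B) (s : pstrans F G) :
    pstrans (comp_map K F) (comp_map K G) :=
  @PsTrans A C (comp_map K F) (comp_map K G) (fun X => m1 K (s X))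
    (fun X Y f =>
      ps_compV K (s Y) (m1 F f) • m2 K (t2 s f) • ps_comp K (m1 G f) (s X)).

Definition rwhisk_pstrans (A B C : twocat) (F G : map2 B C)
    (s : pstrans F G) (K : map2 A B) :
    pstrans (comp_map F K) (comp_map G K) :=
  @PsTrans A C (comp_map F K) (comp_map G K) (fun X => s (m0 K X))
    (fun X Y f => t2 s (m1 K f)).

Definition is_modification (B C : twocat) (F G : map2 B C) (s t : pstrans F G)
    (c : forall X, cell (s X) (t X)) : Prop :=
  forall (X Y : B) (f : hom1 X Y),
    t2 t f • (m1 G f ◁ c X) = (c Y ▷ m1 F f) • t2 s f.

(** ** Pseudo-comonads *)

Record pseudo_comonad (B : twocat) (W : psfunctor B B)
    (eps : pstrans W (id_psfunctor B))
    (del : pstrans W (comp_psfunctor W W)) := PseudoComonad {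
  pc_functor : is_psfunctor W;
  pc_counit : @is_pstrans B B W (id_psfunctor B) eps;
  pc_comult : @is_pstrans B B W (comp_psfunctor W W) del;
  (** The comparisons [Xi : W del . del => del W . del],
      [eps W . del => id] and [W eps . del => id]. *)
  Xi : forall A : B,
    cell (m1 W (del A) ⊚ del A) (del (m0 W A) ⊚ del A);
  Xi_inv : forall A, invertible (Xi A);
  Xi_mod : @is_modification B B W (comp_map W (comp_map W W))
    (comp_pstrans (lwhisk_pstrans W del) del)
    (comp_pstrans (rwhisk_pstrans del W) del) Xi;
  cunitl : forall A : B, cell (eps (m0 W A) ⊚ del A) (id1 (m0 W A));
  cunitl_inv : forall A, invertible (cunitl A);
  cunitl_mod : @is_modification B B W W
    (comp_pstrans (rwhisk_pstrans eps W) del) (id_pstrans W) cunitl;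
  cunitr : forall A : B, cell (m1 W (eps A) ⊚ del A) (id1 (m0 W A));
  cunitr_inv : forall A, invertible (cunitr A);
  cunitr_mod : @is_modification B B W W
    (comp_pstrans (lwhisk_pstrans W eps) del) (id_pstrans W) cunitr;
  (** The coassociativity axiom: the two ways from [WW del . W del . del] to
      [del WW . del W . del] agree. *)
  pc_coassoc : forall A : B,
    (Xi (m0 W A) ▷ del A) • assoc_l (m1 W (del (m0 W A))) (del (m0 W A)) (del A) •
    (m1 W (del (m0 W A)) ◁ Xi A) •
    assoc_r (m1 W (del (m0 W A))) (m1 W (del A)) (del A) •
    (ps_compV W (del (m0 W A)) (del A) ▷ del A) • (m2 W (Xi A) ▷ del A) •
    (ps_comp W (m1 W (del A)) (del A) ▷ del A)
    =
    assoc_l (del (m0 W (m0 W A))) (del (m0 W A)) (del A) •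
    (del (m0 W (m0 W A)) ◁ Xi A) •
    assoc_r (del (m0 W (m0 W A))) (m1 W (del A)) (del A) •
    (t2 del (del A) ▷ del A) •
    assoc_l (m1 W (m1 W (del A))) (del (m0 W A)) (del A) •
    (m1 W (m1 W (del A)) ◁ Xi A) •
    assoc_r (m1 W (m1 W (del A))) (m1 W (del A)) (del A);
  (** The counit axiom: the two ways from [W eps W . W del . del] to [del]
      (written [W id . del]) agree. *)
  pc_counit_axiom : forall A : B,
    (ps_id W (m0 W A) ▷ del A) • (cunitr (m0 W A) ▷ del A) •
    assoc_l (m1 W (eps (m0 W A))) (del (m0 W A)) (del A) •
    (m1 W (eps (m0 W A)) ◁ Xi A)
    =
    (m2 W (cunitl A) ▷ del A) • (ps_comp W (eps (m0 W A)) (del A) ▷ del A) •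
    assoc_l (m1 W (eps (m0 W A))) (m1 W (del A)) (del A)
}.
Arguments Xi {B W eps del} M A : rename.
Arguments cunitl {B W eps del} M A : rename.
Arguments cunitr {B W eps del} M A : rename.

(** ** Normal pseudo-coalgebras *)

Section Coalgebras.
Variables (B : twocat) (W : psfunctor B B) (eps : pstrans W (id_psfunctor B)).
Variables (del : pstrans W (comp_psfunctor W W)).
Variable M : pseudo_comonad eps del.

Lemma coalg_unit_eq (C : B) (l : hom1 C (m0 W C)) (e : eps C ⊚ l = id1 C) :
  l ⊚ (eps C ⊚ l) = id1 (m0 W C) ⊚ l.
Proof. by rewrite e unit1l unit1r. Qed.

Record coalg := Coalg {
  ca_ob :> B;
  ca_str : hom1 ca_ob (m0 W ca_ob);
  ca_normal : eps ca_ob ⊚ ca_str = id1 ca_ob;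
  ca_cell : cell (m1 W ca_str ⊚ ca_str) (del ca_ob ⊚ ca_str);
  ca_cell_inv : invertible ca_cell;
  (** Compatibility with the counit: [ca_cell] becomes an identity under
      [W eps] and under [eps W]. *)
  ca_counitr :
    (ps_id W ca_ob ▷ ca_str) • (cunitr M ca_ob ▷ ca_str) •
    assoc_l (m1 W (eps ca_ob)) (del ca_ob) ca_str • (m1 W (eps ca_ob) ◁ ca_cell)
    =
    (m2 W (idcell ca_normal) ▷ ca_str) •
    (ps_comp W (eps ca_ob) ca_str ▷ ca_str) •
    assoc_l (m1 W (eps ca_ob)) (m1 W ca_str) ca_str;
  ca_counitl :
    (cunitl M ca_ob ▷ ca_str) •
    assoc_l (eps (m0 W ca_ob)) (del ca_ob) ca_str •
    (eps (m0 W ca_ob) ◁ ca_cell) •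
    assoc_r (eps (m0 W ca_ob)) (m1 W ca_str) ca_str •
    (t2 eps ca_str ▷ ca_str) • assoc_l ca_str (eps ca_ob) ca_str
    =
    idcell (coalg_unit_eq ca_normal);
  (** Compatibility with [Xi]: the two ways from [WW l . W l . l] to
      [del W . del . l] agree. *)
  ca_coassoc :
    (Xi M ca_ob ▷ ca_str) • assoc_l (m1 W (del ca_ob)) (del ca_ob) ca_str •
    (m1 W (del ca_ob) ◁ ca_cell) •
    assoc_r (m1 W (del ca_ob)) (m1 W ca_str) ca_str •
    (ps_compV W (del ca_ob) ca_str ▷ ca_str) • (m2 W ca_cell ▷ ca_str) •
    (ps_comp W (m1 W ca_str) ca_str ▷ ca_str)
    =
    assoc_l (del (m0 W ca_ob)) (del ca_ob) ca_str •
    (del (m0 W ca_ob) ◁ ca_cell) •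
    assoc_r (del (m0 W ca_ob)) (m1 W ca_str) ca_str •
    (t2 del ca_str ▷ ca_str) •
    assoc_l (m1 W (m1 W ca_str)) (del ca_ob) ca_str •
    (m1 W (m1 W ca_str) ◁ ca_cell) •
    assoc_r (m1 W (m1 W ca_str)) (m1 W ca_str) ca_str
}.

Lemma coalg_hom_eq (C D : coalg) (G : hom1 C D) :
  G ⊚ (eps C ⊚ ca_str C) = eps D ⊚ (ca_str D ⊚ G).
Proof. by rewrite assoc1 !ca_normal unit1l unit1r. Qed.

(** Pseudo-morphisms. *)
Record coalg_hom (C D : coalg) := CoalgHom {
  ch_1 :> hom1 C D;
  ch_2 : cell (ca_str D ⊚ ch_1) (m1 W ch_1 ⊚ ca_str C);
  ch_2_inv : invertible ch_2;
  ch_counit :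
    (eps D ◁ ch_2) • idcell (coalg_hom_eq ch_1) =
    assoc_r (eps D) (m1 W ch_1) (ca_str C) • (t2 eps ch_1 ▷ ca_str C) •
    assoc_l ch_1 (eps C) (ca_str C);
  (** The two ways from [W mu . mu . G] to [del . W G . l] agree, for [l] and
      [mu] the structures of [C] and [D]. *)
  ch_comult :
    (del D ◁ ch_2) • assoc_r (del D) (ca_str D) ch_1 • (ca_cell D ▷ ch_1) •
    assoc_l (m1 W (ca_str D)) (ca_str D) ch_1
    =
    assoc_r (del D) (m1 W ch_1) (ca_str C) • (t2 del ch_1 ▷ ca_str C) •
    assoc_l (m1 W (m1 W ch_1)) (del C) (ca_str C) •
    (m1 W (m1 W ch_1) ◁ ca_cell C) •
    assoc_r (m1 W (m1 W ch_1)) (m1 W (ca_str C)) (ca_str C) •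
    (ps_compV W (m1 W ch_1) (ca_str C) ▷ ca_str C) • (m2 W ch_2 ▷ ca_str C) •
    (ps_comp W (ca_str D) ch_1 ▷ ca_str C) •
    assoc_l (m1 W (ca_str D)) (m1 W ch_1) (ca_str C) •
    (m1 W (ca_str D) ◁ ch_2)
}.

Definition is_coalg_cell (C D : coalg) (G H : coalg_hom C D)
    (a : cell (G : hom1 C D) (H : hom1 C D)) : Prop :=
  ch_2 H • (ca_str D ◁ a) = (m2 W a ▷ ca_str C) • ch_2 G.

(** Identities and composites of pseudo-morphisms. *)
Definition coalg_id2 (C : coalg) :
    cell (ca_str C ⊚ id1 C) (m1 W (id1 C) ⊚ ca_str C) :=
  (ps_id W C ▷ ca_str C) •
  idcell (etrans (unit1r (ca_str C)) (esym (unit1l (ca_str C)))).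

Definition coalg_comp2 (C D E : coalg) (H : coalg_hom D E) (G : coalg_hom C D) :
    cell (ca_str E ⊚ (H ⊚ G)) (m1 W (H ⊚ G) ⊚ ca_str C) :=
  (ps_comp W H G ▷ ca_str C) • assoc_l (m1 W H) (m1 W G) (ca_str C) •
  (m1 W H ◁ ch_2 G) • assoc_r (m1 W H) (ca_str D) G •
  (ch_2 H ▷ G) • assoc_l (ca_str E) H G.

End Coalgebras.

(** * The 2-category ClIdl *)

Record clidl := ClIdlOb {
  ci_cat :> category;
  ci_null : mor_class ci_cat;
  ci_closed : is_closed_ideal ci_null;
  ci_kernels : has_kernels ci_null;
  ci_cokernels : has_cokernels ci_null
}.
Arguments ci_null c {A B} f : rename.

Record clidl_hom (C D : clidl) := ClIdlHom {
  ch_functor :> functor C D;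
  ch_kernels : preserves_kernels (@ci_null C) (@ci_null D) ch_functor;
  ch_cokernels : preserves_cokernels (@ci_null C) (@ci_null D) ch_functor
}.

Definition id_clidl_hom (C : clidl) : clidl_hom C C :=
  @ClIdlHom C C (id_functor C) (fun A B K f k kP => kP) (fun A B Q f c cP => cP).

Definition comp_clidl_hom (C D E : clidl) (G : clidl_hom D E)
    (F : clidl_hom C D) : clidl_hom C E :=
  @ClIdlHom C E (comp_functor G F)
    (fun A B K f k kP => ch_kernels G (ch_kernels F kP))
    (fun A B Q f c cP => ch_cokernels G (ch_cokernels F cP)).

Definition ClIdl_data : twocat_data :=
  @TwocatData clidl clidl_hom (fun C D F G => nattrans F G)
    id_clidl_hom comp_clidl_hom
    (fun C D F => id_nattrans F)
    (fun C D F G H b a => comp_nattrans b a)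
    (fun C D E H F G a => @whisker_l C D E H F G a)
    (fun C D E F G a H => @whisker_r C D E F G a H).

Lemma nattrans_eq (C D : category) (F G : functor C D) (a b : nattrans F G) :
  (forall X, a X = b X) -> a = b.
Proof.
case: a b => [a aP] [b bP] /= ab.
have e : a = b by apply: functional_extensionality_dep.
by subst b; rewrite (proof_irrelevance _ aP bP).
Qed.

Lemma functor_eq_laws (C D : category) (o : C -> D) m p p' q q' :
  @Functor C D o m p q = @Functor C D o m p' q'.
Proof. by rewrite (proof_irrelevance _ p p') (proof_irrelevance _ q q'). Qed.

Lemma clidl_hom_eq (C D : clidl) (F G : clidl_hom C D) :
  ch_functor F = ch_functor G -> F = G.
Proof.
case: F G => [F k c] [G k' c'] /= e; subst G.
by rewrite (proof_irrelevance _ k k') (proof_irrelevance _ c c').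
Qed.

(** The component of [idcell e] at [X] is an identity up to the equality of
    objects. *)
Definition ob_idm (C : category) (A B : C) (p : A = B) : hom A B :=
  match p with erefl => idm A end.

Lemma ob_idm_refl (C : category) (A : C) (p : A = A) : ob_idm p = idm A.
Proof. by rewrite (proof_irrelevance _ p erefl). Qed.

Lemma ob_idmM (C : category) (A B D : C) (p : A = B) (q : B = D) :
  ob_idm q ∘ ob_idm p = ob_idm (etrans p q).
Proof. by case: D / q; case: B / p; rewrite /= mcomp1m. Qed.

Lemma fmap_ob_idm (C D : category) (F : functor C D) (A B : C) (p : A = B) :
  fmap F (ob_idm p) = ob_idm (f_equal F p).
Proof. by case: B / p; rewrite /= fmap1. Qed.

Lemma idcell_at (C D : clidl) (F G : @hom1 ClIdl_data C D) (e : F = G) (X : C)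
    (p : (F : clidl_hom C D) X = (G : clidl_hom C D) X) :
  (idcell e : nattrans (F : clidl_hom C D) (G : clidl_hom C D)) X = ob_idm p.
Proof. by case: G / e p => p; rewrite ob_idm_refl. Qed.

Lemma ClIdl_assoc (X Y Z W : ClIdl_data) (h : hom1 Z W) (g : hom1 Y Z)
    (f : hom1 X Y) : h ⊚ (g ⊚ f) = h ⊚ g ⊚ f.
Proof. by apply: clidl_hom_eq; apply: functor_eq_laws. Qed.

Lemma ClIdl_unit1l (X Y : ClIdl_data) (f : hom1 X Y) : id1 Y ⊚ f = f.
Proof.
apply: clidl_hom_eq; rewrite /=; case: (ch_functor f) => o m p q.
exact: functor_eq_laws.
Qed.

Lemma ClIdl_unit1r (X Y : ClIdl_data) (f : hom1 X Y) : f ⊚ id1 X = f.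
Proof.
apply: clidl_hom_eq; rewrite /=; case: (ch_functor f) => o m p q.
exact: functor_eq_laws.
Qed.

(** Removes the components of [idcell] whose source and target objects are
    convertible. *)
Ltac drop_idcells :=
  repeat match goal with
  | |- context [nt (@idcell ClIdl_data ?C ?D ?F ?G ?e) ?X] =>
      rewrite (@idcell_at C D F G e X erefl)
  | |- context [nt (@idcell _ ?C ?D ?F ?G ?e) ?X] =>
      rewrite (@idcell_at C D F G e X erefl)
  end; cbn [ob_idm].

Definition ClIdl : twocat.
Proof.
apply: (@Twocat ClIdl_data ClIdl_assoc ClIdl_unit1l ClIdl_unit1r) => *;
  apply: nattrans_eq => ?;
  rewrite /=; drop_idcells; rewrite /= ?mcomp1m ?mcompm1 ?mcompA ?fmap1 ?fmapM //.
by rewrite nt_nat.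
Defined.

(** * Short exact sequences *)

Record ses (C : clidl) := Ses {
  sX : C; sY : C; sZ : C;
  sf : hom sX sY;
  sg : hom sY sZ;
  sP : is_short_exact (@ci_null C) sf sg
}.

Record ses_hom (C : clidl) (S T : ses C) := SesHom {
  hX : hom (sX S) (sX T);
  hY : hom (sY S) (sY T);
  hZ : hom (sZ S) (sZ T);
  hl : hY ∘ sf S = sf T ∘ hX;
  hr : hZ ∘ sg S = sg T ∘ hY
}.

Lemma ci_ideal (C : clidl) : is_ideal (@ci_null C).
Proof. exact: (ci_closed C).1. Qed.

Lemma nullL (C : clidl) (A B D : C) (g : hom B D) (f : hom A B) :
  ci_null C f -> ci_null C (g ∘ f).
Proof. exact: (ci_ideal C).1. Qed.

Lemma nullR (C : clidl) (A B D : C) (g : hom B D) (f : hom A B) :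
  ci_null C g -> ci_null C (g ∘ f).
Proof. exact: (ci_ideal C).2. Qed.

Lemma sf_mono (C : clidl) (S : ses C) (A : C) (u v : hom A (sX S)) :
  sf S ∘ u = sf S ∘ v -> u = v.
Proof. exact: (kernel_mono (ci_ideal C) (sP S).1). Qed.

Lemma sg_epi (C : clidl) (S : ses C) (A : C) (u v : hom (sZ S) A) :
  u ∘ sg S = v ∘ sg S -> u = v.
Proof. exact: (cokernel_epi (ci_ideal C) (sP S).2). Qed.

Lemma ses_null (C : clidl) (S : ses C) : ci_null C (sg S ∘ sf S).
Proof. exact: (sP S).1.1. Qed.

(** A morphism of short exact sequences is determined by its middle component. *)
Lemma ses_hom_eq (C : clidl) (S T : ses C) (u v : ses_hom S T) :
  hY u = hY v -> u = v.
Proof.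
case: u v => [u1 u2 u3 ul ur] [v1 v2 v3 vl vr] /= e; subst v2.
have e1 : u1 = v1 by apply: (@sf_mono C T); rewrite -ul -vl.
have e3 : u3 = v3 by apply: (@sg_epi C S); rewrite ur vr.
subst v1 v3; congr SesHom; exact: proof_irrelevance.
Qed.

Definition ses_id (C : clidl) (S : ses C) : ses_hom S S :=
  @SesHom C S S (idm _) (idm _) (idm _)
    (etrans (mcomp1m _) (esym (mcompm1 _))) (etrans (mcomp1m _) (esym (mcompm1 _))).

Lemma ses_comp_l (C : clidl) (S T U : ses C) (v : ses_hom T U) (u : ses_hom S T) :
  hY v ∘ hY u ∘ sf S = sf U ∘ (hX v ∘ hX u).
Proof. by rewrite -mcompA hl mcompA hl mcompA. Qed.

Lemma ses_comp_r (C : clidl) (S T U : ses C) (v : ses_hom T U) (u : ses_hom S T) :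
  hZ v ∘ hZ u ∘ sg S = sg U ∘ (hY v ∘ hY u).
Proof. by rewrite -mcompA hr mcompA hr mcompA. Qed.

Definition ses_comp (C : clidl) (S T U : ses C) (v : ses_hom T U)
    (u : ses_hom S T) : ses_hom S U :=
  SesHom (ses_comp_l v u) (ses_comp_r v u).

Definition ses_cat (C : clidl) : category.
Proof.
apply: (@Category (ses C) (@ses_hom C) (@ses_id C) (@ses_comp C)) => *;
  apply: ses_hom_eq; rewrite /= ?mcomp1m ?mcompm1 ?mcompA //.
Defined.

(** The ideal [[N]]. *)
Definition iso_ses (C : clidl) (E : ses_cat C) : Prop :=
  is_iso (sf E) /\ is_iso (sg E).

Definition ses_ideal (C : clidl) : mor_class (ses_cat C) :=
  factors_through (@iso_ses C).

(** ** Relative kernels and cokernels in Ses(C) *)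

Lemma factors_ideal (C : category) (P : C -> Prop) :
  is_ideal (@factors_through C P).
Proof.
split=> A B D g f [E [PE [h [k ->]]]]; exists E; split=> //.
  by exists (g ∘ h), k; rewrite mcompA.
by exists h, (k ∘ f); rewrite mcompA.
Qed.

Lemma factors_closed (C : category) (P : C -> Prop) :
  is_closed_ideal (@factors_through C P).
Proof.
split; first exact: factors_ideal.
move=> A B f [E [PE [h [k e]]]]; exists E; split; last by exists h, k.
by exists E; split=> //; exists (idm E), (idm E); rewrite mcomp1m.
Qed.

Lemma iso_epi (C : category) (A B D : C) (i : hom A B) (u v : hom B D) :
  is_iso i -> u ∘ i = v ∘ i -> u = v.
Proof.
by case=> j [_ ij] e; rewrite -(mcompm1 u) -(mcompm1 v) -ij !mcompA e.
Qed.

Lemma iso_null (C : clidl) (A B : C) (i : hom A B) :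
  is_iso i -> ci_null C i -> null_object (@ci_null C) A.
Proof. by case=> j [ji _] Ni; rewrite /null_object -ji; apply: nullL. Qed.

Lemma null_id_kernel (C : clidl) (A B : C) (f : hom A B) :
  ci_null C f -> is_kernel (@ci_null C) f (idm A).
Proof.
move=> Nf; split=> [|H h _]; first by rewrite mcompm1.
by exists h; split=> [|h' <-]; rewrite mcomp1m.
Qed.

Lemma null_id_cokernel (C : clidl) (A B : C) (f : hom A B) :
  ci_null C f -> is_cokernel (@ci_null C) f (idm B).
Proof.
move=> Nf; split=> [|H h _]; first by rewrite mcomp1m.
by exists h; split=> [|h' <-]; rewrite mcompm1.
Qed.

Lemma null_ses_proof (C : clidl) (A : C) : null_object (@ci_null C) A ->
  is_short_exact (@ci_null C) (idm A) (idm A).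
Proof. by move=> NA; split; [apply: null_id_kernel|apply: null_id_cokernel]. Qed.

Lemma ses_idealP (C : clidl) (S T : ses_cat C) (u : hom S T) :
  @ses_ideal C S T u <-> ci_null C (hY u).
Proof.
split=> [[E [[If Ig] [h [k ->]]]]|Nu].
  rewrite /=; apply: nullR; rewrite -(mcompm1 (hY h)); apply: nullL.
  case: Ig => j [ji _]; case: If => i [_ fi]; rewrite -ji -(mcompm1 (sg E)) -fi.
  by rewrite 2!mcompA; apply: nullR; rewrite -mcompA; apply: nullL; apply: ses_null.
case: ((ci_closed C).2 _ _ _ Nu) => D [ND [h [k e]]].
have kN : ci_null C (k ∘ sf S).
  by rewrite -(mcomp1m (k ∘ sf S)); apply: nullR.
have hN : ci_null C (sg T ∘ h).
  by rewrite -(mcompm1 (sg T ∘ h)); apply: nullL.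
pose k' := cokernel_factor (sP S).2 kN; pose h' := kernel_factor (sP T).1 hN.
pose E : ses_cat C := Ses (null_ses_proof ND).
have Ek1 : k ∘ sf S = idm D ∘ (k ∘ sf S) by rewrite mcomp1m.
have Ek2 : k' ∘ sg S = idm D ∘ k by rewrite mcomp1m cokernel_factorE.
have Eh1 : h ∘ idm D = sf T ∘ h' by rewrite mcompm1 kernel_factorE.
have Eh2 : (sg T ∘ h) ∘ idm D = sg T ∘ h by rewrite mcompm1.
exists E; split; first by split; exists (idm D); rewrite mcomp1m.
exists (@SesHom C E T h' h (sg T ∘ h) Eh1 Eh2),
  (@SesHom C S E (k ∘ sf S) k k' Ek1 Ek2).
exact: ses_hom_eq.
Qed.

Lemma kernel_of_factor (C : clidl) (A B K : C) (f : hom A B) (k : hom K A) Q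
    (c : hom A Q) : is_kernel (@ci_null C) f k -> is_cokernel (@ci_null C) k c ->
  is_short_exact (@ci_null C) k c.
Proof.
move=> kP cP; split=> //; split; first exact: cP.1.
move=> H h ch; apply: kP.2.
by rewrite -(cokernel_factorE cP kP.1) -mcompA; apply: nullL.
Qed.

Lemma cokernel_of_factor (C : clidl) (A B Q : C) (f : hom A B) (c : hom B Q) K
    (k : hom K B) : is_cokernel (@ci_null C) f c -> is_kernel (@ci_null C) c k ->
  is_short_exact (@ci_null C) k c.
Proof.
move=> cP kP; split=> //; split; first exact: kP.1.
move=> H h hk; apply: cP.2.
by rewrite -(kernel_factorE kP cP.1) mcompA; apply: nullR.
Qed.

Lemma ses_kernel_intro (C : clidl) (R S T : ses_cat C) (u : hom S T)
    (p : hom R S) :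
  is_kernel (@ci_null C) (hY u) (hY p) ->
  is_kernel (@ci_null C) (sg S ∘ hY p) (sf R) ->
  is_kernel (@ses_ideal C) u p.
Proof.
move=> k1 k2; split; first by apply/ses_idealP; apply: k1.1.
move=> H h /ses_idealP hN.
pose b := kernel_factor k1 hN.
have pb : hY p ∘ b = hY h by apply: kernel_factorE.
have aN : ci_null C (sg S ∘ hY p ∘ (b ∘ sf H)).
  rewrite -mcompA (mcompA (hY p)) pb mcompA -(hr h) -mcompA.
  by apply: nullL; apply: ses_null.
pose a := kernel_factor k2 aN.
have ab : b ∘ sf H = sf R ∘ a by rewrite kernel_factorE.
have cN : ci_null C (sg R ∘ b ∘ sf H).
  by rewrite -mcompA ab mcompA; apply: nullR; apply: ses_null.
have bc : cokernel_factor (sP H).2 cN ∘ sg H = sg R ∘ b.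
  by rewrite cokernel_factorE.
exists (SesHom ab bc); split; first exact: ses_hom_eq.
move=> h' e; apply: ses_hom_eq.
by apply: (kernel_mono (ci_ideal C) k1); rewrite /= pb -e.
Qed.

Lemma ses_cokernel_intro (C : clidl) (R S T : ses_cat C) (u : hom R S)
    (q : hom S T) :
  is_cokernel (@ci_null C) (hY u) (hY q) ->
  is_cokernel (@ci_null C) (hY q ∘ sf S) (sg T) ->
  is_cokernel (@ses_ideal C) u q.
Proof.
move=> k1 k2; split; first by apply/ses_idealP; apply: k1.1.
move=> H h /ses_idealP hN.
pose b := cokernel_factor k1 hN.
have bq : b ∘ hY q = hY h by apply: cokernel_factorE.
have cN : ci_null C (sg H ∘ b ∘ (hY q ∘ sf S)).
  rewrite mcompA -(mcompA (sg H)) bq -mcompA hl mcompA.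
  by apply: nullR; apply: ses_null.
pose c := cokernel_factor k2 cN.
have bc : c ∘ sg T = sg H ∘ b by rewrite cokernel_factorE.
have aN : ci_null C (sg H ∘ (b ∘ sf T)).
  by rewrite mcompA -bc -mcompA; apply: nullL; apply: ses_null.
have ab : b ∘ sf T = sf H ∘ kernel_factor (sP H).1 aN by rewrite kernel_factorE.
exists (SesHom ab bc); split; first exact: ses_hom_eq.
move=> h' e; apply: ses_hom_eq.
by apply: (cokernel_epi (ci_ideal C) k1); rewrite /= bq -e.
Qed.

Lemma ses_kernel_ex (C : clidl) (S T : ses_cat C) (u : hom S T) :
  exists (R : ses_cat C) (p : hom R S),
    is_kernel (@ci_null C) (hY u) (hY p) /\
    is_kernel (@ci_null C) (sg S ∘ hY p) (sf R).
Proof.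
case: (ci_kernels (hY u)) => K [k kP].
case: (ci_kernels (sg S ∘ k)) => X [x xP].
case: (ci_cokernels x) => Z [z zP].
have kN : ci_null C (sg S ∘ (k ∘ x)) by rewrite mcompA; apply: xP.1.
have kl : k ∘ x = sf S ∘ kernel_factor (sP S).1 kN by rewrite kernel_factorE.
have kr : cokernel_factor zP xP.1 ∘ z = sg S ∘ k by rewrite cokernel_factorE.
pose R := Ses (kernel_of_factor xP zP).
by exists R, (@SesHom C R S _ _ _ kl kr).
Qed.

Lemma ses_cokernel_ex (C : clidl) (R S : ses_cat C) (u : hom R S) :
  exists (T : ses_cat C) (q : hom S T),
    is_cokernel (@ci_null C) (hY u) (hY q) /\
    is_cokernel (@ci_null C) (hY q ∘ sf S) (sg T).
Proof.
case: (ci_cokernels (hY u)) => Q [q qP].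
case: (ci_cokernels (q ∘ sf S)) => Z [z zP].
case: (ci_kernels z) => X [x xP].
have kN : ci_null C (z ∘ q ∘ sf S) by rewrite -mcompA; apply: zP.1.
have kr : cokernel_factor (sP S).2 kN ∘ sg S = z ∘ q by rewrite cokernel_factorE.
have kl : q ∘ sf S = x ∘ kernel_factor xP zP.1 by rewrite kernel_factorE.
pose T := Ses (cokernel_of_factor zP xP).
by exists T, (@SesHom C S T _ _ _ kl kr).
Qed.

Lemma is_kernel_iso (C : category) (N : mor_class C) (A B K L : C)
    (f : hom A B) (k : hom K A) (l : hom L A) (a : hom K L) (b : hom L K) :
  is_ideal N -> b ∘ a = idm K -> a ∘ b = idm L -> l ∘ a = k ->
  is_kernel N f k -> is_kernel N f l.
Proof.
move=> NI ba ab e [fk kU].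
have le : l = k ∘ b by rewrite -e -mcompA ab mcompm1.
split=> [|H h fh]; first by rewrite le mcompA; apply: NI.2.
case: (kU _ _ fh) => w [wP wU]; exists (a ∘ w); split; first by rewrite mcompA e.
move=> w' e'; have -> : w = b ∘ w' by apply: wU; rewrite mcompA -le.
by rewrite mcompA ab mcomp1m.
Qed.

Lemma is_cokernel_iso (C : category) (N : mor_class C) (A B K L : C)
    (f : hom A B) (k : hom B K) (l : hom B L) (a : hom K L) (b : hom L K) :
  is_ideal N -> b ∘ a = idm K -> a ∘ b = idm L -> b ∘ l = k ->
  is_cokernel N f k -> is_cokernel N f l.
Proof.
move=> NI ba ab e [fk kU].
have le : l = a ∘ k by rewrite -e mcompA ab mcomp1m.
split=> [|H h fh]; first by rewrite le -mcompA; apply: NI.1.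
case: (kU _ _ fh) => w [wP wU]; exists (w ∘ b); split; first by rewrite -mcompA e.
move=> w' e'; have -> : w = w' ∘ a by apply: wU; rewrite -mcompA -le.
by rewrite -mcompA ab mcompm1.
Qed.

Lemma kernel_unique (C : category) (N : mor_class C) (A B K L : C)
    (f : hom A B) (k : hom K A) (l : hom L A) :
  is_ideal N -> is_kernel N f k -> is_kernel N f l ->
  exists (a : hom K L) (b : hom L K),
    [/\ b ∘ a = idm K, a ∘ b = idm L & l ∘ a = k].
Proof.
move=> NI kP lP; exists (kernel_factor lP kP.1), (kernel_factor kP lP.1).
split; last exact: kernel_factorE.
  by apply: (kernel_mono NI kP); rewrite mcompA !kernel_factorE mcompm1.
by apply: (kernel_mono NI lP); rewrite mcompA !kernel_factorE mcompm1.
Qed.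

Lemma cokernel_unique (C : category) (N : mor_class C) (A B K L : C)
    (f : hom A B) (k : hom B K) (l : hom B L) :
  is_ideal N -> is_cokernel N f k -> is_cokernel N f l ->
  exists (a : hom K L) (b : hom L K),
    [/\ b ∘ a = idm K, a ∘ b = idm L & b ∘ l = k].
Proof.
move=> NI kP lP; exists (cokernel_factor kP lP.1), (cokernel_factor lP kP.1).
split; last exact: cokernel_factorE.
  by apply: (cokernel_epi NI kP); rewrite -mcompA !cokernel_factorE mcomp1m.
by apply: (cokernel_epi NI lP); rewrite -mcompA !cokernel_factorE mcomp1m.
Qed.

(** Kernels in Ses(C) are computed as in [ses_kernel_ex]. *)
Lemma ses_kernelP (C : clidl) (R S T : ses_cat C) (u : hom S T) (p : hom R S) :
  is_kernel (@ses_ideal C) u p <->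
  is_kernel (@ci_null C) (hY u) (hY p) /\
  is_kernel (@ci_null C) (sg S ∘ hY p) (sf R).
Proof.
split=> [pP|[]]; last exact: ses_kernel_intro.
case: (ses_kernel_ex u) => R' [p' [k1 k2]].
case: (kernel_unique (factors_ideal _) (ses_kernel_intro k1 k2) pP)
  => a [b [ba ab e]].
have baY : hY b ∘ hY a = idm _ by rewrite -[LHS]/(hY (b ∘ a)) ba.
have abY : hY a ∘ hY b = idm _ by rewrite -[LHS]/(hY (a ∘ b)) ab.
have eY : hY p ∘ hY a = hY p' by rewrite -e.
have baX : hX b ∘ hX a = idm _ by rewrite -[LHS]/(hX (b ∘ a)) ba.
have abX : hX a ∘ hX b = idm _ by rewrite -[LHS]/(hX (a ∘ b)) ab.
split; first exact: (is_kernel_iso (ci_ideal C) baY abY eY k1).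
have k2' : is_kernel (@ci_null C) (sg S ∘ hY p) (hY a ∘ sf R').
  split=> [|H h hN]; first by rewrite -mcompA (mcompA (hY p)) eY mcompA; apply: k2.1.
  have hN' : ci_null C (sg S ∘ hY p' ∘ (hY b ∘ h)).
    by move: hN; rewrite -eY -!mcompA (mcompA (hY a)) abY mcomp1m.
  case: (k2.2 _ _ hN') => w [wP wU]; exists w; split.
    by rewrite -mcompA wP mcompA abY mcomp1m.
  by move=> w' e'; apply: wU; rewrite -e' !mcompA baY mcomp1m.
apply: (is_kernel_iso (ci_ideal C) baX abX _ k2'); by rewrite hl.
Qed.

Lemma ses_cokernelP (C : clidl) (R S T : ses_cat C) (u : hom R S) (q : hom S T) :
  is_cokernel (@ses_ideal C) u q <->
  is_cokernel (@ci_null C) (hY u) (hY q) /\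
  is_cokernel (@ci_null C) (hY q ∘ sf S) (sg T).
Proof.
split=> [qP|[]]; last exact: ses_cokernel_intro.
case: (ses_cokernel_ex u) => T' [q' [k1 k2]].
case: (cokernel_unique (factors_ideal _) (ses_cokernel_intro k1 k2) qP)
  => a [b [ba ab e]].
have baY : hY b ∘ hY a = idm _ by rewrite -[LHS]/(hY (b ∘ a)) ba.
have abY : hY a ∘ hY b = idm _ by rewrite -[LHS]/(hY (a ∘ b)) ab.
have eY : hY b ∘ hY q = hY q' by rewrite -e.
have baZ : hZ b ∘ hZ a = idm _ by rewrite -[LHS]/(hZ (b ∘ a)) ba.
have abZ : hZ a ∘ hZ b = idm _ by rewrite -[LHS]/(hZ (a ∘ b)) ab.
split; first exact: (is_cokernel_iso (ci_ideal C) baY abY eY k1).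
have k2' : is_cokernel (@ci_null C) (hY q ∘ sf S) (sg T' ∘ hY b).
  split=> [|H h hN].
    by rewrite -mcompA (mcompA (hY b)) eY; apply: k2.1.
  have hN' : ci_null C (h ∘ hY a ∘ (hY q' ∘ sf S)).
    by move: hN; rewrite -eY -!mcompA (mcompA (hY a)) abY mcomp1m.
  case: (k2.2 _ _ hN') => w [wP wU]; exists w; split.
    by rewrite mcompA wP -mcompA abY mcompm1.
  by move=> w' e'; apply: wU; rewrite -e' -!mcompA baY mcompm1.
apply: (is_cokernel_iso (ci_ideal C) baZ abZ _ k2'); by rewrite hr.
Qed.

(** ** The 2-functor Omega *)

Lemma ses_has_kernels (C : clidl) : has_kernels (@ses_ideal C).
Proof.
move=> S T u; case: (ses_kernel_ex u) => R [p [k1 k2]].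
by exists R, p; apply: ses_kernel_intro.
Qed.

Lemma ses_has_cokernels (C : clidl) : has_cokernels (@ses_ideal C).
Proof.
move=> R S u; case: (ses_cokernel_ex u) => T [q [k1 k2]].
by exists T, q; apply: ses_cokernel_intro.
Qed.

Definition Ses_clidl (C : clidl) : clidl :=
  @ClIdlOb (ses_cat C) (@ses_ideal C) (factors_closed _)
    (@ses_has_kernels C) (@ses_has_cokernels C).

Lemma Omega_sP (C D : clidl) (G : clidl_hom C D) (S : ses C) :
  is_short_exact (@ci_null D) (fmap G (sf S)) (fmap G (sg S)).
Proof. by split; [apply: ch_kernels (sP S).1|apply: ch_cokernels (sP S).2]. Qed.

Definition Omega_ob (C D : clidl) (G : clidl_hom C D) (S : ses C) : ses D :=
  Ses (Omega_sP G S).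

Lemma Omega_hl (C D : clidl) (G : functor C D) (S T : ses C) (u : ses_hom S T) :
  fmap G (hY u) ∘ fmap G (sf S) = fmap G (sf T) ∘ fmap G (hX u).
Proof. by rewrite -!fmapM hl. Qed.

Lemma Omega_hr (C D : clidl) (G : functor C D) (S T : ses C) (u : ses_hom S T) :
  fmap G (hZ u) ∘ fmap G (sg S) = fmap G (sg T) ∘ fmap G (hY u).
Proof. by rewrite -!fmapM hr. Qed.

Definition Omega_mor (C D : clidl) (G : clidl_hom C D) (S T : ses C)
    (u : ses_hom S T) : ses_hom (Omega_ob G S) (Omega_ob G T) :=
  @SesHom D (Omega_ob G S) (Omega_ob G T)
    (fmap G (hX u)) (fmap G (hY u)) (fmap G (hZ u)) (Omega_hl G u) (Omega_hr G u).

Definition Omega_functor (C D : clidl) (G : clidl_hom C D) :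
    functor (Ses_clidl C) (Ses_clidl D).
Proof.
apply: (@Functor (Ses_clidl C) (Ses_clidl D) (Omega_ob G) (@Omega_mor C D G)).
  by move=> S; apply: ses_hom_eq; rewrite /= fmap1.
by move=> R S T v u; apply: ses_hom_eq; rewrite /= fmapM.
Defined.

Lemma Omega_kernels (C D : clidl) (G : clidl_hom C D) :
  preserves_kernels (@ses_ideal C) (@ses_ideal D) (Omega_functor G).
Proof.
move=> S T R u p /ses_kernelP [k1 k2]; apply: ses_kernel_intro.
  exact: ch_kernels k1.
by rewrite /= -fmapM; apply: ch_kernels k2.
Qed.

Lemma Omega_cokernels (C D : clidl) (G : clidl_hom C D) :
  preserves_cokernels (@ses_ideal C) (@ses_ideal D) (Omega_functor G).
Proof.
move=> R S T u q /ses_cokernelP [k1 k2]; apply: ses_cokernel_intro.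
  exact: ch_cokernels k1.
by rewrite /= -fmapM; apply: ch_cokernels k2.
Qed.

Definition Omega_hom (C D : clidl) (G : clidl_hom C D) :
    clidl_hom (Ses_clidl C) (Ses_clidl D) :=
  @ClIdlHom (Ses_clidl C) (Ses_clidl D) (Omega_functor G)
    (@Omega_kernels C D G) (@Omega_cokernels C D G).

Definition Omega_cell_at (C D : clidl) (G H : clidl_hom C D)
    (a : nattrans G H) (S : Ses_clidl C) : hom (Omega_hom G S) (Omega_hom H S) :=
  @SesHom D (Omega_ob G S) (Omega_ob H S) (a (sX S)) (a (sY S)) (a (sZ S))
    (nt_nat a (sf S)) (nt_nat a (sg S)).

Lemma Omega_cell_nat (C D : clidl) (G H : clidl_hom C D) (a : nattrans G H)
    (S T : Ses_clidl C) (u : hom S T) :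
  Omega_cell_at a T ∘ fmap (Omega_hom G) u =
  fmap (Omega_hom H) u ∘ Omega_cell_at a S.
Proof. by apply: ses_hom_eq; rewrite /= nt_nat. Qed.

Definition Omega_cell (C D : clidl) (G H : clidl_hom C D) (a : nattrans G H) :
    nattrans (Omega_hom G) (Omega_hom H) :=
  @NatTrans (Ses_clidl C) (Ses_clidl D) (Omega_hom G) (Omega_hom H)
    (Omega_cell_at a) (Omega_cell_nat a).

Definition Omega_map : map2 ClIdl ClIdl :=
  @Map2 ClIdl ClIdl Ses_clidl Omega_hom (fun C D G H a => @Omega_cell C D G H a).

Lemma id_square (C : category) (A B : C) (f : hom A B) :
  idm B ∘ f = f ∘ idm A.
Proof. by rewrite mcomp1m mcompm1. Qed.

(** The comparison 2-cells of Omega have identity components: both sides agree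
    on the objects and morphisms of a short exact sequence. *)
Definition Omega_id_at (C : clidl) (S : ses C) :
    ses_hom S (Omega_ob (id_clidl_hom C) S) :=
  @SesHom C S (Omega_ob (id_clidl_hom C) S) (idm _) (idm _) (idm _)
    (id_square (sf S)) (id_square (sg S)).

Lemma Omega_id_nat (C : clidl) (S T : Ses_clidl C) (u : hom S T) :
  (Omega_id_at T : hom (T : Ses_clidl C) _) ∘ u =
  fmap (Omega_hom (id_clidl_hom C)) u ∘ (Omega_id_at S : hom (S : Ses_clidl C) _).
Proof. by apply: ses_hom_eq; apply: id_square. Qed.

Definition Omega_id (C : clidl) :
    nattrans (id_clidl_hom (Ses_clidl C)) (Omega_hom (id_clidl_hom C)) :=
  @NatTrans (Ses_clidl C) (Ses_clidl C) (id_clidl_hom (Ses_clidl C))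
    (Omega_hom (id_clidl_hom C)) (@Omega_id_at C) (@Omega_id_nat C).

Section OmegaComp.
Variables (C D E : clidl) (G : clidl_hom D E) (F : clidl_hom C D).

Definition Omega_comp_at (S : Ses_clidl C) :
    hom (comp_clidl_hom (Omega_hom G) (Omega_hom F) S)
        (Omega_hom (comp_clidl_hom G F) S) :=
  @SesHom E (Omega_ob G (Omega_ob F S)) (Omega_ob (comp_clidl_hom G F) S)
    (idm _) (idm _) (idm _)
    (id_square (fmap G (fmap F (sf S)))) (id_square (fmap G (fmap F (sg S)))).

Definition Omega_compV_at (S : Ses_clidl C) :
    hom (Omega_hom (comp_clidl_hom G F) S)
        (comp_clidl_hom (Omega_hom G) (Omega_hom F) S) :=
  @SesHom E (Omega_ob (comp_clidl_hom G F) S) (Omega_ob G (Omega_ob F S))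
    (idm _) (idm _) (idm _)
    (id_square (fmap G (fmap F (sf S)))) (id_square (fmap G (fmap F (sg S)))).

Lemma Omega_comp_nat (S T : Ses_clidl C) (u : hom S T) :
  Omega_comp_at T ∘ fmap (comp_clidl_hom (Omega_hom G) (Omega_hom F)) u =
  fmap (Omega_hom (comp_clidl_hom G F)) u ∘ Omega_comp_at S.
Proof. by apply: ses_hom_eq; apply: id_square. Qed.

Lemma Omega_compV_nat (S T : Ses_clidl C) (u : hom S T) :
  Omega_compV_at T ∘ fmap (Omega_hom (comp_clidl_hom G F)) u =
  fmap (comp_clidl_hom (Omega_hom G) (Omega_hom F)) u ∘ Omega_compV_at S.
Proof. by apply: ses_hom_eq; apply: id_square. Qed.

Definition Omega_comp :
    nattrans (comp_clidl_hom (Omega_hom G) (Omega_hom F))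
             (Omega_hom (comp_clidl_hom G F)) := NatTrans Omega_comp_nat.

Definition Omega_compV :
    nattrans (Omega_hom (comp_clidl_hom G F))
             (comp_clidl_hom (Omega_hom G) (Omega_hom F)) :=
  NatTrans Omega_compV_nat.
End OmegaComp.

Definition Omega : psfunctor ClIdl ClIdl :=
  @PsFunctor ClIdl ClIdl Omega_map Omega_id
    (fun C D E G F => @Omega_comp C D E G F)
    (fun C D E G F => @Omega_compV C D E G F).

(** ** The counit *)

Definition epsilon_functor (C : clidl) : functor (Ses_clidl C) C :=
  @Functor (Ses_clidl C) C (@sY C) (fun S T u => hY u)
    (fun S => erefl) (fun R S T v u => erefl).

Definition epsilon_hom (C : clidl) : clidl_hom (Ses_clidl C) C :=
  @ClIdlHom (Ses_clidl C) C (epsilon_functor C)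
    (fun S T R u p pP => ((ses_kernelP u p).1 pP).1)
    (fun R S T u q qP => ((ses_cokernelP u q).1 qP).1).

Definition epsilon_nat (C D : clidl) (G : clidl_hom C D) :
    nattrans (comp_clidl_hom G (epsilon_hom C))
             (comp_clidl_hom (epsilon_hom D) (Omega_hom G)) :=
  @NatTrans (Ses_clidl C) D (comp_clidl_hom G (epsilon_hom C))
    (comp_clidl_hom (epsilon_hom D) (Omega_hom G))
    (fun S => idm (G (sY S))) (fun S T u => id_square (fmap G (hY u))).

Definition epsilon : pstrans Omega (id_psfunctor ClIdl) :=
  @PsTrans ClIdl ClIdl Omega (id_psfunctor ClIdl) epsilon_hom
    (fun C D G => @epsilon_nat C D G).

(** ** The comultiplication *)

(** Chosen kernels and cokernels. *)
Lemma chosen_kernel_sig (C : clidl) (A B : C) (f : hom A B) :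
  {K : C & {k : hom K A | is_kernel (@ci_null C) f k}}.
Proof.
have := constructive_indefinite_description _ (ci_kernels f).
case=> K /constructive_indefinite_description [k kP]; by exists K, k.
Qed.

Lemma chosen_cokernel_sig (C : clidl) (A B : C) (f : hom A B) :
  {Q : C & {c : hom B Q | is_cokernel (@ci_null C) f c}}.
Proof.
have := constructive_indefinite_description _ (ci_cokernels f).
case=> Q /constructive_indefinite_description [c cP]; by exists Q, c.
Qed.

Definition Ker (C : clidl) (A B : C) (f : hom A B) : C :=
  projT1 (chosen_kernel_sig f).
Definition ker (C : clidl) (A B : C) (f : hom A B) : hom (Ker f) A :=
  proj1_sig (projT2 (chosen_kernel_sig f)).
Lemma kerP (C : clidl) (A B : C) (f : hom A B) :
  is_kernel (@ci_null C) f (ker f).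
Proof. exact: proj2_sig (projT2 (chosen_kernel_sig f)). Qed.

Definition Coker (C : clidl) (A B : C) (f : hom A B) : C :=
  projT1 (chosen_cokernel_sig f).
Definition coker (C : clidl) (A B : C) (f : hom A B) : hom B (Coker f) :=
  proj1_sig (projT2 (chosen_cokernel_sig f)).
Lemma cokerP (C : clidl) (A B : C) (f : hom A B) :
  is_cokernel (@ci_null C) f (coker f).
Proof. exact: proj2_sig (projT2 (chosen_cokernel_sig f)). Qed.

Section Delta.
Variable C : clidl.
Implicit Types X Y Z : C.

Lemma coker_id_null X : ci_null C (coker (idm X)).
Proof. by rewrite -(mcompm1 (coker _)); apply: (cokerP (idm X)).1. Qed.

Lemma ker_id_null Z : ci_null C (ker (idm Z)).
Proof. by rewrite -(mcomp1m (ker _)); apply: (kerP (idm Z)).1. Qed.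

Lemma delta_top_sP X : is_short_exact (@ci_null C) (idm X) (coker (idm X)).
Proof.
by split; [apply: null_id_kernel; apply: coker_id_null | apply: cokerP].
Qed.

Lemma delta_bot_sP Z : is_short_exact (@ci_null C) (ker (idm Z)) (idm Z).
Proof.
by split; [apply: kerP | apply: null_id_cokernel; apply: ker_id_null].
Qed.

Definition delta_top X : Ses_clidl C := Ses (delta_top_sP X).
Definition delta_bot Z : Ses_clidl C := Ses (delta_bot_sP Z).

Lemma to_coker_null X A (h : hom X A) :
  ci_null C h -> ci_null C (h ∘ idm X).
Proof. by rewrite mcompm1. Qed.

Lemma to_ker_null Z A (h : hom A Z) :
  ci_null C h -> ci_null C (idm Z ∘ h).
Proof. by rewrite mcomp1m. Qed.

(** The morphisms induced on [C(id)] and [K(id)] by null morphisms. *)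
Definition from_coker_id X A (h : hom X A) (Nh : ci_null C h) :
    hom (Coker (idm X)) A := cokernel_factor (cokerP (idm X)) (to_coker_null Nh).

Definition to_ker_id Z A (h : hom A Z) (Nh : ci_null C h) :
    hom A (Ker (idm Z)) := kernel_factor (kerP (idm Z)) (to_ker_null Nh).

Lemma from_coker_idE X A (h : hom X A) (Nh : ci_null C h) :
  from_coker_id Nh ∘ coker (idm X) = h.
Proof. exact: cokernel_factorE. Qed.

Lemma to_ker_idE Z A (h : hom A Z) (Nh : ci_null C h) :
  ker (idm Z) ∘ to_ker_id Nh = h.
Proof. exact: kernel_factorE. Qed.

Definition delta_top_mor X Y (u : hom X Y) : hom (delta_top X) (delta_top Y) :=
  @SesHom C (delta_top X) (delta_top Y) u u
    (from_coker_id (nullR u (coker_id_null Y)))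
    (esym (id_square u)) (from_coker_idE _).

Definition delta_bot_mor Y Z (w : hom Y Z) : hom (delta_bot Y) (delta_bot Z) :=
  @SesHom C (delta_bot Y) (delta_bot Z)
    (to_ker_id (nullL w (ker_id_null Y))) w w
    (esym (to_ker_idE _)) (esym (id_square w)).

Definition delta_in (S : Ses_clidl C) : hom (delta_top (sX S)) S :=
  @SesHom C (delta_top (sX S)) S (idm (sX S)) (sf S)
    (from_coker_id (ses_null S)) erefl (from_coker_idE _).

Definition delta_out (S : Ses_clidl C) : hom S (delta_bot (sZ S)) :=
  @SesHom C S (delta_bot (sZ S)) (to_ker_id (ses_null S)) (sg S) (idm (sZ S))
    (esym (to_ker_idE _)) erefl.

Lemma delta_sP (S : Ses_clidl C) :
  is_short_exact (@ses_ideal C) (delta_in S) (delta_out S).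
Proof.
split; [apply: ses_kernel_intro | apply: ses_cokernel_intro] => /=.
- exact: (sP S).1.
- by apply: null_id_kernel; apply: ses_null.
- exact: (sP S).2.
- by apply: null_id_cokernel; apply: ses_null.
Qed.

Definition delta_ob (S : Ses_clidl C) : Ses_clidl (Ses_clidl C) :=
  @Ses (Ses_clidl C) _ _ _ (delta_in S) (delta_out S) (delta_sP S).

Lemma delta_mor_l (S T : Ses_clidl C) (u : hom S T) :
  u ∘ delta_in S = delta_in T ∘ delta_top_mor (hX u).
Proof. by apply: ses_hom_eq; rewrite /= hl. Qed.

Lemma delta_mor_r (S T : Ses_clidl C) (u : hom S T) :
  delta_bot_mor (hZ u) ∘ delta_out S = delta_out T ∘ u.
Proof. by apply: ses_hom_eq; rewrite /= hr. Qed.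

Definition delta_mor (S T : Ses_clidl C) (u : hom S T) :
    hom (delta_ob S) (delta_ob T) :=
  @SesHom (Ses_clidl C) (delta_ob S) (delta_ob T)
    (delta_top_mor (hX u)) u (delta_bot_mor (hZ u))
    (delta_mor_l u) (delta_mor_r u).

Lemma delta_mor1 (S : Ses_clidl C) : delta_mor (idm S) = idm (delta_ob S).
Proof. exact: ses_hom_eq. Qed.

Lemma delta_morM (R S T : Ses_clidl C) (v : hom S T) (u : hom R S) :
  delta_mor (v ∘ u) = delta_mor v ∘ delta_mor u.
Proof. exact: ses_hom_eq. Qed.

Definition delta_functor : functor (Ses_clidl C) (Ses_clidl (Ses_clidl C)) :=
  @Functor (Ses_clidl C) (Ses_clidl (Ses_clidl C)) delta_ob delta_mor
    delta_mor1 delta_morM.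

Lemma delta_kernels :
  preserves_kernels (@ses_ideal C) (@ses_ideal (Ses_clidl C)) delta_functor.
Proof.
move=> S T R u p pP; apply: ses_kernel_intro => //=.
have [_ k2] := (ses_kernelP u p).1 pP.
apply: ses_kernel_intro => //=; apply: null_id_kernel.
exact: ses_null.
Qed.

Lemma delta_cokernels :
  preserves_cokernels (@ses_ideal C) (@ses_ideal (Ses_clidl C)) delta_functor.
Proof.
move=> R S T u q qP; apply: ses_cokernel_intro => //=.
have [_ k2] := (ses_cokernelP u q).1 qP.
apply: ses_cokernel_intro => //=; apply: null_id_cokernel.
exact: ses_null.
Qed.

Definition delta_hom : clidl_hom (Ses_clidl C) (Ses_clidl (Ses_clidl C)) :=
  @ClIdlHom (Ses_clidl C) (Ses_clidl (Ses_clidl C)) delta_functor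
    delta_kernels delta_cokernels.
End Delta.

(** The structure isomorphism of delta at [G]: identities except for the
    canonical morphisms [G(C(id)) -> C(id)] and [G(K(id)) -> K(id)]. *)
Section DeltaNat.
Variables (C D : clidl) (G : clidl_hom C D).

Lemma fmap_coker_id (X : C) :
  is_cokernel (@ci_null D) (idm (G X)) (fmap G (coker (idm X))).
Proof. by rewrite -fmap1; apply: ch_cokernels; apply: cokerP. Qed.

Lemma fmap_ker_id_null (Z : C) : ci_null D (fmap G (ker (idm Z))).
Proof.
have := (ch_kernels G (kerP (idm Z))).1; by rewrite -fmapM mcomp1m.
Qed.

Definition can_coker (X : C) : hom (G (Coker (idm X))) (Coker (idm (G X))) :=
  cokernel_factor (fmap_coker_id X) (cokerP (idm (G X))).1.

Lemma can_cokerE (X : C) :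
  can_coker X ∘ fmap G (coker (idm X)) = coker (idm (G X)).
Proof. exact: cokernel_factorE. Qed.

Definition can_ker (Z : C) : hom (G (Ker (idm Z))) (Ker (idm (G Z))) :=
  to_ker_id (fmap_ker_id_null Z).

Lemma can_kerE (Z : C) : ker (idm (G Z)) ∘ can_ker Z = fmap G (ker (idm Z)).
Proof. exact: to_ker_idE. Qed.

Lemma delta_nat_top_l (X : C) :
  idm (G X) ∘ fmap G (idm X) = idm (G X) ∘ idm (G X).
Proof. by rewrite fmap1. Qed.

Lemma delta_nat_top_r (X : C) :
  can_coker X ∘ fmap G (coker (idm X)) = coker (idm (G X)) ∘ idm (G X).
Proof. by rewrite can_cokerE mcompm1. Qed.

Definition delta_nat_top (X : C) :
    hom (Omega_ob G (delta_top X) : Ses_clidl D) (delta_top (G X)) :=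
  @SesHom D (Omega_ob G (delta_top X)) (delta_top (G X))
    (idm (G X)) (idm (G X)) (can_coker X)
    (delta_nat_top_l X) (delta_nat_top_r X).

Lemma delta_nat_bot_l (Z : C) :
  idm (G Z) ∘ fmap G (ker (idm Z)) = ker (idm (G Z)) ∘ can_ker Z.
Proof. by rewrite can_kerE mcomp1m. Qed.

Lemma delta_nat_bot_r (Z : C) :
  idm (G Z) ∘ fmap G (idm Z) = idm (G Z) ∘ idm (G Z).
Proof. by rewrite fmap1. Qed.

Definition delta_nat_bot (Z : C) :
    hom (Omega_ob G (delta_bot Z) : Ses_clidl D) (delta_bot (G Z)) :=
  @SesHom D (Omega_ob G (delta_bot Z)) (delta_bot (G Z))
    (can_ker Z) (idm (G Z)) (idm (G Z))
    (delta_nat_bot_l Z) (delta_nat_bot_r Z).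

Let lhs : clidl_hom (Ses_clidl C) (Ses_clidl (Ses_clidl D)) :=
  comp_clidl_hom (Omega_hom (Omega_hom G)) (delta_hom C).
Let rhs : clidl_hom (Ses_clidl C) (Ses_clidl (Ses_clidl D)) :=
  comp_clidl_hom (delta_hom D) (Omega_hom G).

Lemma delta_nat_l (S : Ses_clidl C) :
  idm (Omega_hom G S) ∘ sf (lhs S) = sf (rhs S) ∘ delta_nat_top (sX S).
Proof. by apply: ses_hom_eq; apply: id_square. Qed.

Lemma delta_nat_r (S : Ses_clidl C) :
  delta_nat_bot (sZ S) ∘ sg (lhs S) = sg (rhs S) ∘ idm (Omega_hom G S).
Proof. by apply: ses_hom_eq; apply: id_square. Qed.

Definition delta_nat_at (S : Ses_clidl C) : hom (lhs S) (rhs S) :=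
  @SesHom (Ses_clidl D) (lhs S) (rhs S)
    (delta_nat_top (sX S)) (idm (Omega_hom G S)) (delta_nat_bot (sZ S))
    (delta_nat_l S) (delta_nat_r S).

Lemma delta_nat_nat (S T : Ses_clidl C) (u : hom S T) :
  delta_nat_at T ∘ fmap lhs u = fmap rhs u ∘ delta_nat_at S.
Proof. by apply: ses_hom_eq; apply: id_square. Qed.

Definition delta_nat : nattrans lhs rhs := NatTrans delta_nat_nat.
End DeltaNat.

Definition delta : pstrans Omega (comp_psfunctor Omega Omega) :=
  @PsTrans ClIdl ClIdl Omega (comp_psfunctor Omega Omega) delta_hom
    (fun C D G => @delta_nat C D G).


(** * The 2-category of pseudo-coalgebras over ClIdl *)

Section Invertible.
Variable B : twocat.

Lemma invertible_idcell (X Y : B) (f g : hom1 X Y) (e : f = g) :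
  invertible (idcell e).
Proof. by case: g / e; exists (id2 f); rewrite vcomp1c. Qed.

Lemma invertible_vcomp (X Y : B) (f g h : hom1 X Y) (b : cell g h) (a : cell f g) :
  invertible b -> invertible a -> invertible (b • a).
Proof.
case=> b' [bb b'b] [a' [aa a'a]]; exists (a' • b'); split.
  by rewrite -vcompA (vcompA b') bb vcomp1c.
by rewrite -vcompA (vcompA a) a'a vcomp1c.
Qed.

Lemma invertible_lwhisk (X Y Z : B) (h : hom1 Y Z) (f g : hom1 X Y)
    (a : cell f g) : invertible a -> invertible (h ◁ a).
Proof.
by case=> a' [aa a'a]; exists (h ◁ a'); rewrite -!lwhiskV aa a'a !lwhisk1.
Qed.

Lemma invertible_rwhisk (X Y Z : B) (f g : hom1 Y Z) (e : hom1 X Y)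
    (a : cell f g) : invertible a -> invertible (a ▷ e).
Proof.
by case=> a' [aa a'a]; exists (a' ▷ e); rewrite -!rwhiskV aa a'a !rwhisk1.
Qed.
End Invertible.

(** Evaluation of 1-cells and 2-cells of ClIdl at an object. *)
Definition ev1 (C D : ClIdl) (f : hom1 C D) (S : (C : clidl)) : (D : clidl) :=
  (f : clidl_hom C D) S.
Definition evm (C D : ClIdl) (f : hom1 C D) (S T : (C : clidl)) (u : hom S T) :
    hom (ev1 f S) (ev1 f T) := fmap (f : clidl_hom C D) u.
Definition ev (C D : ClIdl) (f g : hom1 C D) (a : cell f g) (S : (C : clidl)) :
    hom (ev1 f S) (ev1 g S) := (a : nattrans (f : clidl_hom C D) (g : clidl_hom C D)) S.

Lemma ev_ext (C D : ClIdl) (f g : hom1 C D) (a b : cell f g) :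
  (forall S, ev a S = ev b S) -> a = b.
Proof. exact: nattrans_eq. Qed.

Lemma ev_eq (C D : ClIdl) (f g : hom1 C D) (a b : cell f g) :
  a = b -> forall S, ev a S = ev b S.
Proof. by move->. Qed.

Lemma ev_vcomp (C D : ClIdl) (f g h : hom1 C D) (b : cell g h) (a : cell f g) S :
  ev (b • a) S = ev b S ∘ ev a S.
Proof. by []. Qed.

Lemma ev_lwhisk (C D E : ClIdl) (h : hom1 D E) (f g : hom1 C D) (a : cell f g) S :
  ev (h ◁ a) S = evm h (ev a S).
Proof. by []. Qed.

Lemma ev_rwhisk (C D E : ClIdl) (f g : hom1 D E) (e : hom1 C D) (a : cell f g) S :
  ev (a ▷ e) S = ev a (ev1 e S).
Proof. by []. Qed.

Lemma ev_id2 (C D : ClIdl) (f : hom1 C D) S : ev (id2 f) S = idm _.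
Proof. by []. Qed.

Lemma ev_idcell (C D : ClIdl) (f g : hom1 C D) (e : f = g) S
    (p : ev1 f S = ev1 g S) : ev (idcell e) S = ob_idm p.
Proof. exact: idcell_at. Qed.

Lemma ev_assoc_l (C D E F : ClIdl) (h : hom1 E F) (g : hom1 D E) (f : hom1 C D) S :
  ev (assoc_l h g f) S = idm _.
Proof. exact: (@idcell_at C F _ _ (assoc1 h g f) S erefl). Qed.

Lemma ev_assoc_r (C D E F : ClIdl) (h : hom1 E F) (g : hom1 D E) (f : hom1 C D) S :
  ev (assoc_r h g f) S = idm _.
Proof. exact: (@idcell_at C F _ _ (esym (assoc1 h g f)) S erefl). Qed.

Lemma ev_nat (C D : ClIdl) (f g : hom1 C D) (a : cell f g) S T
    (u : @hom (C : clidl) S T) : ev a T ∘ evm f u = evm g u ∘ ev a S.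
Proof. exact: nt_nat. Qed.

Lemma evm_id (C D : ClIdl) (f : hom1 C D) S : evm f (idm S) = idm _.
Proof. exact: fmap1. Qed.

Lemma evm_comp (C D : ClIdl) (f : hom1 C D) (R S T : (C : clidl))
    (v : hom S T) (u : hom R S) : evm f (v ∘ u) = evm f v ∘ evm f u.
Proof. exact: fmapM. Qed.

Lemma evm_ob_idm (C D : ClIdl) (f : hom1 C D) (S T : (C : clidl)) (p : S = T) :
  evm f (ob_idm p) = ob_idm (f_equal (ev1 f) p).
Proof. exact: fmap_ob_idm. Qed.

Definition evE := (ev_vcomp, ev_lwhisk, ev_rwhisk, ev_assoc_l, ev_assoc_r,
  ev_id2, mcomp1m, mcompm1, evm_id, evm_comp).

Ltac ev_idcells :=
  repeat match goal with
  | |- context [ev (@idcell _ ?C ?D ?f ?g ?e) ?S] =>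
      rewrite (@ev_idcell C D f g e S erefl)
  end; cbn [ob_idm].

Lemma idcell_trans (B : twocat) (X Y : B) (f g h : hom1 X Y) (p : f = g) (q : g = h) :
  idcell (etrans p q) = idcell q • idcell p.
Proof. by case: h / q; rewrite vcomp1c. Qed.

Lemma idcell_symK (B : twocat) (X Y : B) (f g : hom1 X Y) (p : f = g) :
  idcell (esym p) • idcell p = id2 f.
Proof. by case: g / p; rewrite vcomp1c. Qed.

Lemma idcell_symVK (B : twocat) (X Y : B) (f g : hom1 X Y) (p : f = g) :
  idcell p • idcell (esym p) = id2 g.
Proof. by case: g / p; rewrite vcomp1c. Qed.

Lemma rl2 (C : category) (U X Y Z : C) (z : hom Z U) (a : hom Y Z) (b : hom X Y) r :
  a ∘ b = r -> z ∘ a ∘ b = z ∘ r.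
Proof. by move=> <-; rewrite mcompA. Qed.

Lemma rl3 (C : category) (U V X Y Z : C) (z : hom Z U) (a : hom Y Z) (b : hom X Y)
    (c : hom V X) r : a ∘ b ∘ c = r -> z ∘ a ∘ b ∘ c = z ∘ r.
Proof. by move=> <-; rewrite !mcompA. Qed.

Section PsCoalg.
Variables (W : psfunctor ClIdl ClIdl) (eps : pstrans W (id_psfunctor ClIdl)).
Variables (del : pstrans W (comp_psfunctor W W)).
Variable M : pseudo_comonad eps del.

Let WP : is_psfunctor W := pc_functor M.
Let epsP := pc_counit M.
Let delP := pc_comult M.

Lemma ps_inv_comp (C D E : ClIdl) (g : hom1 D E) (f : hom1 C D) :
  invertible (ps_comp W g f).
Proof.
by exists (ps_compV W g f); split; [exact: (ps_compK WP)|exact: (ps_compVK WP)].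
Qed.

Lemma ps_m2_idcell (C D : ClIdl) (f g : hom1 C D) (e : f = g) :
  m2 W (idcell e) = idcell (f_equal (m1 W) e).
Proof. by case: g / e; exact: (ps_id2 WP). Qed.

Lemma ps_assoc_l (X Y Z V : ClIdl) (h : hom1 Z V) (g : hom1 Y Z) (f : hom1 X Y) :
  m2 W (assoc_l h g f) • ps_comp W h (g ⊚ f) =
  ps_comp W (h ⊚ g) f • (ps_comp W h g ▷ m1 W f) •
    assoc_l (m1 W h) (m1 W g) (m1 W f) • (m1 W h ◁ ps_compV W g f).
Proof.
rewrite -(ps_assoc WP) -(vcompA _ (m1 W h ◁ _)) -lwhiskV (ps_compVK WP).
by rewrite lwhisk1 vcompc1.
Qed.

Lemma ps_assoc_r (X Y Z V : ClIdl) (h : hom1 Z V) (g : hom1 Y Z) (f : hom1 X Y) :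
  m2 W (assoc_r h g f) • ps_comp W (h ⊚ g) f =
  ps_comp W h (g ⊚ f) • (m1 W h ◁ ps_comp W g f) •
    assoc_r (m1 W h) (m1 W g) (m1 W f) • (ps_compV W h g ▷ m1 W f).
Proof.
have e : m2 W (assoc_r h g f) •
    (m2 W (assoc_l h g f) • ps_comp W h (g ⊚ f) • (m1 W h ◁ ps_comp W g f)) =
  m2 W (assoc_r h g f) • (ps_comp W (h ⊚ g) f • (ps_comp W h g ▷ m1 W f) •
    assoc_l (m1 W h) (m1 W g) (m1 W f)) by rewrite (ps_assoc WP).
move: e; rewrite !vcompA -(ps_vcomp WP) idcell_symK (ps_id2 WP) vcomp1c => ->.
rewrite -(vcompA _ (assoc_l _ _ _)) idcell_symVK vcompc1.
rewrite -(vcompA _ (_ ▷ _) (_ ▷ _)) -rwhiskV (ps_compVK WP) rwhisk1.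
by rewrite vcompc1.
Qed.

Lemma coalg_id_inv (C : coalg M) : invertible (coalg_id2 C).
Proof.
apply: invertible_vcomp; last exact: invertible_idcell.
exact: invertible_rwhisk (ps_id_inv WP C).
Qed.

Lemma coalg_id_counit (C : coalg M) :
  (eps C ◁ coalg_id2 C) • idcell (coalg_hom_eq (C := C) (D := C) (id1 C)) =
  assoc_r (eps C) (m1 W (id1 C)) (ca_str C) • (t2 eps (id1 C) ▷ ca_str C) •
  assoc_l (id1 C) (eps C) (ca_str C).
Proof.
apply: ev_ext => S; rewrite /coalg_id2 !evE.
have := ev_eq (t2_id1 epsP C) (ev1 (ca_str C) S).
by rewrite !evE; ev_idcells; rewrite !evE.
Qed.

Lemma coalg_id_comult (C : coalg M) :
  (del C ◁ coalg_id2 C) • assoc_r (del C) (ca_str C) (id1 C) •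
  (ca_cell C ▷ id1 C) • assoc_l (m1 W (ca_str C)) (ca_str C) (id1 C)
  =
  assoc_r (del C) (m1 W (id1 C)) (ca_str C) • (t2 del (id1 C) ▷ ca_str C) •
  assoc_l (m1 W (m1 W (id1 C))) (del C) (ca_str C) •
  (m1 W (m1 W (id1 C)) ◁ ca_cell C) •
  assoc_r (m1 W (m1 W (id1 C))) (m1 W (ca_str C)) (ca_str C) •
  (ps_compV W (m1 W (id1 C)) (ca_str C) ▷ ca_str C) •
  (m2 W (coalg_id2 C) ▷ ca_str C) •
  (ps_comp W (ca_str C) (id1 C) ▷ ca_str C) •
  assoc_l (m1 W (ca_str C)) (m1 W (id1 C)) (ca_str C) •
  (m1 W (ca_str C) ◁ coalg_id2 C).
Proof.
apply: ev_ext => S; rewrite /coalg_id2 idcell_trans !(ps_vcomp WP) !evE.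
ev_idcells; rewrite !evE.
set l := ca_str C; set x := ev1 l S; rewrite !mcompA.
have H1 := ev_eq (ps_unitr WP l) x.
have H2 := ev_eq (ps_unitl WP l) x.
have H3 := ev_eq (ps_rwhisk WP l (ps_id W C)) x.
have H4 := ev_eq (ps_compK WP (m1 W (id1 C)) l) x.
have H5 : m2 W (idcell (esym (unit1l l))) • m2 W (idcell (unit1l l)) = id2 _.
  by rewrite -(ps_vcomp WP) idcell_symK (ps_id2 WP).
move/ev_eq/(_ x): H5 => H5.
have H6 := ev_eq (t2_id1 delP C) x.
have H7 := ev_nat (ps_id (comp_psfunctor W W) C) (ev (ca_cell C) S).
rewrite !evE in H1.
rewrite !evE in H2.
rewrite !evE in H3.
rewrite !evE in H4.
rewrite !evE in H5.
rewrite !evE in H6.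
rewrite !evE in H7.
move: H1 H2 H6; ev_idcells; rewrite !evE => H1 H2 H6.
rewrite (rl3 _ H1) mcompm1.
have {}H2 := f_equal (fun t => ev (m2 W (idcell (esym (unit1l l)))) x ∘ t) H2.
rewrite /= !mcompA H5 mcomp1m mcompm1 in H2.
rewrite -H2 !mcompA (rl2 _ H3) !mcompA (rl2 _ H4) mcompm1.
rewrite -H6 -mcompA; symmetry; rewrite -!mcompA; congr (_ ∘ _).
by rewrite -mcompA in H7; exact: esym H7.
Qed.

Definition coalg_id (C : coalg M) : coalg_hom C C :=
  CoalgHom (coalg_id_inv C) (coalg_id_counit C) (coalg_id_comult C).

Section Comp.
Variables (C D E : coalg M) (H : coalg_hom D E) (G : coalg_hom C D).

Lemma coalg_comp_inv : invertible (coalg_comp2 H G).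
Proof.
apply: invertible_vcomp; last exact: invertible_idcell.
apply: invertible_vcomp; last exact: invertible_rwhisk (ch_2_inv H).
apply: invertible_vcomp; last exact: invertible_idcell.
apply: invertible_vcomp; last exact: invertible_lwhisk (ch_2_inv G).
apply: invertible_vcomp; last exact: invertible_idcell.
exact: invertible_rwhisk (ps_inv_comp _ _).
Qed.

Lemma coalg_comp_counit :
  (eps E ◁ coalg_comp2 H G) • idcell (coalg_hom_eq (C := C) (D := E) (H ⊚ G)) =
  assoc_r (eps E) (m1 W (H ⊚ G)) (ca_str C) • (t2 eps (H ⊚ G) ▷ ca_str C) •
  assoc_l (H ⊚ G) (eps C) (ca_str C).
Proof.
apply: ev_ext => S; rewrite /coalg_comp2 !evE.
have K1 := ev_eq (ch_counit H) (ev1 G S).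
have K2 := ev_eq (ch_counit G) S.
have K3 := ev_eq (t2_comp1 epsP H G) (ev1 (ca_str C) S).
have K4 := ev_nat (t2 eps H) (ev (ch_2 G) S).
rewrite !evE in K1; rewrite !evE in K2; rewrite !evE in K3.
have -> : ev (idcell (coalg_hom_eq (C := C) (D := E) (H ⊚ G))) S =
    ev (idcell (coalg_hom_eq H)) (ev1 G S) ∘
    evm H (ev (idcell (coalg_hom_eq G)) S).
  rewrite (ev_idcell (coalg_hom_eq H)
    (f_equal (fun f : @hom1 ClIdl D E => ev1 f (ev1 G S)) (coalg_hom_eq H))).
  rewrite (ev_idcell (coalg_hom_eq G)
    (f_equal (fun f : @hom1 ClIdl C D => ev1 f S) (coalg_hom_eq G))).
  rewrite evm_ob_idm ob_idmM; exact: ev_idcell.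
rewrite K3 -K2 evm_comp !mcompA (rl2 _ K4) mcompA.
congr (_ ∘ _); rewrite -!mcompA; do 2!congr (_ ∘ _); exact: K1.
Qed.

Lemma coalg_comp_comult :
  (del E ◁ coalg_comp2 H G) • assoc_r (del E) (ca_str E) (H ⊚ G) •
  (ca_cell E ▷ (H ⊚ G)) • assoc_l (m1 W (ca_str E)) (ca_str E) (H ⊚ G)
  =
  assoc_r (del E) (m1 W (H ⊚ G)) (ca_str C) • (t2 del (H ⊚ G) ▷ ca_str C) •
  assoc_l (m1 W (m1 W (H ⊚ G))) (del C) (ca_str C) •
  (m1 W (m1 W (H ⊚ G)) ◁ ca_cell C) •
  assoc_r (m1 W (m1 W (H ⊚ G))) (m1 W (ca_str C)) (ca_str C) •
  (ps_compV W (m1 W (H ⊚ G)) (ca_str C) ▷ ca_str C) •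
  (m2 W (coalg_comp2 H G) ▷ ca_str C) •
  (ps_comp W (ca_str E) (H ⊚ G) ▷ ca_str C) •
  assoc_l (m1 W (ca_str E)) (m1 W (H ⊚ G)) (ca_str C) •
  (m1 W (ca_str E) ◁ coalg_comp2 H G).
Proof.
apply: ev_ext => S; rewrite /coalg_comp2 !(ps_vcomp WP) !evE.
set l := ca_str C; set m := ca_str D; set n := ca_str E; set x := ev1 l S.
have A1 := ev_eq (ch_comult H) (ev1 G S).
have A2 := ev_eq (ch_comult G) S.
have A3 := ev_eq (t2_comp1 delP H G) x.
have a := ev_eq (ps_assoc WP n H G) x.
have b := ev_eq (ps_rwhisk WP G (ch_2 H)) x.
have c := ev_nat (ps_comp W n H) (ev (ch_2 G) S).
have d := ev_nat (m2 W (ch_2 H)) (ev (ch_2 G) S).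
have e := ev_eq (ps_assoc_r (m1 W H) m G) x.
have f := ev_nat (ps_compV W (m1 W H) m) (ev (ch_2 G) S).
have g := ev_eq (ps_lwhisk WP (m1 W H) (ch_2 G)) x.
have h := ev_eq (ps_assoc_l (m1 W H) (m1 W G) l) x.
have i := ev_eq (ps_rwhisk WP l (ps_comp W H G)) x.
have j := ev_eq (ps_compK WP (m1 W (H ⊚ G)) l) x.
have k := ev_nat (ps_comp (comp_psfunctor W W) H G) (ev (ca_cell C) S).
have t := ev_nat (t2 del H) (ev (ch_2 G) S).
rewrite !evE in A1.
rewrite !evE in A2.
rewrite !evE in A3.
rewrite !evE in a.
rewrite !evE in b.
rewrite !evE in e.
rewrite !evE in g.
rewrite !evE in h.
rewrite !evE in i.
rewrite !evE in j.
rewrite !mcompA (rl3 _ a) !mcompA (rl2 _ b) !mcompA (rl2 _ c) !mcompA (rl2 _ d) !mcompA.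
rewrite (rl2 _ e) !mcompA (rl2 _ f) !mcompA (rl2 _ g) !mcompA (rl2 _ h) !mcompA.
rewrite (rl2 _ i) !mcompA (rl2 _ j) mcompm1.
have {}k := esym k; rewrite !mcompA in k.
rewrite (rl3 _ k) !mcompA; rewrite !mcompA in A3; rewrite A3.
have A2' := f_equal (fun z => evm (m1 W (m1 W H)) z) A2.
rewrite !evm_comp in A2'.
transitivity (evm (del E) (ev (ps_comp W H G) x) ∘
  ev (t2 del H) (ev1 (m1 W G) x) ∘
  (evm (m1 W (m1 W H)) (evm (del D) (ev (ch_2 G) S)) ∘
   evm (m1 W (m1 W H)) (ev (ca_cell D) (ev1 G S))) ∘
  ev (ps_compV W (m1 W H) m) (ev1 (ca_str D ⊚ G) S) ∘
  ev (m2 W (ch_2 H)) (ev1 (ca_str D ⊚ G) S) ∘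
  ev (ps_comp W n H) (ev1 (ca_str D ⊚ G) S) ∘
  evm (m1 W n) (ev (ch_2 H) (ev1 G S))); last by rewrite A2' !mcompA.
rewrite !mcompA (rl2 _ t) !mcompA; rewrite -!mcompA; do 2!congr (_ ∘ _).
by rewrite -!mcompA in A1; exact: A1.
Qed.

Definition coalg_comp : coalg_hom C E :=
  CoalgHom coalg_comp_inv coalg_comp_counit coalg_comp_comult.
End Comp.

(** ** 2-cells *)

Definition coalg_cell (C D : coalg M) (G H : coalg_hom C D) :=
  {a : cell (G : hom1 C D) (H : hom1 C D) | is_coalg_cell a}.

Lemma coalg_cell_eq (C D : coalg M) (G H : coalg_hom C D) (a b : coalg_cell G H) :
  proj1_sig a = proj1_sig b -> a = b.
Proof.
case: a b => [a aP] [b bP] /= e; subst b.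
by rewrite (proof_irrelevance _ aP bP).
Qed.

Lemma coalg_hom_ext (C D : coalg M) (G H : coalg_hom C D) (e : ch_1 G = ch_1 H) :
  is_coalg_cell (G := G) (H := H) (idcell e) -> G = H.
Proof.
case: G H e => [G G2 p q r] [H H2 p' q' r'] /= e; case: H / e H2 p' q' r'.
move=> H2 p' q' r'; rewrite /is_coalg_cell; cbn [idcell ch_1 ch_2].
rewrite lwhisk1 (ps_id2 WP) rwhisk1.
rewrite vcompc1 vcomp1c => e; case: G2 / e p' q' r' p q r => p' q' r' p q r.
by congr CoalgHom; apply: proof_irrelevance.
Qed.

Lemma id_is_coalg_cell (C D : coalg M) (G : coalg_hom C D) :
  is_coalg_cell (G := G) (H := G) (id2 _).
Proof.
by rewrite /is_coalg_cell lwhisk1 (ps_id2 WP) rwhisk1 vcompc1 vcomp1c.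
Qed.

Lemma vcomp_is_coalg_cell (C D : coalg M) (F G H : coalg_hom C D)
    (b : coalg_cell G H) (a : coalg_cell F G) :
  is_coalg_cell (G := F) (H := H) (proj1_sig b • proj1_sig a).
Proof.
case: a b => [a aP] [b bP] /=; rewrite /is_coalg_cell lwhiskV vcompA bP.
by rewrite -vcompA aP vcompA (ps_vcomp WP) rwhiskV.
Qed.

Lemma lwhisk_is_coalg_cell (C D E : coalg M) (H : coalg_hom D E)
    (F G : coalg_hom C D) (a : coalg_cell F G) :
  is_coalg_cell (G := coalg_comp H F) (H := coalg_comp H G)
    ((H : hom1 D E) ◁ proj1_sig a).
Proof.
case: a => [a aP]; apply: ev_ext => S.
cbn [ch_1 ch_2 coalg_comp proj1_sig]; rewrite /coalg_comp2 !evE.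
have p := ev_eq aP S.
have q := ev_eq (ps_lwhisk WP H a) (ev1 (ca_str C) S).
have r := ev_nat (ch_2 H) (ev a S).
move: p q r; rewrite !evE => p q r.
have {}p := f_equal (fun z => evm (m1 W H) z) p; rewrite !evm_comp in p.
rewrite (rl2 _ r) !mcompA q; congr (_ ∘ _); rewrite -!mcompA; congr (_ ∘ _).
exact: p.
Qed.

Lemma rwhisk_is_coalg_cell (C D E : coalg M) (F G : coalg_hom D E)
    (a : coalg_cell F G) (K : coalg_hom C D) :
  is_coalg_cell (G := coalg_comp F K) (H := coalg_comp G K)
    (proj1_sig a ▷ (K : hom1 C D)).
Proof.
case: a => [a aP]; apply: ev_ext => S.
cbn [ch_1 ch_2 coalg_comp proj1_sig]; rewrite /coalg_comp2 !evE.
have p := ev_eq aP (ev1 K S).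
have q := ev_eq (ps_rwhisk WP K a) (ev1 (ca_str C) S).
have r := ev_nat (m2 W a) (ev (ch_2 K) S).
move: p q r; rewrite !evE => p q r.
by rewrite (rl2 _ p) !mcompA q; congr (_ ∘ _); rewrite -!mcompA r.
Qed.

Lemma coalg_assoc (X Y Z V : coalg M) (h : coalg_hom Z V) (g : coalg_hom Y Z)
    (f : coalg_hom X Y) :
  coalg_comp h (coalg_comp g f) = coalg_comp (coalg_comp h g) f.
Proof.
apply: (@coalg_hom_ext X V (coalg_comp h (coalg_comp g f))
  (coalg_comp (coalg_comp h g) f) (assoc1 (ch_1 h) (ch_1 g) (ch_1 f))).
apply: ev_ext => S.
have p := ev_eq (ps_assoc WP h g f) (ev1 (ca_str X) S).
have q := ev_nat (ps_comp W h g) (ev (ch_2 f) S).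
do 2!(cbn [ch_1 ch_2 coalg_comp]; rewrite /coalg_comp2).
rewrite !evE in p; rewrite !evE; ev_idcells; rewrite ?evE.
by rewrite !mcompA p (rl2 _ q) !mcompA.
Qed.

Lemma coalg_unitl (X Y : coalg M) (f : coalg_hom X Y) :
  coalg_comp (coalg_id Y) f = f.
Proof.
apply: (@coalg_hom_ext X Y (coalg_comp (coalg_id Y) f) f (unit1l (ch_1 f))).
apply: ev_ext => S.
have p := ev_eq (ps_unitl WP f) (ev1 (ca_str X) S).
have q := ev_nat (ps_id W Y) (ev (ch_2 f) S).
move: p q; do 2!(cbn [ch_1 ch_2 coalg_comp coalg_id]; rewrite /coalg_comp2).
rewrite /coalg_id2 !evE; ev_idcells; rewrite ?evE => p q.
by rewrite !mcompA (rl2 _ (esym q)) !mcompA p mcomp1m.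
Qed.

Lemma coalg_unitr (X Y : coalg M) (f : coalg_hom X Y) :
  coalg_comp f (coalg_id X) = f.
Proof.
apply: (@coalg_hom_ext X Y (coalg_comp f (coalg_id X)) f (unit1r (ch_1 f))).
apply: ev_ext => S.
have p := ev_eq (ps_unitr WP f) (ev1 (ca_str X) S).
move: p; do 2!(cbn [ch_1 ch_2 coalg_comp coalg_id]; rewrite /coalg_comp2).
rewrite /coalg_id2 !evE; ev_idcells; rewrite ?evE => p.
by rewrite !mcompA p mcomp1m.
Qed.

Definition PsCoalg_data : twocat_data :=
  @TwocatData (coalg M) (@coalg_hom _ _ _ _ M) coalg_cell coalg_id
    (fun C D E H G => coalg_comp H G)
    (fun C D G => exist _ _ (id_is_coalg_cell G))
    (fun C D F G H b a => exist _ _ (vcomp_is_coalg_cell b a))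
    (fun C D E H F G a => exist _ _ (lwhisk_is_coalg_cell H a))
    (fun C D E F G a K => exist _ _ (rwhisk_is_coalg_cell a K)).

Lemma coalg_idcell (C D : PsCoalg_data) (G H : hom1 C D) (e : G = H)
    (e' : ch_1 (G : coalg_hom C D) = ch_1 (H : coalg_hom C D)) :
  proj1_sig (idcell e : coalg_cell (G : coalg_hom C D) (H : coalg_hom C D)) = idcell e'.
Proof. by case: H / e e' => e'; rewrite (proof_irrelevance _ e' erefl). Qed.

Lemma idcell_square (C D : PsCoalg_data) (F F' G G' : @hom1 PsCoalg_data C D)
    (p : F = F') (q : G = G') (a : cell F G) (b : cell F' G') :
  (exists (p' : ch_1 (F : coalg_hom C D) = ch_1 (F' : coalg_hom C D))
    (q' : ch_1 (G : coalg_hom C D) = ch_1 (G' : coalg_hom C D)),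
  idcell q' • proj1_sig (a : coalg_cell (F : coalg_hom C D) (G : coalg_hom C D)) =
    proj1_sig (b : coalg_cell (F' : coalg_hom C D) (G' : coalg_hom C D)) •
    idcell p') ->
  proj1_sig (idcell q • a : coalg_cell (F : coalg_hom C D) (G' : coalg_hom C D)) =
  proj1_sig (b • idcell p : coalg_cell (F : coalg_hom C D) (G' : coalg_hom C D)).
Proof.
by move=> [p' [q' e]]; rewrite -(coalg_idcell p p') -(coalg_idcell q q') in e.
Qed.

Definition PsCoalg : twocat.
Proof.
apply: (@Twocat PsCoalg_data coalg_assoc coalg_unitl coalg_unitr).
1-8: move=> *; apply: coalg_cell_eq.
- exact: vcomp1c.
- exact: vcompc1.
- exact: vcompA.
- exact: lwhisk1.
- exact: lwhiskV.
- exact: rwhisk1.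
- exact: rwhiskV.
- exact: whisk_exchange.
- move=> X Y f g a; apply: coalg_cell_eq; apply: idcell_square.
  do 2!eexists; exact: (lwhisk_id1 (t := ClIdl) (proj1_sig a)).
- move=> X Y f g a; apply: coalg_cell_eq; apply: idcell_square.
  do 2!eexists; exact: (rwhisk_id1 (t := ClIdl) (proj1_sig a)).
- move=> X Y Z V k h f g a; apply: coalg_cell_eq; apply: idcell_square.
  do 2!eexists; exact: (lwhisk_comp1 (t := ClIdl) (ch_1 k) (ch_1 h) (proj1_sig a)).
- move=> X Y Z V f g h e a; apply: coalg_cell_eq; apply: idcell_square.
  do 2!eexists; exact: (rwhisk_comp1 (t := ClIdl) (ch_1 h) (ch_1 e) (proj1_sig a)).
- move=> X Y Z V h f g e a; apply: coalg_cell_eq; apply: idcell_square.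
  do 2!eexists; exact: (lrwhisk (t := ClIdl) (ch_1 h) (ch_1 e) (proj1_sig a)).
Defined.

Definition PsCoalg_forget : map2 PsCoalg ClIdl :=
  @Map2 PsCoalg ClIdl (fun C => ca_ob C) (fun C D G => ch_1 (G : coalg_hom C D))
    (fun C D G H a => proj1_sig (a : coalg_cell _ _)).
End PsCoalg.

(** * Pretorsion theories *)

(** Full replete subcategories are given by predicates on objects closed under
    isomorphism; the choice of short exact sequences is part of the data. *)
Definition replete (C : category) (P : C -> Prop) : Prop :=
  forall (A B : C) (i : hom A B), is_iso i -> P A -> P B.

(** Morphisms factoring through an object that is torsion and torsion-free. *)
Definition pretorsion_null (C : category) (T F : C -> Prop) : mor_class C :=
  factors_through (fun D => T D /\ F D).

Record pretorsion := Pretorsion {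
  pt_cat :> category;
  torsion : pt_cat -> Prop;
  torsionfree : pt_cat -> Prop;
  torsion_replete : replete torsion;
  torsionfree_replete : replete torsionfree;
  pt_T1 : forall (A B : pt_cat) (f : hom A B),
    torsion A -> torsionfree B -> pretorsion_null torsion torsionfree f;
  tors : pt_cat -> pt_cat;
  tfree : pt_cat -> pt_cat;
  ell : forall X, hom (tors X) X;
  rho : forall X, hom X (tfree X);
  tors_torsion : forall X, torsion (tors X);
  tfree_torsionfree : forall X, torsionfree (tfree X);
  pt_T2 : forall X,
    is_short_exact (pretorsion_null torsion torsionfree) (ell X) (rho X)
}.
Arguments torsion {p} X.
Arguments torsionfree {p} X.
Arguments tors {p} X.
Arguments tfree {p} X.
Arguments ell {p} X.
Arguments rho {p} X.

Definition pt_null (P : pretorsion) : mor_class P :=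
  pretorsion_null (@torsion P) (@torsionfree P).

(** The functors [X |-> T^X] and [X |-> F^X], as endofunctors of the ambient
    category. *)
Section TorsionFunctors.
Variable P : pretorsion.

Let NI : is_ideal (@pt_null P) := factors_ideal _.

Lemma tors_mor_null (X Y : P) (h : hom X Y) : pt_null (rho Y ∘ (h ∘ ell X)).
Proof.
by apply: pt_T1; [apply: tors_torsion | apply: tfree_torsionfree].
Qed.

Lemma tfree_mor_null (X Y : P) (h : hom X Y) : pt_null (rho Y ∘ h ∘ ell X).
Proof. by rewrite -mcompA; apply: tors_mor_null. Qed.

Definition tors_mor (X Y : P) (h : hom X Y) : hom (tors X) (tors Y) :=
  kernel_factor (pt_T2 Y).1 (tors_mor_null h).

Definition tfree_mor (X Y : P) (h : hom X Y) : hom (tfree X) (tfree Y) :=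
  cokernel_factor (pt_T2 X).2 (tfree_mor_null h).

Lemma tors_morE (X Y : P) (h : hom X Y) : ell Y ∘ tors_mor h = h ∘ ell X.
Proof. exact: kernel_factorE. Qed.

Lemma tfree_morE (X Y : P) (h : hom X Y) : tfree_mor h ∘ rho X = rho Y ∘ h.
Proof. exact: cokernel_factorE. Qed.

Lemma ell_mono (X A : P) (u v : hom A (tors X)) : ell X ∘ u = ell X ∘ v -> u = v.
Proof. exact: (kernel_mono NI (pt_T2 X).1). Qed.

Lemma rho_epi (X A : P) (u v : hom (tfree X) A) : u ∘ rho X = v ∘ rho X -> u = v.
Proof. exact: (cokernel_epi NI (pt_T2 X).2). Qed.

Definition torsion_functor : functor P P.
Proof.
apply: (@Functor P P (fun X => tors X) tors_mor) => [X|X Y Z g f].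
  by apply: ell_mono; rewrite tors_morE mcomp1m mcompm1.
by apply: ell_mono; rewrite mcompA !tors_morE -!mcompA tors_morE.
Defined.

Definition torsionfree_functor : functor P P.
Proof.
apply: (@Functor P P (fun X => tfree X) tfree_mor) => [X|X Y Z g f].
  by apply: rho_epi; rewrite tfree_morE mcomp1m mcompm1.
by apply: rho_epi; rewrite -mcompA !tfree_morE !mcompA tfree_morE.
Defined.
End TorsionFunctors.

Definition hereditary (P : pretorsion) : Prop :=
  preserves_kernels (@pt_null P) (@pt_null P) (torsion_functor P).

Definition cohereditary (P : pretorsion) : Prop :=
  preserves_cokernels (@pt_null P) (@pt_null P) (torsionfree_functor P).

(** * The 2-category BiHPTors *)

Record bihptors := BiHPTorsOb {
  bh_pt :> pretorsion;
  bh_kernels : has_kernels (@pt_null bh_pt);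
  bh_cokernels : has_cokernels (@pt_null bh_pt);
  bh_hereditary : hereditary bh_pt;
  bh_cohereditary : cohereditary bh_pt
}.

Definition bh_clidl (P : bihptors) : clidl :=
  @ClIdlOb P (@pt_null P) (factors_closed _) (@bh_kernels P) (@bh_cokernels P).

Record bihptors_hom (P Q : bihptors) := BiHPTorsHom {
  bh_hom :> clidl_hom (bh_clidl P) (bh_clidl Q);
  bh_torsion : forall X : P, torsion X -> torsion (bh_hom X : Q);
  bh_torsionfree : forall X : P, torsionfree X -> torsionfree (bh_hom X : Q)
}.

Definition bihptors_id (P : bihptors) : bihptors_hom P P :=
  @BiHPTorsHom P P (id_clidl_hom (bh_clidl P)) (fun X TX => TX) (fun X FX => FX).

Definition bihptors_comp (P Q R : bihptors) (G : bihptors_hom Q R)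
    (F : bihptors_hom P Q) : bihptors_hom P R :=
  @BiHPTorsHom P R (comp_clidl_hom G F)
    (fun X TX => bh_torsion G (bh_torsion F TX))
    (fun X FX => bh_torsionfree G (bh_torsionfree F FX)).

Lemma bihptors_hom_eq (P Q : bihptors) (F G : bihptors_hom P Q) :
  bh_hom F = bh_hom G -> F = G.
Proof.
case: F G => [F t f] [G t' f'] /= e; subst G.
by rewrite (proof_irrelevance _ t t') (proof_irrelevance _ f f').
Qed.

Definition BiHPTors_data : twocat_data :=
  @TwocatData bihptors bihptors_hom (fun P Q F G => nattrans F G)
    bihptors_id bihptors_comp
    (fun P Q F => id_nattrans F)
    (fun P Q F G H b a => comp_nattrans b a)
    (fun P Q R H F G a => @whisker_l _ _ _ H F G a)
    (fun P Q R F G a H => @whisker_r _ _ _ F G a H).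

Lemma BiHPTors_assoc (X Y Z W : BiHPTors_data) (h : hom1 Z W) (g : hom1 Y Z)
    (f : hom1 X Y) : h ⊚ (g ⊚ f) = h ⊚ g ⊚ f.
Proof. by apply: bihptors_hom_eq; apply: ClIdl_assoc. Qed.

Lemma BiHPTors_unit1l (X Y : BiHPTors_data) (f : hom1 X Y) : id1 Y ⊚ f = f.
Proof. by apply: bihptors_hom_eq; apply: ClIdl_unit1l. Qed.

Lemma BiHPTors_unit1r (X Y : BiHPTors_data) (f : hom1 X Y) : f ⊚ id1 X = f.
Proof. by apply: bihptors_hom_eq; apply: ClIdl_unit1r. Qed.

Lemma bihptors_idcell_at (P Q : BiHPTors_data) (F G : hom1 P Q) (e : F = G) X
    (p : (F : bihptors_hom P Q) X = (G : bihptors_hom P Q) X) :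
  (idcell e : nattrans (F : bihptors_hom P Q) (G : bihptors_hom P Q)) X = ob_idm p.
Proof. by case: G / e p => p; rewrite ob_idm_refl. Qed.

Definition BiHPTors : twocat.
Proof.
apply: (@Twocat BiHPTors_data BiHPTors_assoc BiHPTors_unit1l BiHPTors_unit1r) => *;
  apply: nattrans_eq => ?;
  rewrite /=;
  repeat match goal with
  | |- context [nt (@idcell _ ?C ?D ?F ?G ?e) ?X] =>
      rewrite (@bihptors_idcell_at C D F G e X erefl)
  end;
  rewrite /= ?mcomp1m ?mcompm1 ?mcompA ?fmap1 ?fmapM //.
by rewrite nt_nat.
Defined.

Definition BiHPTors_forget : map2 BiHPTors ClIdl :=
  @Map2 BiHPTors ClIdl bh_clidl (fun P Q F => bh_hom F) (fun P Q F G a => a).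

Definition identity_counit_comparisons (W : psfunctor ClIdl ClIdl)
    (eps : pstrans W (id_psfunctor ClIdl))
    (del : pstrans W (comp_psfunctor W W)) (M : pseudo_comonad eps del) : Prop :=
  forall C : ClIdl,
    is_identity_cell (cunitl M C) /\ is_identity_cell (cunitr M C).

(* Main.v *)
Require Import Defs.
From Corelib Require Import ssreflect ssrfun ssrbool.
From Stdlib Require Import FunctionalExtensionality PropExtensionality.
From Stdlib Require Import ProofIrrelevance IndefiniteDescription.

(** A morphism of short exact sequences is determined by its middle component,
    and exists over a given middle component [v] as soon as [sg T ∘ v ∘ sf S] is
    null.  Hence every 2-cell required by the theorem (the modification [Xi], the
    cell of a pseudo-coalgebra, the cell of a pseudo-morphism) lies over an
    identity, is unique, and satisfies every coherence axiom automatically.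

    A normal pseudo-coalgebra is thus nothing but a functor [l] preserving kernels
    and cokernels with [l X] a short exact sequence [cX X -> X -> cZ X].  Its
    torsion (torsion-free) objects are those for which [cX X -> X] (respectively
    [X -> cZ X]) is invertible.  Null objects are the ones that are both.
    Preservation by [l] of the kernel [cX X -> X] of [X -> cZ X] makes [cX X]
    torsion, because it exhibits [cX (cX X) -> cX X] as the kernel of a null
    morphism.  Since kernels reflect null morphisms, preservation of all kernels by
    [l] amounts to hereditarity; dually for cokernels.  A functor underlies a
    (unique) pseudo-morphism exactly when it preserves torsion and torsion-free
    objects, and every natural transformation is a 2-cell. *)

Set Implicit Arguments.
Unset Strict Implicit.
Unset Printing Implicit Defensive.

(** * Invertible 2-functors *)

Section HeterogeneousEquality.
Variable B : twocat_data.

(** An inverse 2-functor returns objects only up to propositional equality, so 1-cells and 2-cells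
    with different endpoints have to be compared; an inductive family does this without
    transports. *)
Inductive heq1 (X Y : B) (f : hom1 X Y) : forall X' Y' : B, hom1 X' Y' -> Prop :=
  heq1_refl : heq1 f f.

Inductive heq2 (X Y : B) (f g : hom1 X Y) (a : cell f g) :
    forall (X' Y' : B) (f' g' : hom1 X' Y'), cell f' g' -> Prop :=
  heq2_refl : heq2 a a.

Lemma heq1_sym (X Y X' Y' : B) (f : hom1 X Y) (f' : hom1 X' Y') :
  heq1 f f' -> heq1 f' f.
Proof. by case. Qed.

Lemma heq1_trans (X Y X' Y' X'' Y'' : B) (f : hom1 X Y) (f' : hom1 X' Y')
    (f'' : hom1 X'' Y'') : heq1 f f' -> heq1 f' f'' -> heq1 f f''.
Proof. by case. Qed.

Lemma heq2_sym (X Y X' Y' : B) (f g : hom1 X Y) (f' g' : hom1 X' Y')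
    (a : cell f g) (a' : cell f' g') : heq2 a a' -> heq2 a' a.
Proof. by case. Qed.

Lemma heq2_trans (X Y X' Y' X'' Y'' : B) (f g : hom1 X Y) (f' g' : hom1 X' Y')
    (f'' g'' : hom1 X'' Y'') (a : cell f g) (a' : cell f' g') (a'' : cell f'' g'') :
  heq2 a a' -> heq2 a' a'' -> heq2 a a''.
Proof. by case. Qed.

(** Heterogeneous equality yields an equality of hom types carrying one 1-cell to the other. When
    the endpoints agree this is a loop, trivial by proof irrelevance. *)
Lemma heq1_eq (X Y : B) (f g : hom1 X Y) : heq1 f g -> f = g.
Proof.
have H X' Y' (f' : hom1 X' Y') : heq1 f f' ->
    exists e : hom1 X Y = hom1 X' Y',
      match e in _ = T return T with erefl => f end = f'.
  by case; exists erefl.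
by case/H=> e; rewrite (proof_irrelevance _ e erefl).
Qed.

Lemma heq2_eq (X Y : B) (f g : hom1 X Y) (a b : cell f g) : heq2 a b -> a = b.
Proof.
have H X' Y' (f' g' : hom1 X' Y') (a' : cell f' g') : heq2 a a' ->
    exists e : cell f g = cell f' g',
      match e in _ = T return T with erefl => a end = a'.
  by case; exists erefl.
by case/H=> e; rewrite (proof_irrelevance _ e erefl).
Qed.

Lemma heq1_comp1 (X Y Z X' Y' Z' : B) (g : hom1 Y Z) (f : hom1 X Y)
    (g' : hom1 Y' Z') (f' : hom1 X' Y') : X = X' -> Y = Y' -> Z = Z' ->
  heq1 g g' -> heq1 f f' -> heq1 (g ⊚ f) (g' ⊚ f').
Proof. by move=> ? ? ?; subst=> /heq1_eq -> /heq1_eq ->. Qed.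

Lemma heq2_id2 (X Y X' Y' : B) (f : hom1 X Y) (f' : hom1 X' Y') :
  heq1 f f' -> heq2 (id2 f) (id2 f').
Proof. by case. Qed.

Lemma heq2_vcomp (X Y X' Y' : B) (f g h : hom1 X Y) (f' g' h' : hom1 X' Y')
    (b : cell g h) (a : cell f g) (b' : cell g' h') (a' : cell f' g') :
  X = X' -> Y = Y' -> heq1 f f' -> heq1 g g' -> heq1 h h' ->
  heq2 b b' -> heq2 a a' -> heq2 (b • a) (b' • a').
Proof.
move=> ? ?; subst=> /heq1_eq ? /heq1_eq ? /heq1_eq ?; subst.
by move=> /heq2_eq -> /heq2_eq ->.
Qed.

Lemma heq2_lwhisk (X Y Z X' Y' Z' : B) (h : hom1 Y Z) (f g : hom1 X Y)
    (a : cell f g) (h' : hom1 Y' Z') (f' g' : hom1 X' Y') (a' : cell f' g') :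
  X = X' -> Y = Y' -> Z = Z' -> heq1 h h' -> heq1 f f' -> heq1 g g' ->
  heq2 a a' -> heq2 (h ◁ a) (h' ◁ a').
Proof.
move=> ? ? ?; subst=> /heq1_eq ? /heq1_eq ? /heq1_eq ?; subst.
by move=> /heq2_eq ->.
Qed.

Lemma heq2_rwhisk (X Y Z X' Y' Z' : B) (h : hom1 X Y) (f g : hom1 Y Z)
    (a : cell f g) (h' : hom1 X' Y') (f' g' : hom1 Y' Z') (a' : cell f' g') :
  X = X' -> Y = Y' -> Z = Z' -> heq1 h h' -> heq1 f f' -> heq1 g g' ->
  heq2 a a' -> heq2 (a ▷ h) (a' ▷ h').
Proof.
move=> ? ? ?; subst=> /heq1_eq ? /heq1_eq ? /heq1_eq ?; subst.
by move=> /heq2_eq ->.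
Qed.
End HeterogeneousEquality.

(** Strict 2-functors state their compatibility with whiskering in the left-hand form; [heq2]
    absorbs both identity cells, after which such equations can be chained. *)
Lemma idcell_squareP (B : twocat) (X Y : B) (f f' g g' : hom1 X Y)
    (p : f = f') (q : g = g') (a : cell f g) (b : cell f' g') :
  idcell q • a = b • idcell p <-> heq2 a b.
Proof.
case: f' / p b => b; case: g' / q b => b /=; rewrite vcomp1c vcompc1.
by split=> [->|/heq2_eq].
Qed.

Section Map2.
Variables B C : twocat_data.
Implicit Types F G : map2 B C.

Lemma map2_eq F G :
  (forall X, m0 F X = m0 G X) ->
  (forall (X Y : B) (f : hom1 X Y), heq1 (m1 F f) (m1 G f)) ->
  (forall (X Y : B) (f g : hom1 X Y) (a : cell f g), heq2 (m2 F a) (m2 G a)) ->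
  F = G.
Proof.
case: F G => [F0 F1 F2] [G0 G1 G2] /= e0 e1 e2.
have {}e0 : F0 = G0 by apply: functional_extensionality.
subst G0.
have {}e1 : F1 = G1.
  by do 3!apply: functional_extensionality_dep=> ?; apply: heq1_eq.
subst G1; congr Map2.
by do 5!apply: functional_extensionality_dep=> ?; apply: heq2_eq.
Qed.
End Map2.

(** * 2-functors bijective on objects, 1-cells and 2-cells *)

Section Inverse.
Variables (B C : twocat) (F : map2 B C).
Hypothesis FP : is_2functor F.
Hypothesis inj0 : forall X X' : B, m0 F X = m0 F X' -> X = X'.
Hypothesis surj0 : forall Y : C, exists X, m0 F X = Y.
Hypothesis inj1 : forall (X Y : B) (f f' : hom1 X Y), m1 F f = m1 F f' -> f = f'.
Hypothesis surj1 : forall (X Y : B) (k : hom1 (m0 F X) (m0 F Y)),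
  exists f : hom1 X Y, m1 F f = k.
Hypothesis inj2 : forall (X Y : B) (f g : hom1 X Y) (a a' : cell f g),
  m2 F a = m2 F a' -> a = a'.
Hypothesis surj2 : forall (X Y : B) (f g : hom1 X Y) (c : cell (m1 F f) (m1 F g)),
  exists a : cell f g, m2 F a = c.

Lemma heq1_inj (X Y X' Y' : B) (f : hom1 X Y) (f' : hom1 X' Y') :
  X = X' -> Y = Y' -> heq1 (m1 F f) (m1 F f') -> heq1 f f'.
Proof. by move=> ? ?; subst=> /heq1_eq/inj1 ->. Qed.

Lemma heq2_inj (X Y X' Y' : B) (f g : hom1 X Y) (f' g' : hom1 X' Y')
    (a : cell f g) (a' : cell f' g') : X = X' -> Y = Y' ->
  heq1 f f' -> heq1 g g' -> heq2 (m2 F a) (m2 F a') -> heq2 a a'.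
Proof.
by move=> ? ?; subst=> /heq1_eq ? /heq1_eq ?; subst=> /heq2_eq/inj2 ->.
Qed.

Lemma inverse_ob : {G0 : C -> B | forall Y, m0 F (G0 Y) = Y}.
Proof.
exists (fun Y => proj1_sig (constructive_indefinite_description _ (surj0 Y))).
by move=> Y; case: constructive_indefinite_description.
Qed.

Let G0 : C -> B := proj1_sig inverse_ob.
Let FG0 Y : m0 F (G0 Y) = Y := proj2_sig inverse_ob Y.

Lemma inverse_hom (Y Y' : C) (k : hom1 Y Y') :
  {f : hom1 (G0 Y) (G0 Y') | heq1 (m1 F f) k}.
Proof.
apply: constructive_indefinite_description.
(* The equation [m0 F (G0 Y) = Y] has [Y] on both sides and cannot be substituted; with [G0 Y]
   generalized to [Z] it can. *)
have H Z Z' : m0 F Z = Y -> m0 F Z' = Y' -> exists f : hom1 Z Z', heq1 (m1 F f) k.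
  by move=> ? ?; subst; case: (surj1 k) => f <-; exists f.
exact: H.
Qed.

Let G1 (Y Y' : C) (k : hom1 Y Y') := proj1_sig (inverse_hom k).
Let FG1 (Y Y' : C) (k : hom1 Y Y') : heq1 (m1 F (G1 k)) k := proj2_sig (inverse_hom k).

Lemma inverse_cell (Y Y' : C) (k l : hom1 Y Y') (c : cell k l) :
  {a : cell (G1 k) (G1 l) | heq2 (m2 F a) c}.
Proof.
apply: constructive_indefinite_description.
have H Z Z' (f g : hom1 Z Z') : m0 F Z = Y -> m0 F Z' = Y' ->
    heq1 (m1 F f) k -> heq1 (m1 F g) l -> exists a : cell f g, heq2 (m2 F a) c.
  move=> ? ?; subst=> /heq1_eq ? /heq1_eq ?; subst.
  by case: (surj2 c) => a <-; exists a.
exact: H.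
Qed.

Let G2 (Y Y' : C) (k l : hom1 Y Y') (c : cell k l) := proj1_sig (inverse_cell c).
Let FG2 (Y Y' : C) (k l : hom1 Y Y') (c : cell k l) : heq2 (m2 F (G2 c)) c :=
  proj2_sig (inverse_cell c).

Let G : map2 C B := @Map2 C B G0 G1 G2.

Lemma heq2_lwhisk_map (X Y Z : B) (h : hom1 Y Z) (f g : hom1 X Y) (a : cell f g) :
  heq2 (m2 F (h ◁ a)) (m1 F h ◁ m2 F a).
Proof. exact: (proj1 (idcell_squareP _ _ _ _) (tf_lwhisk FP h a)). Qed.

Lemma heq2_rwhisk_map (X Y Z : B) (f g : hom1 Y Z) (e : hom1 X Y) (a : cell f g) :
  heq2 (m2 F (a ▷ e)) (m2 F a ▷ m1 F e).
Proof. exact: (proj1 (idcell_squareP _ _ _ _) (tf_rwhisk FP e a)). Qed.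

Lemma inverse_comp1 (X Y Z : C) (g : hom1 Y Z) (f : hom1 X Y) :
  G1 (g ⊚ f) = G1 g ⊚ G1 f.
Proof.
apply: inj1; apply: heq1_eq; rewrite (tf_comp1 FP); apply: heq1_trans (FG1 _) _.
by apply: heq1_sym; apply: heq1_comp1.
Qed.

Lemma inverse_2functor : is_2functor G.
Proof.
have id1G X : G1 (id1 X) = id1 (G0 X).
  apply: inj1; apply: heq1_eq; rewrite (tf_id1 FP); apply: heq1_trans (FG1 _) _.
  by rewrite FG0.
apply: (@Is2Functor C B G id1G inverse_comp1).
- move=> X Y f; apply: inj2; apply: heq2_eq; apply: heq2_trans (FG2 _) _.
  by rewrite (tf_id2 FP); apply: heq2_id2; apply: heq1_sym.
- move=> X Y f g h b a; apply: inj2; apply: heq2_eq; apply: heq2_trans (FG2 _) _.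
  by rewrite (tf_vcomp FP); apply: heq2_sym; apply: heq2_vcomp.
- move=> X Y Z h f g a; apply/idcell_squareP.
  apply: heq2_inj => //=; try by rewrite inverse_comp1.
  apply: heq2_trans (FG2 _) _; apply: heq2_sym.
  by apply: heq2_trans (heq2_lwhisk_map _ _) _; apply: heq2_lwhisk.
- move=> X Y Z f g e a; apply/idcell_squareP.
  apply: heq2_inj => //=; try by rewrite inverse_comp1.
  apply: heq2_trans (FG2 _) _; apply: heq2_sym.
  by apply: heq2_trans (heq2_rwhisk_map _ _) _; apply: heq2_rwhisk.
Qed.

Lemma bijective_2isomorphism : is_2isomorphism F.
Proof.
have GF0 X : G0 (m0 F X) = X by apply: inj0; apply: FG0.
have GF1 (X Y : B) (f : hom1 X Y) : heq1 (G1 (m1 F f)) f.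
  by apply: heq1_inj.
split=> //; exists G; split; first exact: inverse_2functor.
split; apply: map2_eq => //= X Y f g a.
by apply: heq2_inj.
Qed.
End Inverse.

(** * The pseudo-comonad *)

(** The identities along [p] form a natural family, which expresses equality of the actions on
    morphisms without a transport. *)
Lemma functor_eq (C D : category) (F G : functor C D) (p : forall X, F X = G X) :
  (forall (X Y : C) (f : hom X Y),
    ob_idm (p Y) ∘ fmap F f = fmap G f ∘ ob_idm (p X)) -> F = G.
Proof.
case: F G p => [o m m1 mM] [o' m' m1' mM'] /= p.
have e : o = o' by apply: functional_extensionality.
subst o' => H; have e : m = m'.
  apply: functional_extensionality_dep => X.
  apply: functional_extensionality_dep => Y.
  apply: functional_extensionality => f.
  by have := H _ _ f; rewrite !ob_idm_refl mcomp1m mcompm1.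
by subst m'; apply: functor_eq_laws.
Qed.

Lemma hY_ob_idm (C : clidl) (S T : Ses_clidl C) (p : S = T) (q : sY S = sY T) :
  hY (ob_idm p) = ob_idm q.
Proof. by case: T / p q => q; rewrite !ob_idm_refl. Qed.

Lemma hY_idcell (C : ClIdl) (D : clidl) (F G : @hom1 ClIdl C (Ses_clidl D)) (e : F = G)
    (S : (C : clidl)) (q : sY (ev1 F S : ses D) = sY (ev1 G S : ses D)) :
  hY (ev (idcell e) S) = ob_idm q.
Proof.
rewrite (@ev_idcell C (Ses_clidl D) F G e S
  (f_equal (fun K : @hom1 ClIdl C (Ses_clidl D) => ev1 K S) e)).
exact: hY_ob_idm.
Qed.

Lemma hY_comp (C : clidl) (R S T : ses_cat C) (v : hom S T) (u : hom R S) :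
  hY (v ∘ u) = hY v ∘ hY u.
Proof. by []. Qed.

Section Lift.
Variables (C : clidl) (S T : ses_cat C) (v : hom (sY S) (sY T)).
Hypothesis vN : ci_null C (sg T ∘ v ∘ sf S).

Let vN' : ci_null C (sg T ∘ (v ∘ sf S)).
Proof. by rewrite mcompA. Qed.

(** Nullness of [sg T ∘ v ∘ sf S] makes [v ∘ sf S] lift through the kernel [sf T] and [sg T ∘ v]
    descend along the cokernel [sg S]; these factorizations are the outer components. *)
Definition ses_lift : hom S T :=
  SesHom (esym (kernel_factorE (sP T).1 vN')) (cokernel_factorE (sP S).2 vN).
End Lift.

Lemma hY_Omega2 (C D : ClIdl) (f g : hom1 C D) (a : cell f g) (S : ses C) :
  hY (ev (m2 Omega a) S) = ev a (sY S).
Proof. by []. Qed.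

Lemma hY_Omega1 (C D : ClIdl) (f : hom1 C D) (S T : ses_cat C) (u : hom S T) :
  hY (evm (m1 Omega f) u) = evm f (hY u).
Proof. by []. Qed.

Lemma hY_Omega_id (C : ClIdl) (S : ses C) : hY (ev (ps_id Omega C) S) = idm _.
Proof. by []. Qed.

Lemma hY_Omega_comp (C D E : ClIdl) (g : hom1 D E) (f : hom1 C D) (S : ses C) :
  hY (ev (ps_comp Omega g f) S) = idm _.
Proof. by []. Qed.

Lemma hY_Omega_compV (C D E : ClIdl) (g : hom1 D E) (f : hom1 C D) (S : ses C) :
  hY (ev (ps_compV Omega g f) S) = idm _.
Proof. by []. Qed.

Lemma hY_idm (C : clidl) (S : ses_cat C) : hY (idm S) = idm (sY S).
Proof. by []. Qed.

Definition hYE := (hY_comp, hY_Omega2, hY_Omega1, hY_Omega_id, hY_Omega_comp,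
  hY_Omega_compV, hY_idm).

(** Equality of morphisms of short exact sequences is tested on middle components, where the
    comparison cells of [Omega] become identities. *)
Ltac middle :=
  rewrite ?evE; apply: ses_hom_eq; rewrite ?hYE ?evE; ev_idcells;
  rewrite ?evE ?hYE ?evE.

(** The inverse is the lift of [v], which is what the null condition is for; both inverse laws
    follow from the middle component. *)
Lemma ses_iso (C : clidl) (S T : ses_cat C) (u : hom S T) (v : hom (sY T) (sY S)) :
  v ∘ hY u = idm _ -> hY u ∘ v = idm _ -> ci_null C (sg S ∘ v ∘ sf T) -> is_iso u.
Proof.
by move=> vu uv vN; exists (ses_lift vN); split; apply: ses_hom_eq.
Qed.

(** Inverses of the components are selected by choice, and their naturality follows from that of
    [a]. *)
Lemma invertible_pointwise (C D : ClIdl) (f g : hom1 C D) (a : cell f g) :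
  (forall S, is_iso (ev a S)) -> invertible a.
Proof.
move=> aI.
have [b bP] : exists b : forall S, hom (ev1 g S) (ev1 f S),
    forall S, b S ∘ ev a S = idm _ /\ ev a S ∘ b S = idm _.
  exists (fun S => proj1_sig (constructive_indefinite_description _ (aI S))) => S.
  by case: constructive_indefinite_description.
have bN S T (u : hom S T) : b T ∘ evm g u = evm f u ∘ b S.
  rewrite -(mcompm1 (evm g u)) -(bP S).2 2!mcompA -(mcompA _ (evm g u)).
  by rewrite -ev_nat mcompA (bP T).1 mcomp1m.
exists (@NatTrans _ _ (g : clidl_hom C D) (f : clidl_hom C D) b bN).
by split; apply: ev_ext => S; [exact: (bP S).1|exact: (bP S).2].
Qed.

(** * Coherence laws of [Omega], [epsilon] and [delta] *)

Lemma Omega_psfunctor : is_psfunctor Omega.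
Proof.
split; last 7 first.
1-7: by move=> *; apply: ev_ext => S; middle.
1-2: by move=> *; apply: ev_ext => S; apply: ses_hom_eq.
move=> C; apply: invertible_pointwise => S.
apply: (@ses_iso C S (Omega_ob (id_clidl_hom C) S) (Omega_id_at S) (idm (sY S))).
- exact: mcomp1m.
- exact: mcomp1m.
- by rewrite mcompm1; apply: ses_null.
Qed.

Lemma epsilon_pstrans : @is_pstrans ClIdl ClIdl Omega (id_psfunctor ClIdl) epsilon.
Proof.
split.
- move=> C D G; apply: invertible_pointwise => S; exists (idm (G (sY S))).
  by rewrite mcomp1m.
- by move=> *; apply: ev_ext => S; rewrite ?evE.
- by move=> *; apply: ev_ext => S; rewrite ?evE; ev_idcells; rewrite ?evE.
- by move=> *; apply: ev_ext => S; rewrite ?evE.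
Qed.

Lemma delta_pstrans : @is_pstrans ClIdl ClIdl Omega (comp_psfunctor Omega Omega) delta.
Proof.
split.
- move=> C D G; apply: invertible_pointwise => S.
  have iso_at : is_iso (delta_nat_at G S); last exact iso_at.
  apply: (@ses_iso (Ses_clidl D) _ _ (delta_nat_at G S)
    (@idm (ses_cat D) (Omega_ob G S))).
  + exact: mcomp1m.
  + exact: mcomp1m.
  (* Nullness is tested on the middle component, which is the composite of the sequence
     [Omega_ob G S]. *)
  + by rewrite mcompm1; apply/ses_idealP; apply: (ses_null (Omega_ob G S)).
- by move=> *; apply: ev_ext => S; middle.
- by move=> *; apply: ev_ext => S; middle.
- by move=> *; apply: ev_ext => S; middle.
Qed.

(** * The coassociativity and counit comparisons *)

Section Comonad.
Variable A : ClIdl.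

(** Both iterated diagrams have [delta_ob S] in the middle, so the comparison can lie over its
    identity. The middle component of the composite is that of the two morphisms of [delta_ob S]. *)
Lemma coassoc_null (S : Ses_clidl A) :
  @ses_ideal (Ses_clidl A) _ _ (sg (delta_ob (delta_ob S)) ∘ idm (delta_ob S) ∘
    sf (Omega_ob (delta_hom A) (delta_ob S))).
Proof. by rewrite mcompm1; apply/ses_idealP; apply: (ses_null (delta_ob S)). Qed.

Definition coassoc_at (S : Ses_clidl A) :
    hom (Omega_ob (delta_hom A) (delta_ob S) : Ses_clidl (Ses_clidl (Ses_clidl A)))
        (delta_ob (delta_ob S)) :=
  @ses_lift (Ses_clidl (Ses_clidl A)) (Omega_ob (delta_hom A) (delta_ob S))
    (delta_ob (delta_ob S)) (idm (delta_ob S)) (coassoc_null S).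

Lemma coassoc_nat (S T : Ses_clidl A) (u : hom S T) :
  coassoc_at T ∘ fmap (comp_clidl_hom (Omega_hom (delta_hom A)) (delta_hom A)) u =
  fmap (comp_clidl_hom (delta_hom (Ses_clidl A)) (delta_hom A)) u ∘ coassoc_at S.
Proof. by apply: ses_hom_eq; apply: id_square. Qed.

Definition coassoc : @cell ClIdl _ _ (m1 Omega (delta A) ⊚ delta A)
    (delta (m0 Omega A) ⊚ delta A) :=
  @NatTrans _ _ (comp_clidl_hom (Omega_hom (delta_hom A)) (delta_hom A))
    (comp_clidl_hom (delta_hom (Ses_clidl A)) (delta_hom A)) coassoc_at coassoc_nat.

Lemma coassoc_inv : invertible coassoc.
Proof.
apply: invertible_pointwise => S.
have iso_at : is_iso (coassoc_at S); last exact iso_at.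
apply: (@ses_iso (Ses_clidl (Ses_clidl A)) _ _ (coassoc_at S)
  (@idm (ses_cat (Ses_clidl A)) (delta_ob S))).
- exact: mcomp1m.
- exact: mcomp1m.
- by rewrite mcompm1; apply/ses_idealP; apply: (ses_null (delta_ob S)).
Qed.

Lemma counitl_eq : epsilon (m0 Omega A) ⊚ delta A = id1 (m0 Omega A).
Proof. by apply: clidl_hom_eq; apply: functor_eq_laws. Qed.

(** The left-hand side is the middle column of the diagram of [S], that is, [S] with another proof
    of short exactness. The counit comparison is therefore a strict equality. *)
Lemma counitr_ob (S : Ses_clidl A) :
  Omega_ob (epsilon_hom A) (delta_ob S) = S :> Ses_clidl A.
Proof.
case: S => X Y Z f g P; rewrite /Omega_ob /=.
by congr Ses; apply: proof_irrelevance.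
Qed.

Lemma counitr_eq : m1 Omega (epsilon A) ⊚ delta A = id1 (m0 Omega A).
Proof.
apply: clidl_hom_eq; apply: (@functor_eq (Ses_clidl A) (Ses_clidl A)
  (comp_clidl_hom (Omega_hom (epsilon_hom A)) (delta_hom A))
  (id_clidl_hom (Ses_clidl A)) counitr_ob) => S T u.
apply: ses_hom_eq.
have e (R : Ses_clidl A) : hY (ob_idm (counitr_ob R)) = idm (sY R) :=
  hY_ob_idm (counitr_ob R) erefl.
apply: etrans (f_equal (fun z => z ∘ hY u) (e T)) _.
apply: etrans (id_square (hY u)) _.
exact: (f_equal (fun z => hY u ∘ z) (esym (e S))).
Qed.
End Comonad.

Lemma hY_coassoc (A : ClIdl) (S : ses A) : hY (ev (coassoc A) S) = idm _.
Proof. by []. Qed.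

Lemma hY_counitl (A : ClIdl) (S : ses A) : hY (ev (idcell (counitl_eq A)) S) = idm _.
Proof. exact: (@hY_idcell (Ses_clidl A) A _ _ (counitl_eq A) S erefl). Qed.

Lemma hY_counitr (A : ClIdl) (S : ses A) : hY (ev (idcell (counitr_eq A)) S) = idm _.
Proof. exact: (@hY_idcell (Ses_clidl A) A _ _ (counitr_eq A) S erefl). Qed.

Lemma evm_delta (C : ClIdl) (S T : Ses_clidl C) (u : hom S T) :
  hY (evm (delta C) u) = u.
Proof. by []. Qed.

Lemma evm_epsilon (C : ClIdl) (S T : Ses_clidl C) (u : hom S T) :
  evm (epsilon C) u = hY u.
Proof. by []. Qed.

Lemma hY_delta2 (C D : ClIdl) (f : hom1 C D) (S : ses C) :
  hY (ev (t2 delta f) S) = idm _.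
Proof. by []. Qed.

Lemma ev_epsilon2 (C D : ClIdl) (f : hom1 C D) (S : ses C) :
  ev (t2 epsilon f) S = idm _.
Proof. by []. Qed.

Definition comonadE := (evm_delta, evm_epsilon, hY_delta2, ev_epsilon2,
  hY_coassoc, hY_counitl, hY_counitr).

(** Every axiom is an equation over identities in the middle. The definition stays transparent
    because the coalgebra axioms are later checked by unfolding [Xi], [cunitl] and [cunitr]. *)
Definition Omega_comonad : pseudo_comonad epsilon delta.
Proof.
refine (@PseudoComonad ClIdl Omega epsilon delta Omega_psfunctor epsilon_pstrans
  delta_pstrans coassoc coassoc_inv _ (fun A => idcell (counitl_eq A))
  (fun A => invertible_idcell (counitl_eq A)) _ (fun A => idcell (counitr_eq A))
  (fun A => invertible_idcell (counitr_eq A)) _ _ _).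
- by move=> X Y f; apply: ev_ext => S; middle; rewrite !comonadE.
- move=> X Y f; apply: ev_ext => S; middle; rewrite ?comonadE.
  exact: (@hY_idcell (Ses_clidl X) Y _ _
    (etrans (unit1r (m1 Omega f)) (esym (unit1l (m1 Omega f)))) S erefl).
- move=> X Y f; apply: ev_ext => S; middle; rewrite ?comonadE.
  have H := @hY_idcell (Ses_clidl X) Y _ _
    (etrans (unit1r (m1 Omega f)) (esym (unit1l (m1 Omega f)))) S erefl.
  apply: etrans (f_equal (fun z => z ∘ evm f (idm (sY S))) H) _.
  by rewrite evm_id mcomp1m.
- by move=> X; apply: ev_ext => S; middle; rewrite !comonadE.
- by move=> X; apply: ev_ext => S; middle; rewrite !comonadE.
Defined.

Lemma Omega_comonad_counit : identity_counit_comparisons Omega_comonad.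
Proof. by move=> C; split; [exists (counitl_eq C)|exists (counitr_eq C)]. Qed.

(** * Short exact choices and pretorsion theories *)

Lemma iso_comp (C : category) (A B D : C) (g : hom B D) (f : hom A B) :
  is_iso g -> is_iso f -> is_iso (g ∘ f).
Proof.
case=> g' [gg' g'g] [f' [ff' f'f]]; exists (f' ∘ g'); split.
  by rewrite -mcompA (mcompA g') gg' mcomp1m.
by rewrite -mcompA (mcompA f) f'f mcomp1m.
Qed.

Lemma iso_cancelr (C : category) (A B D : C) (g : hom B D) (f : hom A B) :
  is_iso f -> is_iso (g ∘ f) -> is_iso g.
Proof.
case=> f' [f'f ff'] gf; have -> : g = g ∘ f ∘ f' by rewrite -mcompA ff' mcompm1.
by apply: iso_comp gf _; exists f.
Qed.

Lemma iso_cancell (C : category) (A B D : C) (g : hom B D) (f : hom A B) :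
  is_iso g -> is_iso (g ∘ f) -> is_iso f.
Proof.
case=> g' [g'g gg'] gf; have -> : f = g' ∘ (g ∘ f) by rewrite mcompA g'g mcomp1m.
by apply: iso_comp _ gf; exists g.
Qed.

Lemma iso_fmap (C D : category) (F : functor C D) (A B : C) (f : hom A B) :
  is_iso f -> is_iso (fmap F f).
Proof. by case=> g [gf fg]; exists (fmap F g); rewrite -!fmapM gf fg !fmap1. Qed.

Lemma iso_hX (C : clidl) (S T : Ses_clidl C) (u : hom S T) : is_iso u -> is_iso (hX u).
Proof.
case=> v [vu uv]; exists (hX v); split.
  by rewrite -[LHS]/(hX (v ∘ u)) vu.
by rewrite -[LHS]/(hX (u ∘ v)) uv.
Qed.

Lemma iso_hZ (C : clidl) (S T : Ses_clidl C) (u : hom S T) : is_iso u -> is_iso (hZ u).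
Proof.
case=> v [vu uv]; exists (hZ v); split.
  by rewrite -[LHS]/(hZ (v ∘ u)) vu.
by rewrite -[LHS]/(hZ (u ∘ v)) uv.
Qed.

(** For null [f] the identity of [A] itself factors through [k]. *)
Lemma kernel_null_iso (C : category) (N : mor_class C) (A B K : C) (f : hom A B)
    (k : hom K A) : is_ideal N -> is_kernel N f k -> N _ _ f -> is_iso k.
Proof.
move=> NI kP Nf; have Nf1 : N _ _ (f ∘ idm A) by rewrite mcompm1.
exists (kernel_factor kP Nf1); split; last exact: kernel_factorE.
by apply: (kernel_mono NI kP); rewrite mcompA kernel_factorE mcomp1m mcompm1.
Qed.

Lemma cokernel_null_iso (C : category) (N : mor_class C) (A B Q : C) (f : hom A B)
    (c : hom B Q) : is_ideal N -> is_cokernel N f c -> N _ _ f -> is_iso c.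
Proof.
move=> NI cP Nf; have Nf1 : N _ _ (idm B ∘ f) by rewrite mcomp1m.
exists (cokernel_factor cP Nf1); split; first exact: cokernel_factorE.
by apply: (cokernel_epi NI cP); rewrite -mcompA cokernel_factorE mcomp1m mcompm1.
Qed.

(** By closedness [k ∘ u] factors through a null object [D]. The leg out of [D] composes with [f] to
    a null morphism, hence lifts through [k], and [u] factors through [D]. *)
Lemma kernel_reflects_null (C : clidl) (A B K H : C) (f : hom A B) (k : hom K A)
    (u : hom H K) : is_kernel (@ci_null C) f k -> ci_null C (k ∘ u) -> ci_null C u.
Proof.
move=> kP /((ci_closed C).2 _ _ _) [D [ND [h [g e]]]].
have fh : ci_null C (f ∘ h) by rewrite -(mcompm1 (f ∘ h)); apply: nullL.
rewrite -(kernel_factorE kP fh) -mcompA in e.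
rewrite (kernel_mono (ci_ideal C) kP e) -(mcompm1 (kernel_factor _ _)).
by apply: nullR; apply: nullL.
Qed.

Lemma cokernel_reflects_null (C : clidl) (A B Q H : C) (f : hom A B) (c : hom B Q)
    (u : hom Q H) : is_cokernel (@ci_null C) f c -> ci_null C (u ∘ c) -> ci_null C u.
Proof.
move=> cP /((ci_closed C).2 _ _ _) [D [ND [h [g e]]]].
have gf : ci_null C (g ∘ f) by rewrite -(mcomp1m (g ∘ f)); apply: nullR.
rewrite -(cokernel_factorE cP gf) mcompA in e.
rewrite (cokernel_epi (ci_ideal C) cP e) -(mcompm1 h).
by apply: nullR; apply: nullL.
Qed.

(** The strict form of a section of the counit: its objects of the middle row are
    definitionally the given ones, and [cN] is what makes it functorial. *)
Record ses_choice (C : clidl) := SesChoice {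
  cX : C -> C;
  cZ : C -> C;
  cl : forall X, hom (cX X) X;
  cr : forall X, hom X (cZ X);
  cP : forall X, is_short_exact (@ci_null C) (cl X) (cr X);
  cN : forall (X Y : C) (h : hom X Y), ci_null C (cr Y ∘ h ∘ cl X)
}.

(** * The bihereditary pretorsion theory of a choice *)

Section Choice.
Variables (C : clidl) (K : ses_choice C).

Definition choice_ses (X : C) : Ses_clidl C := Ses (cP K X).

Definition choice_mor (X Y : C) (h : hom X Y) : hom (choice_ses X) (choice_ses Y) :=
  @ses_lift C (choice_ses X) (choice_ses Y) h (cN K h).

Definition choice_functor : functor C (Ses_clidl C).
Proof.
by apply: (@Functor C (Ses_clidl C) choice_ses choice_mor) => *; apply: ses_hom_eq.
Defined.

Definition choice_preserves : Prop :=
  preserves_kernels (@ci_null C) (@ses_ideal C) choice_functor /\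
  preserves_cokernels (@ci_null C) (@ses_ideal C) choice_functor.

Definition choice_torsion (X : C) : Prop := is_iso (cl K X).
Definition choice_torsionfree (X : C) : Prop := is_iso (cr K X).

Let N := @pretorsion_null C choice_torsion choice_torsionfree.

(** If [cl K D] and [cr K D] are invertible, [idm D] arises from the null [cr K D ∘ cl K D] by
    composing with the inverses. Conversely, on a null object these are a kernel and a cokernel of
    null morphisms, hence invertible. *)
Lemma choice_null : N = @ci_null C.
Proof.
apply: functional_extensionality_dep => A; apply: functional_extensionality_dep => B.
apply: functional_extensionality => f; apply: propositional_extensionality; split.
  case=> D [[[l' [l'l ll']] [r' [r'r rr']]] [h [g ->]]].
  apply: nullR; rewrite -(mcompm1 h); apply: nullL.
  rewrite -ll' -(mcomp1m (cl K D)) -r'r -!mcompA; apply: nullL; rewrite mcompA.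
  by apply: nullR; apply: (cP K D).1.1.
move=> /((ci_closed C).2 _ _ _) [D [ND [h [g ->]]]]; exists D.
split; last by exists h, g.
split; [apply: (kernel_null_iso (ci_ideal C) (cP K D).1)
       |apply: (cokernel_null_iso (ci_ideal C) (cP K D).2)].
  by rewrite -(mcompm1 (cr K D)); apply: nullL.
by rewrite -(mcomp1m (cl K D)); apply: nullR.
Qed.

Lemma choice_torsion_replete : replete choice_torsion.
Proof.
move=> A B i iI tA; have e := hl (choice_mor i).
apply: (iso_cancelr (f := hX (choice_mor i))).
  exact: iso_hX (iso_fmap choice_functor iI).
by rewrite -[X in is_iso X]e; apply: iso_comp.
Qed.

Lemma choice_torsionfree_replete : replete choice_torsionfree.
Proof.
move=> A B i iI tA; have e := hr (choice_mor i).
apply: (iso_cancelr iI); rewrite -[X in is_iso X]e; apply: iso_comp tA.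
exact: iso_hZ (iso_fmap choice_functor iI).
Qed.

(** Up to the isomorphisms [cl K A] and [cr K B], [f] is the composite that [cN] declares null. *)
Lemma choice_T1 (A B : C) (f : hom A B) :
  choice_torsion A -> choice_torsionfree B -> N f.
Proof.
move=> [l [_ ll]] [r [rr _]]; rewrite choice_null.
have -> : f = r ∘ (cr K B ∘ f ∘ cl K A) ∘ l.
  by rewrite 2!mcompA rr mcomp1m -mcompA ll mcompm1.
by apply: nullR; apply: nullL; apply: cN.
Qed.

Lemma choice_T2 (X : C) : is_short_exact N (cl K X) (cr K X).
Proof. by rewrite choice_null; apply: cP. Qed.

Hypothesis KP : choice_preserves.

Lemma choice_tors_torsion (X : C) : choice_torsion (cX K X).
Proof.
(* The second half of the kernel criterion, for [cl K X] as kernel of [cr K X], makes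
   [cl K (cX K X)] a kernel of [cr K X ∘ cl K X]. *)
have [_ k] := (ses_kernelP _ _).1 (KP.1 _ _ _ _ _ (cP K X).1).
by apply: (kernel_null_iso (ci_ideal C) k); apply: (cP K X).1.1.
Qed.

Lemma choice_tfree_torsionfree (X : C) : choice_torsionfree (cZ K X).
Proof.
have [_ k] := (ses_cokernelP _ _).1 (KP.2 _ _ _ _ _ (cP K X).2).
by apply: (cokernel_null_iso (ci_ideal C) k); apply: (cP K X).1.1.
Qed.

Definition choice_pretorsion : pretorsion :=
  @Pretorsion C choice_torsion choice_torsionfree choice_torsion_replete
    choice_torsionfree_replete choice_T1 (cX K) (cZ K) (cl K) (cr K)
    choice_tors_torsion choice_tfree_torsionfree choice_T2.

Lemma choice_hereditary : hereditary choice_pretorsion.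
Proof.
rewrite /hereditary /pt_null /= -/N choice_null => A B L f k kP.
have [_ k2] := (ses_kernelP _ _).1 (KP.1 _ _ _ _ _ kP).
have fE (X Y : C) (h : hom X Y) : cl K Y ∘ fmap (torsion_functor choice_pretorsion) h =
    h ∘ cl K X by exact: tors_morE.
have mono X (H : C) (u v : hom H (cX K X)) : cl K X ∘ u = cl K X ∘ v -> u = v.
  exact: (kernel_mono (ci_ideal C) (cP K X).1).
split.
  apply: (kernel_reflects_null (cP K B).1).
  by rewrite mcompA fE -mcompA fE mcompA; apply: nullR; apply: kP.1.
move=> H h hN.
(* The morphism [cl K A ∘ h] becomes null under [f], so it lifts through [k]; the lift [g] in turn
   lifts through [cl K L], which is a kernel of [cr K A ∘ k] by [k2]. *)
have [g [gE _]] : exists! g, k ∘ g = cl K A ∘ h.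
  by apply: kP.2; rewrite mcompA -fE -mcompA; apply: nullL.
have [w [wE _]] : exists! w, cl K L ∘ w = g.
  apply: k2.2; rewrite /= -mcompA gE mcompA.
  by apply: nullR; apply: (cP K A).1.1.
exists w; split; first by apply: mono; rewrite mcompA fE -mcompA wE gE.
move=> w' e'; apply: (mono L); apply: (kernel_mono (ci_ideal C) kP).
by rewrite wE gE -e' 2!mcompA fE.
Qed.

Lemma choice_cohereditary : cohereditary choice_pretorsion.
Proof.
rewrite /cohereditary /pt_null /= -/N choice_null => A B L f k kP.
have [_ k2] := (ses_cokernelP _ _).1 (KP.2 _ _ _ _ _ kP).
have fE (X Y : C) (h : hom X Y) :
    fmap (torsionfree_functor choice_pretorsion) h ∘ cr K X = cr K Y ∘ h.
  exact: tfree_morE.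
have epi X (H : C) (u v : hom (cZ K X) H) : u ∘ cr K X = v ∘ cr K X -> u = v.
  exact: (cokernel_epi (ci_ideal C) (cP K X).2).
split.
  apply: (cokernel_reflects_null (cP K A).2).
  by rewrite -mcompA fE mcompA fE -mcompA; apply: nullL; apply: kP.1.
move=> H h hN.
have [g [gE _]] : exists! g, g ∘ k = h ∘ cr K B.
  by apply: kP.2; rewrite -mcompA -fE mcompA; apply: nullR.
have [w [wE _]] : exists! w, w ∘ cr K L = g.
  apply: k2.2; rewrite /= mcompA gE -mcompA.
  by apply: nullL; apply: (cP K B).1.1.
exists w; split; first by apply: epi; rewrite -mcompA fE mcompA wE gE.
move=> w' e'; apply: (epi L); apply: (cokernel_epi (ci_ideal C) kP).
by rewrite wE gE -e' -!mcompA fE.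
Qed.

Lemma choice_kernels : has_kernels (@pt_null choice_pretorsion).
Proof. by rewrite /pt_null /= -/N choice_null; apply: ci_kernels. Qed.

Lemma choice_cokernels : has_cokernels (@pt_null choice_pretorsion).
Proof. by rewrite /pt_null /= -/N choice_null; apply: ci_cokernels. Qed.

Definition choice_bihptors : bihptors :=
  BiHPTorsOb choice_kernels choice_cokernels choice_hereditary choice_cohereditary.
End Choice.

(** * The choice underlying a bihereditary pretorsion theory *)

Section PretorsionChoice.
Variable P : bihptors.
Let C : clidl := bh_clidl P.

Definition pretorsion_choice : ses_choice C :=
  @SesChoice C (@tors P) (@tfree P) (@ell P) (@rho P) (@pt_T2 P)
    (@tfree_mor_null P).

Lemma pretorsion_choice_preserves : choice_preserves pretorsion_choice.
Proof.
have KE (X Y : C) (h : hom X Y) : ell Y ∘ fmap (torsion_functor P) h = h ∘ ell X.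
  exact: tors_morE.
have QE (X Y : C) (h : hom X Y) : fmap (torsionfree_functor P) h ∘ rho X = rho Y ∘ h.
  exact: tfree_morE.
have nul (X : C) : ci_null C (rho X ∘ ell X) by apply: (pt_T2 X).1.1.
split=> A B L f k kP.
  apply: ses_kernel_intro => //=.
  have Tk : is_kernel (@ci_null C) _ _ := bh_hereditary kP.
  split; first by rewrite -mcompA -KE mcompA; apply: (@nullR C).
  move=> H h hN; have {}hN : ci_null C (rho A ∘ (k ∘ h)) by rewrite mcompA.
  have [g [gE _]] := (pt_T2 A).1.2 _ _ hN.
  (* Since [ell B] reflects null morphisms, the torsion part of [f] composed with [g] is null, so
     [g] lifts through the torsion part of [k], a kernel by heredity. The lift [w] is the required
     factorization of [h]. *)
  have [|w [wE _]] := Tk.2 _ g.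
    apply: (@kernel_reflects_null C _ _ _ _ _ _ _ (pt_T2 B).1).
    by rewrite mcompA KE -mcompA gE mcompA; apply: (@nullR C); apply: kP.1.
  exists w; split=> [|w' e]; last first.
    apply: (kernel_mono (ci_ideal C) (pt_T2 L).1); rewrite e.
    apply: (kernel_mono (ci_ideal C) kP).
    by rewrite mcompA -KE -mcompA wE gE.
  by apply: (kernel_mono (ci_ideal C) kP); rewrite mcompA -KE -mcompA wE gE.
apply: ses_cokernel_intro => //=.
have Fk : is_cokernel (@ci_null C) _ _ := bh_cohereditary kP.
split; first by rewrite mcompA -QE -mcompA; apply: (@nullL C).
move=> H h hN; have {}hN : ci_null C (h ∘ k ∘ ell B) by rewrite -mcompA.
have [g [gE _]] := (pt_T2 B).2.2 _ _ hN.
have [|w [wE _]] := Fk.2 _ g.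
  apply: (@cokernel_reflects_null C _ _ _ _ _ _ _ (pt_T2 A).2).
  by rewrite -mcompA QE mcompA gE -mcompA; apply: (@nullL C); apply: kP.1.
exists w; split=> [|w' e]; last first.
  apply: (cokernel_epi (ci_ideal C) (pt_T2 L).2); rewrite e.
  apply: (cokernel_epi (ci_ideal C) kP).
  by rewrite -mcompA -QE mcompA wE gE.
by apply: (cokernel_epi (ci_ideal C) kP); rewrite -mcompA -QE mcompA wE gE.
Qed.

Lemma pretorsion_torsionE : choice_torsion pretorsion_choice = @torsion P.
Proof.
apply: functional_extensionality => X; apply: propositional_extensionality; split.
  by move=> lI; apply: (torsion_replete lI); apply: tors_torsion.
(* For torsion [X] the morphism [rho X] is null by (T1), so its kernel [ell X] is invertible. *)
move=> tX; apply: (kernel_null_iso (ci_ideal C) (pt_T2 X).1).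
by apply: pt_T1 => //; apply: tfree_torsionfree.
Qed.

Lemma pretorsion_torsionfreeE :
  choice_torsionfree pretorsion_choice = @torsionfree P.
Proof.
apply: functional_extensionality => X; apply: propositional_extensionality; split.
  move=> [s [sr rs]]; apply: (@torsionfree_replete P (tfree X) X s).
    by exists (rho X).
  exact: tfree_torsionfree.
move=> tX; apply: (cokernel_null_iso (ci_ideal C) (pt_T2 X).2).
by apply: pt_T1 => //; apply: tors_torsion.
Qed.
End PretorsionChoice.

(** Besides the two predicates, the fields are either shared data or propositions. *)
Lemma bihptors_eq (C : category) (T F T' F' : C -> Prop) (t f : C -> C) l r
    rT rT' rF rF' t1 t1' tT tT' fF fF' t2 t2' k k' c c' h h' ch ch' :
  T = T' -> F = F' ->
  @BiHPTorsOb (@Pretorsion C T F rT rF t1 t f l r tT fF t2) k c h ch =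
  @BiHPTorsOb (@Pretorsion C T' F' rT' rF' t1' t f l r tT' fF' t2') k' c' h' ch'.
Proof.
move=> ? ?; subst T' F'.
have ? := proof_irrelevance _ rT rT'; have ? := proof_irrelevance _ rF rF'.
have ? := proof_irrelevance _ t1 t1'; have ? := proof_irrelevance _ tT tT'.
have ? := proof_irrelevance _ fF fF'; have ? := proof_irrelevance _ t2 t2'.
by subst; congr BiHPTorsOb; apply: proof_irrelevance.
Qed.

Lemma choice_pretorsionK (P : bihptors) :
  choice_bihptors (pretorsion_choice_preserves P) = P.
Proof.
have := pretorsion_torsionE P; have := pretorsion_torsionfreeE P.
move: (pretorsion_choice_preserves P) => KP.
case: P KP => [[C T F rT rF t1 t f l r tT fF t2] k c h ch] KP eF eT.
by apply: bihptors_eq.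
Qed.

Lemma ob_idmK (C : category) (A B : C) (p : A = B) : ob_idm (esym p) ∘ ob_idm p = idm A.
Proof. by rewrite ob_idmM ob_idm_refl. Qed.

Lemma ob_idmVK (C : category) (A B : C) (p : A = B) :
  ob_idm p ∘ ob_idm (esym p) = idm B.
Proof. by rewrite ob_idmM ob_idm_refl. Qed.

(** * The choice underlying a section of the counit *)

Section Coalgebra.
Variables (C : clidl) (l : clidl_hom C (Ses_clidl C)).
Hypothesis lN : comp_clidl_hom (epsilon_hom C) l = id_clidl_hom C.

Definition str_ob (X : C) : sY (l X) = X :=
  f_equal (fun G : clidl_hom C C => G X) lN.

Lemma str_mor (X Y : C) (h : hom X Y) :
  ob_idm (str_ob Y) ∘ hY (fmap l h) = h ∘ ob_idm (str_ob X).
Proof.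
rewrite /str_ob.
have H (F G : clidl_hom C C) (e : F = G) :
    ob_idm (f_equal (fun G : clidl_hom C C => G Y) e) ∘ fmap F h =
    fmap G h ∘ ob_idm (f_equal (fun G : clidl_hom C C => G X) e).
  by case: G / e; apply: id_square.
exact: (H _ _ lN).
Qed.

Definition str_l (X : C) : hom (sX (l X)) X := ob_idm (str_ob X) ∘ sf (l X).
Definition str_r (X : C) : hom X (sZ (l X)) := sg (l X) ∘ ob_idm (esym (str_ob X)).

(** The middle object of [l X] equals [X] only propositionally. Moving the sequence along this
    equality changes nothing once the equality is eliminated. *)
Lemma ses_rebase (S : ses C) (Y : C) (p : sY S = Y) :
  is_short_exact (@ci_null C) (ob_idm p ∘ sf S) (sg S ∘ ob_idm (esym p)) /\
  forall P, @Ses C _ _ _ (ob_idm p ∘ sf S) (sg S ∘ ob_idm (esym p)) P = S.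
Proof.
case: Y / p => /=; rewrite mcomp1m mcompm1; split; first exact: sP.
by case: S => [X Y Z f g P'] P; congr Ses; apply: proof_irrelevance.
Qed.

Lemma str_null (X Y : C) (h : hom X Y) : ci_null C (str_r Y ∘ h ∘ str_l X).
Proof.
rewrite /str_r /str_l -!mcompA (mcompA h) -str_mor.
rewrite 2!(mcompA (ob_idm (esym _))) ob_idmK mcomp1m hl mcompA.
by apply: nullR; apply: ses_null.
Qed.

Definition str_choice : ses_choice C :=
  @SesChoice C _ _ str_l str_r (fun X => (ses_rebase (str_ob X)).1) str_null.

Lemma str_choice_ob (X : C) : choice_ses str_choice X = l X.
Proof. exact: (ses_rebase (str_ob X)).2. Qed.

(** The equality is strict, so [l] can be recovered from its choice and its preservation properties
    carry over by rewriting. *)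
Lemma str_choiceE : choice_functor str_choice = l.
Proof.
apply: (@functor_eq C (Ses_clidl C) (choice_functor str_choice) l str_choice_ob).
move=> X Y h; apply: ses_hom_eq; rewrite !hY_comp.
rewrite (hY_ob_idm (str_choice_ob X) (esym (str_ob X))).
rewrite (hY_ob_idm (str_choice_ob Y) (esym (str_ob Y))).
rewrite -[RHS]mcomp1m -(ob_idmK (str_ob Y)) -!mcompA; congr (_ ∘ _).
by rewrite mcompA str_mor -mcompA ob_idmVK mcompm1.
Qed.

Lemma str_choice_preserves : choice_preserves str_choice.
Proof.
rewrite /choice_preserves str_choiceE; split; first exact: (@ch_kernels _ _ l).
exact: (@ch_cokernels _ _ l).
Qed.
End Coalgebra.

(** * The pseudo-coalgebra of a choice *)

Section ChoiceCoalgebra.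
Variables (C : clidl) (K : ses_choice C) (KP : choice_preserves K).

Definition choice_hom : clidl_hom C (Ses_clidl C) :=
  @ClIdlHom C (Ses_clidl C) (choice_functor K) KP.1 KP.2.

Let l : @hom1 ClIdl C (m0 Omega C) := choice_hom.

Lemma choice_normal : epsilon C ⊚ l = id1 (C : ClIdl).
Proof. by apply: clidl_hom_eq; apply: functor_eq_laws. Qed.

Lemma choice_cell_null (X : C) : @ses_ideal C _ _
  (sg (delta_ob (choice_ses K X)) ∘ idm (choice_ses K X) ∘
    sf (Omega_ob choice_hom (choice_ses K X))).
Proof.
by rewrite mcompm1; apply/ses_idealP; apply: (ses_null (choice_ses K X)).
Qed.

Definition choice_cell_at (X : C) :
    hom (Omega_ob choice_hom (choice_ses K X) : Ses_clidl (Ses_clidl C))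
        (delta_ob (choice_ses K X)) :=
  @ses_lift (Ses_clidl C) (Omega_ob choice_hom (choice_ses K X))
    (delta_ob (choice_ses K X)) (idm (choice_ses K X)) (choice_cell_null X).

Lemma choice_cell_nat (X Y : C) (u : hom X Y) :
  choice_cell_at Y ∘ fmap (comp_clidl_hom (Omega_hom choice_hom) choice_hom) u =
  fmap (comp_clidl_hom (delta_hom C) choice_hom) u ∘ choice_cell_at X.
Proof. by apply: ses_hom_eq; apply: id_square. Qed.

Definition choice_cell : cell (m1 Omega l ⊚ l) (delta C ⊚ l) :=
  @NatTrans _ _ (comp_clidl_hom (Omega_hom choice_hom) choice_hom)
    (comp_clidl_hom (delta_hom C) choice_hom) choice_cell_at choice_cell_nat.

Lemma choice_cell_inv : invertible choice_cell.
Proof.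
apply: invertible_pointwise => X.
have iso_at : is_iso (choice_cell_at X); last exact iso_at.
apply: (@ses_iso (Ses_clidl C) _ _ (choice_cell_at X)
  (@idm (ses_cat C) (choice_ses K X))).
- exact: mcomp1m.
- exact: mcomp1m.
- by rewrite mcompm1; apply/ses_idealP; apply: (ses_null (choice_ses K X)).
Qed.

Definition choice_coalg : coalg Omega_comonad.
Proof.
apply: (@Coalg _ _ _ _ Omega_comonad C l choice_normal choice_cell choice_cell_inv).
- by apply: ev_ext => X; cbn [cunitr Omega_comonad]; middle; rewrite ?comonadE.
- by apply: ev_ext => X; cbn [cunitl Omega_comonad]; middle; rewrite ?comonadE.
- by apply: ev_ext => X; cbn [Xi Omega_comonad]; middle; rewrite ?comonadE.
Defined.
End ChoiceCoalgebra.

(** * Pseudo-coalgebras as pretorsion theories *)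

(** Applying [Omega] of the counit and then taking the middle extracts the central component of the
    cell, and the counit axiom equates it with an identity cell. This determines the whole cell. *)
Lemma coalg_cell_obid (A : coalg Omega_comonad) (X : ca_ob A) :
  exists p, hY (hY (ev (ca_cell A) X)) = ob_idm p.
Proof.
have := f_equal (fun u => hY u) (ev_eq (ca_counitr A) X).
cbn [cunitr Omega_comonad]; rewrite ?evE ?hYE ?evE ?comonadE ?evE => ->.
rewrite (@ev_idcell A A _ _ (ca_normal A) (sY (ca_str A X))
  (str_ob (ca_normal A) (sY (ca_str A X)))).
by exists (str_ob (ca_normal A) (sY (ca_str A X))).
Qed.

Lemma ses_choice_eq (C : clidl) (X Z : C -> C) l l' r r' P P' N N' :
  l = l' -> r = r' -> @SesChoice C X Z l r P N = @SesChoice C X Z l' r' P' N'.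
Proof. by move=> ? ?; subst; congr SesChoice; apply: proof_irrelevance. Qed.

Lemma str_choice_hom (C : clidl) (K : ses_choice C) (KP : choice_preserves K) n :
  @str_choice C (choice_hom KP) n = K.
Proof.
case: K KP n => X Z l r P N KP n; apply: ses_choice_eq;
  apply: functional_extensionality_dep => A.
  by rewrite /str_l; have /= := ob_idm_refl (str_ob n A) => ->; rewrite mcomp1m.
by rewrite /str_r; have /= := ob_idm_refl (esym (str_ob n A)) => ->; rewrite mcompm1.
Qed.

Lemma choice_bihptors_eq (C : clidl) (K K' : ses_choice C) (KP : choice_preserves K)
    (KP' : choice_preserves K') :
  K = K' -> choice_bihptors KP = choice_bihptors KP'.
Proof. by move=> ?; subst; rewrite (proof_irrelevance _ KP KP'). Qed.

(** The non-propositional data needed to recover a choice, as nested dependent pairs that can be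
    peeled off one by one. *)
Definition pretorsion_data (P : pretorsion) :
    {C : category & {X : C -> C & {Z : C -> C &
      ((forall A, hom (X A) A) * (forall A, hom A (Z A)))%type}}} :=
  existT _ (pt_cat P) (existT _ (@tors P) (existT _ (@tfree P) (@ell P, @rho P))).

Lemma choice_bihptors_inj (C : clidl) (K K' : ses_choice C)
    (KP : choice_preserves K) (KP' : choice_preserves K') :
  choice_bihptors KP = choice_bihptors KP' -> K = K'.
Proof.
move=> /(f_equal (fun P : bihptors => pretorsion_data P)).
case: K KP => X Z l r P N KP; case: K' KP' => X' Z' l' r' P' N' KP'.
rewrite /pretorsion_data /= => e.
have {}e := inj_pairT2 _ _ _ _ _ e.
have eX := f_equal (fun s => projT1 s) e; rewrite /= in eX; subst X'.
have {}e := inj_pairT2 _ _ _ _ _ e.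
have eZ := f_equal (fun s => projT1 s) e; rewrite /= in eZ; subst Z'.
by case: (inj_pairT2 _ _ _ _ _ e) => el er; apply: ses_choice_eq.
Qed.

Definition coalg_bihptors (A : coalg Omega_comonad) : bihptors :=
  choice_bihptors (@str_choice_preserves (ca_ob A) (ca_str A) (ca_normal A)).

Lemma clidl_eq (C : category) (N N' : mor_class C) cl cl' k k' c c' :
  N = N' -> @ClIdlOb C N cl k c = @ClIdlOb C N' cl' k' c'.
Proof. by move=> ?; subst; congr ClIdlOb; apply: proof_irrelevance. Qed.

Lemma coalg_bihptors_forget (A : coalg Omega_comonad) :
  bh_clidl (coalg_bihptors A) = ca_ob A.
Proof.
have := choice_null (str_choice (ca_normal A)); rewrite /coalg_bihptors /bh_clidl.
move: (str_choice_preserves _).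
case: A => [[C N cl k c] l n e i a b d] KP eN; exact: clidl_eq.
Qed.

(** The cells agree by [coalg_cell_obid], and the remaining fields are propositions. *)
Lemma coalg_eq (A B : coalg Omega_comonad) (e : ca_ob A = ca_ob B :> ClIdl) :
  match e in _ = C return @hom1 ClIdl C (m0 Omega C) with erefl => ca_str A end =
    ca_str B ->
  A = B.
Proof.
have := @coalg_cell_obid A; have := @coalg_cell_obid B.
case: A B e => [C l n c i a b d] [C' l' n' c' i' a' b' d'] /= e.
case: C' / e l' n' c' i' a' b' d' => l' n' c' i' a' b' d' H H' el; subst l'.
have ? := proof_irrelevance _ n n'; subst n'.
have ? : c = c'.
  apply: ev_ext => X; apply: ses_hom_eq; apply: ses_hom_eq.
  have [p ->] := H X; have [q ->] := H' X; by rewrite (proof_irrelevance _ p q).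
by subst c'; congr Coalg; apply: proof_irrelevance.
Qed.

(** An equality of theories gives one of underlying objects of [ClIdl], then one of choices; a
    choice determines the structure by [str_choiceE]. *)
Lemma coalg_bihptors_inj (A B : coalg Omega_comonad) :
  coalg_bihptors A = coalg_bihptors B -> A = B.
Proof.
move=> e; have eo : ca_ob A = ca_ob B.
  by rewrite -(coalg_bihptors_forget A) e coalg_bihptors_forget.
apply: (coalg_eq (e := eo)); move: e; rewrite /coalg_bihptors.
case: A B eo => [C l n c i a b d] [C' l' n' c' i' a' b' d'] /= e.
case: C' / e l' n' c' i' a' b' d' => l' n' _ _ _ _ _ /choice_bihptors_inj e.
by apply: clidl_hom_eq; rewrite -(str_choiceE n) e str_choiceE.
Qed.

Lemma coalg_bihptors_surj (P : bihptors) : exists A, coalg_bihptors A = P.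
Proof.
exists (choice_coalg (pretorsion_choice_preserves P)).
rewrite -[RHS]choice_pretorsionK; apply: choice_bihptors_eq; exact: str_choice_hom.
Qed.

(** * Pseudo-morphisms and 2-cells *)

(** Identities up to an equality of objects; parallel ones coincide by uniqueness
    of identity proofs, which settles all coherence equations below. *)
Definition obid (C : category) (A B : C) (f : hom A B) : Prop :=
  exists p, f = ob_idm p.

Lemma obid_eq (C : category) (A B : C) (f g : hom A B) : obid f -> obid g -> f = g.
Proof. by move=> [p ->] [q ->]; rewrite (proof_irrelevance _ p q). Qed.

Lemma obid_idm (C : category) (A : C) : obid (idm A).
Proof. by exists erefl. Qed.

Lemma obid_comp (C : category) (A B D : C) (g : hom B D) (f : hom A B) :
  obid g -> obid f -> obid (g ∘ f).
Proof. by move=> [p ->] [q ->]; exists (etrans q p); rewrite ob_idmM. Qed.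

Lemma obid_evm (C D : ClIdl) (F : hom1 C D) (A B : (C : clidl)) (f : hom A B) :
  obid f -> obid (evm F f).
Proof. by move=> [p ->]; exists (f_equal (ev1 F) p); rewrite evm_ob_idm. Qed.

Lemma obid_hY (C : clidl) (S T : Ses_clidl C) (u : hom S T) : obid u -> obid (hY u).
Proof. by move=> [p ->]; exists (f_equal (@sY C) p); apply: hY_ob_idm. Qed.

Lemma obid_inv (C : category) (A B : C) (f : hom A B) :
  obid f -> exists g, [/\ obid g, g ∘ f = idm A & f ∘ g = idm B].
Proof.
move=> [p ->]; exists (ob_idm (esym p)); split; first by exists (esym p).
  exact: ob_idmK.
exact: ob_idmVK.
Qed.

Lemma obid_iso (C : category) (A B : C) (f : hom A B) : obid f -> is_iso f.
Proof. by move/obid_inv=> [g [_ gf fg]]; exists g. Qed.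

Lemma obid_idcell (C D : ClIdl) (f g : hom1 C D) (e : f = g) S :
  obid (ev (idcell e) S).
Proof.
exists (f_equal (fun h => ev1 h S) e); exact: ev_idcell.
Qed.

(** In the counit axiom all other cells have components that are identities up to object equality,
    and the remaining [idcell] can be cancelled. *)
Lemma coalg_hom_obid (A B : coalg Omega_comonad) (G : coalg_hom A B) (X : ca_ob A) :
  obid (hY (ev (ch_2 G) X)).
Proof.
have := ev_eq (ch_counit G) X; rewrite !evE ?comonadE ?evE => e.
have [g [gI _ ig]] := obid_inv (obid_idcell (coalg_hom_eq (ch_1 G)) X).
rewrite -[X in obid X]mcompm1 -ig mcompA.
by rewrite [X in X ∘ g]e mcomp1m.
Qed.

Lemma coalg_null (A : coalg Omega_comonad) :
  @pt_null (coalg_bihptors A) = @ci_null (ca_ob A).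
Proof. exact: choice_null. Qed.

Lemma iso_ev (C D : ClIdl) (F G : hom1 C D) (a : cell F G) (X : (C : clidl)) :
  invertible a -> is_iso (ev a X).
Proof.
by case=> b [ba ab]; exists (ev b X); rewrite -!ev_vcomp ba ab.
Qed.

Section StrIso.
Variables (C : clidl) (l : clidl_hom C (Ses_clidl C)).
Variable n : comp_clidl_hom (epsilon_hom C) l = id_clidl_hom C.

Lemma str_l_iso (X : C) : is_iso (str_l n X) <-> is_iso (sf (l X)).
Proof.
have i : is_iso (ob_idm (str_ob n X)) by apply: obid_iso; exists (str_ob n X).
by split; [apply: iso_cancell|apply: iso_comp].
Qed.

Lemma str_r_iso (X : C) : is_iso (str_r n X) <-> is_iso (sg (l X)).
Proof.
have i : is_iso (ob_idm (esym (str_ob n X))).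
  by apply: obid_iso; exists (esym (str_ob n X)).
by split=> h; [apply: (iso_cancelr i h)|apply: iso_comp].
Qed.
End StrIso.

Lemma obid_sandwich (C : category) (A B D E : C) (m : hom B D) (a a' : hom D E)
    (b b' : hom A B) : obid a -> obid a' -> obid b -> obid b' ->
  a ∘ m ∘ b = a' ∘ m ∘ b'.
Proof.
by move=> aI aI' bI bI'; rewrite (obid_eq aI aI') (obid_eq bI bI').
Qed.

Lemma str_hY (C : clidl) (l : clidl_hom C (Ses_clidl C))
    (n : comp_clidl_hom (epsilon_hom C) l = id_clidl_hom C) (X Y : C) (h : hom X Y) :
  hY (fmap l h) = ob_idm (esym (str_ob n Y)) ∘ h ∘ ob_idm (str_ob n X).
Proof. by rewrite -mcompA -str_mor mcompA ob_idmK mcomp1m. Qed.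

Section Hom.
Variables A B : coalg Omega_comonad.

Section Torsion.
Variable G : coalg_hom A B.

Lemma coalg_hom_torsion (X : ca_ob A) :
  choice_torsion (str_choice (ca_normal A)) X ->
  choice_torsion (str_choice (ca_normal B)) (ev1 G X).
Proof.
move/str_l_iso => lI; apply/str_l_iso.
pose u : hom (ev1 (ca_str B ⊚ G) X : Ses_clidl (ca_ob B))
    (ev1 (m1 Omega G ⊚ ca_str A) X) :=
  ev (ch_2 G) X.
have uI : is_iso u by apply: iso_ev; apply: ch_2_inv.
have yI : is_iso (hY u) by apply: obid_iso; apply: coalg_hom_obid.
(* In the left square of [u] the middle and left components are invertible, as is the image under
   [G] of the first morphism at [X]; hence so is the first morphism at [G X]. *)
apply: (iso_cancell yI); rewrite hl; apply: iso_comp (iso_hX uI).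
exact: (iso_fmap (ch_1 G : clidl_hom _ _) lI).
Qed.

Lemma coalg_hom_torsionfree (X : ca_ob A) :
  choice_torsionfree (str_choice (ca_normal A)) X ->
  choice_torsionfree (str_choice (ca_normal B)) (ev1 G X).
Proof.
move/str_r_iso => lI; apply/str_r_iso.
pose u : hom (ev1 (ca_str B ⊚ G) X : Ses_clidl (ca_ob B))
    (ev1 (m1 Omega G ⊚ ca_str A) X) :=
  ev (ch_2 G) X.
have uI : is_iso u by apply: iso_ev; apply: ch_2_inv.
have yI : is_iso (hY u) by apply: obid_iso; apply: coalg_hom_obid.
apply: (iso_cancell (iso_hZ uI)); rewrite hr; apply: iso_comp yI.
exact: (iso_fmap (ch_1 G : clidl_hom _ _) lI).
Qed.

Lemma coalg_hom_kernels : preserves_kernels (@pt_null (coalg_bihptors A))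
  (@pt_null (coalg_bihptors B)) (ch_1 G : clidl_hom (ca_ob A) (ca_ob B)).
Proof. by rewrite !coalg_null; exact: ch_kernels. Qed.

Lemma coalg_hom_cokernels : preserves_cokernels (@pt_null (coalg_bihptors A))
  (@pt_null (coalg_bihptors B)) (ch_1 G : clidl_hom (ca_ob A) (ca_ob B)).
Proof. by rewrite !coalg_null; exact: ch_cokernels. Qed.

Definition coalg_bihptors_hom : bihptors_hom (coalg_bihptors A) (coalg_bihptors B) :=
  @BiHPTorsHom (coalg_bihptors A) (coalg_bihptors B)
    (@ClIdlHom (bh_clidl (coalg_bihptors A)) (bh_clidl (coalg_bihptors B))
      (ch_1 G : clidl_hom (ca_ob A) (ca_ob B)) coalg_hom_kernels coalg_hom_cokernels)
    coalg_hom_torsion coalg_hom_torsionfree.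
End Torsion.

Lemma coalg_bihptors_hom_inj (G H : coalg_hom A B) :
  coalg_bihptors_hom G = coalg_bihptors_hom H -> G = H.
Proof.
move=> /(f_equal (fun F : bihptors_hom _ _ => ch_functor F)) /= /clidl_hom_eq.
case: G H => [G G2 i c d] [H H2 i' c' d'] /= e; subst H.
have ? : G2 = H2.
  apply: ev_ext => X; apply: ses_hom_eq; apply: obid_eq.
    exact: (coalg_hom_obid (CoalgHom i c d)).
  exact: (coalg_hom_obid (CoalgHom i' c' d')).
by subst H2; congr CoalgHom; apply: proof_irrelevance.
Qed.

Section Surjectivity.
Variable F : bihptors_hom (coalg_bihptors A) (coalg_bihptors B).

Lemma underlying_kernels : preserves_kernels (@ci_null (ca_ob A)) (@ci_null (ca_ob B))
  (ch_functor F : functor (ca_ob A) (ca_ob B)).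
Proof. by rewrite -!coalg_null; exact: (@ch_kernels _ _ F). Qed.

Lemma underlying_cokernels : preserves_cokernels (@ci_null (ca_ob A))
  (@ci_null (ca_ob B)) (ch_functor F : functor (ca_ob A) (ca_ob B)).
Proof. by rewrite -!coalg_null; exact: (@ch_cokernels _ _ F). Qed.

Definition underlying_hom : clidl_hom (ca_ob A) (ca_ob B) :=
  @ClIdlHom (ca_ob A) (ca_ob B) _ underlying_kernels underlying_cokernels.

Let G : hom1 (ca_ob A : ClIdl) (ca_ob B) := underlying_hom.
Let S (X : ca_ob A) : Ses_clidl (ca_ob B) := ev1 (ca_str B ⊚ G) X.
Let T (X : ca_ob A) : Ses_clidl (ca_ob B) := ev1 (m1 Omega G ⊚ ca_str A) X.

Lemma underlying_ob (X : ca_ob A) : sY (S X) = sY (T X).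
Proof.
exact: (etrans (str_ob (ca_normal B) (ev1 G X))
  (esym (f_equal (ev1 G) (str_ob (ca_normal A) X)))).
Qed.

(** Up to object equalities this is the torsion inclusion at [G X] followed by the image of the
    torsion-free quotient of [X]. It runs from a torsion object to a torsion-free one, because [F]
    preserves the latter, and (T1) applies. The opposite composite, needed for the inverse cell,
    uses preservation of torsion objects. *)
Lemma underlying_ses_null (X : ca_ob A) (p : sY (S X) = sY (T X)) :
  ci_null (ca_ob B) (sg (T X) ∘ ob_idm p ∘ sf (S X)).
Proof.
rewrite -coalg_null.
have -> : sg (T X) ∘ ob_idm p ∘ sf (S X) =
    evm G (str_r (ca_normal A) X) ∘ str_l (ca_normal B) (ev1 G X).
  rewrite /str_r /str_l evm_comp evm_ob_idm -!mcompA; congr (_ ∘ _).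
  by rewrite !mcompA ob_idmM; congr (ob_idm _ ∘ _); apply: proof_irrelevance.
apply: pt_T1; first exact: (choice_tors_torsion (str_choice_preserves (ca_normal B))).
apply: (bh_torsionfree F).
exact: (@choice_tfree_torsionfree _ _ (str_choice_preserves (ca_normal A))).
Qed.

Lemma underlying_ses_nullV (X : ca_ob A) (p : sY (T X) = sY (S X)) :
  ci_null (ca_ob B) (sg (S X) ∘ ob_idm p ∘ sf (T X)).
Proof.
rewrite -coalg_null.
have -> : sg (S X) ∘ ob_idm p ∘ sf (T X) =
    str_r (ca_normal B) (ev1 G X) ∘ evm G (str_l (ca_normal A) X).
  rewrite /str_r /str_l evm_comp evm_ob_idm -!mcompA; congr (_ ∘ _).
  by rewrite !mcompA ob_idmM; congr (ob_idm _ ∘ _); apply: proof_irrelevance.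
apply: pt_T1; last first.
  exact: (choice_tfree_torsionfree (str_choice_preserves (ca_normal B))).
apply: (bh_torsion F).
exact: (@choice_tors_torsion _ _ (str_choice_preserves (ca_normal A))).
Qed.

Definition underlying_cell_at (X : ca_ob A) : hom (S X) (T X) :=
  ses_lift (underlying_ses_null (underlying_ob X)).

Lemma underlying_cell_nat (X Y : ca_ob A) (h : hom X Y) :
  underlying_cell_at Y ∘ evm (ca_str B ⊚ G) h =
  evm (m1 Omega G ⊚ ca_str A) h ∘ underlying_cell_at X.
Proof.
apply: ses_hom_eq; rewrite !hY_comp.
have eA := str_hY (ca_normal A) h.
have eB := str_hY (ca_normal B) (evm G h).
apply: etrans (f_equal (fun z => ob_idm (underlying_ob Y) ∘ z) eB) _.
apply: etrans (f_equal (fun z => evm G z ∘ ob_idm (underlying_ob X)) (esym eA)).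
(* Both sides become [evm G h] between identities up to object equality. *)
rewrite !evm_comp -!mcompA mcompA (mcompA (evm G h)) -(mcompA (evm G h)) !mcompA.
rewrite -(mcompA _ _ (ob_idm (underlying_ob X))).
apply: obid_sandwich.
- by apply: obid_comp; eexists.
- by apply: obid_evm; eexists.
- by eexists.
- by apply: obid_comp; [apply: obid_evm; eexists|eexists].
Qed.

Definition underlying_cell : cell (ca_str B ⊚ G) (m1 Omega G ⊚ ca_str A) :=
  @NatTrans _ _ (comp_clidl_hom (ca_str B) G)
    (comp_clidl_hom (Omega_hom G) (ca_str A)) underlying_cell_at underlying_cell_nat.

Lemma underlying_cell_inv : invertible underlying_cell.
Proof.
apply: invertible_pointwise => X.
have iso_at : is_iso (underlying_cell_at X); last exact iso_at.
apply: (@ses_iso (ca_ob B) (S X) (T X) (underlying_cell_at X)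
  (ob_idm (esym (underlying_ob X)))).
- exact: ob_idmK.
- exact: ob_idmVK.
- exact: underlying_ses_nullV.
Qed.

Lemma underlying_cell_obid (X : ca_ob A) : obid (hY (ev underlying_cell X)).
Proof. by exists (underlying_ob X). Qed.

Lemma underlying_counit :
  (epsilon B ◁ underlying_cell) • idcell (coalg_hom_eq (C := A) (D := B) G) =
  assoc_r (epsilon B) (m1 Omega G) (ca_str A) • (t2 epsilon G ▷ ca_str A) •
  assoc_l G (epsilon A) (ca_str A).
Proof.
apply: ev_ext => X; rewrite !evE ?comonadE ?evE; apply: obid_eq.
  by apply: obid_comp; [apply: underlying_cell_obid|apply: obid_idcell].
exact: obid_idm.
Qed.

Lemma underlying_comult :
  (delta B ◁ underlying_cell) • assoc_r (delta B) (ca_str B) G • (ca_cell B ▷ G) •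
  assoc_l (m1 Omega (ca_str B)) (ca_str B) G
  =
  assoc_r (delta B) (m1 Omega G) (ca_str A) • (t2 delta G ▷ ca_str A) •
  assoc_l (m1 Omega (m1 Omega G)) (delta A) (ca_str A) •
  (m1 Omega (m1 Omega G) ◁ ca_cell A) •
  assoc_r (m1 Omega (m1 Omega G)) (m1 Omega (ca_str A)) (ca_str A) •
  (ps_compV Omega (m1 Omega G) (ca_str A) ▷ ca_str A) •
  (m2 Omega underlying_cell ▷ ca_str A) •
  (ps_comp Omega (ca_str B) G ▷ ca_str A) •
  assoc_l (m1 Omega (ca_str B)) (m1 Omega G) (ca_str A) •
  (m1 Omega (ca_str B) ◁ underlying_cell).
Proof.
apply: ev_ext => X; rewrite !evE.
(* The components are morphisms between sequences of sequences, so the middle is taken twice; there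
   every factor is an identity up to object equality. *)
apply: ses_hom_eq; rewrite ?hYE ?comonadE ?evE.
apply: ses_hom_eq; rewrite ?hYE ?comonadE ?evE.
apply: obid_eq.
  by apply: obid_comp; [apply: underlying_cell_obid|apply: coalg_cell_obid].
apply: obid_comp.
  by apply: obid_comp; [apply: obid_evm; apply: coalg_cell_obid
                       |apply: underlying_cell_obid].
by apply: obid_hY; apply: obid_evm; apply: underlying_cell_obid.
Qed.

Lemma coalg_bihptors_hom_surj : exists G : coalg_hom A B, coalg_bihptors_hom G = F.
Proof.
exists (CoalgHom underlying_cell_inv underlying_counit underlying_comult).
apply: bihptors_hom_eq; exact: clidl_hom_eq.
Qed.
End Surjectivity.

Section Cells.
Variables (G H : coalg_hom A B).

Lemma nattrans_is_coalg_cell (a : cell (ch_1 G) (ch_1 H)) :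
  is_coalg_cell (G := G) (H := H) a.
Proof.
apply: ev_ext => X; rewrite !evE; apply: ses_hom_eq; rewrite ?hYE ?evE.
have eB := str_hY (ca_normal B) (ev a X).
apply: etrans (f_equal (fun z => hY (ev (ch_2 H) X) ∘ z) eB) _.
pose p := str_ob (ca_normal A) X.
(* Naturality of [a] replaces its component at the middle of the structure sequence by the one at
   [X]. *)
have e : ev a (sY (ev1 (ca_str A) X)) =
    evm (ch_1 H) (ob_idm (esym p)) ∘ ev a X ∘ evm (ch_1 G) (ob_idm p).
  by rewrite -ev_nat -mcompA -evm_comp ob_idmK evm_id mcompm1.
rewrite e mcompA -(mcompA _ _ (hY _)) (mcompA (hY _) (ob_idm _)).
apply: obid_sandwich.
- by apply: obid_comp; [apply: coalg_hom_obid|eexists].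
- by apply: obid_evm; eexists.
- by eexists.
- by apply: obid_comp; [apply: obid_evm; eexists|apply: coalg_hom_obid].
Qed.
End Cells.
End Hom.

Definition coalg_bihptors_map : map2 (PsCoalg Omega_comonad) BiHPTors :=
  @Map2 (PsCoalg Omega_comonad) BiHPTors coalg_bihptors coalg_bihptors_hom
    (fun A B G H a => proj1_sig (a : coalg_cell _ _)).

Lemma coalg_bihptors_2functor : is_2functor coalg_bihptors_map.
Proof.
have id1P X : m1 coalg_bihptors_map (id1 X) = id1 (m0 coalg_bihptors_map X).
  by apply: bihptors_hom_eq; apply: clidl_hom_eq.
have comp1P (X Y Z : PsCoalg Omega_comonad) (g : hom1 Y Z) (f : hom1 X Y) :
    m1 coalg_bihptors_map (g ⊚ f) = m1 coalg_bihptors_map g ⊚ m1 coalg_bihptors_map f.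
  by apply: bihptors_hom_eq; apply: clidl_hom_eq.
apply: (@Is2Functor _ _ _ id1P comp1P) => //.
- move=> X Y Z h f g a; apply: nattrans_eq => x.
  (* Both functors agree definitionally on objects, so the identity cells have identity
     components. *)
  apply: etrans (f_equal (fun z => z ∘ _)
    (@bihptors_idcell_at _ _ _ _ (comp1P _ _ _ h g) x erefl)) _.
  apply: etrans (mcomp1m _) _; symmetry.
  apply: etrans (f_equal (fun z => _ ∘ z)
    (@bihptors_idcell_at _ _ _ _ (comp1P _ _ _ h f) x erefl)) _.
  exact: mcompm1.
- move=> X Y Z f g h a; apply: nattrans_eq => x.
  apply: etrans (f_equal (fun z => z ∘ _)
    (@bihptors_idcell_at _ _ _ _ (comp1P _ _ _ g h) x erefl)) _.
  apply: etrans (mcomp1m _) _; symmetry.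
  apply: etrans (f_equal (fun z => _ ∘ z)
    (@bihptors_idcell_at _ _ _ _ (comp1P _ _ _ f h) x erefl)) _.
  exact: mcompm1.
Qed.

(** * Compatibility with the forgetful 2-functors *)

Section ChangeOfIdeal.
Variables (C D : category) (N N' : mor_class C) (M M' : mor_class D).
Variables (cl : is_closed_ideal N) (cl' : is_closed_ideal N').
Variables (k : has_kernels N) (k' : has_kernels N').
Variables (c : has_cokernels N) (c' : has_cokernels N').
Variables (dl : is_closed_ideal M) (dl' : is_closed_ideal M').
Variables (l : has_kernels M) (l' : has_kernels M').
Variables (d : has_cokernels M) (d' : has_cokernels M').
Let X : ClIdl := ClIdlOb cl k c.
Let X' : ClIdl := ClIdlOb cl' k' c'.
Let Y : ClIdl := ClIdlOb dl l d.
Let Y' : ClIdl := ClIdlOb dl' l' d'.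

(** The objects [bh_clidl (coalg_bihptors A)] and [ca_ob A] share their category, but their null
    classes are equal only through [choice_null]; hence the same functor is compared
    heterogeneously. *)
Lemma change_ideal1 (F : functor C D) a a' b b' : N = N' -> M = M' ->
  @heq1 ClIdl X Y (@ClIdlHom X Y F a b) X' Y' (@ClIdlHom X' Y' F a' b').
Proof.
rewrite /X /Y /X' /Y' => eN eM.
subst N' M'.
have ? := proof_irrelevance _ cl cl'; have ? := proof_irrelevance _ k k'.
have ? := proof_irrelevance _ c c'; have ? := proof_irrelevance _ dl dl'.
have ? := proof_irrelevance _ l l'; have ? := proof_irrelevance _ d d'.
subst.
by rewrite (proof_irrelevance _ a a') (proof_irrelevance _ b b').
Qed.

Lemma change_ideal2 (F G : functor C D) (t : nattrans F G) a a' b b' p p' q q' :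
  N = N' -> M = M' ->
  @heq2 ClIdl X Y (@ClIdlHom X Y F a b) (@ClIdlHom X Y G p q) t
    X' Y' (@ClIdlHom X' Y' F a' b') (@ClIdlHom X' Y' G p' q') t.
Proof.
rewrite /X /Y /X' /Y' => eN eM.
subst N' M'.
have ? := proof_irrelevance _ cl cl'; have ? := proof_irrelevance _ k k'.
have ? := proof_irrelevance _ c c'; have ? := proof_irrelevance _ dl dl'.
have ? := proof_irrelevance _ l l'; have ? := proof_irrelevance _ d d'.
subst.
have ? := proof_irrelevance _ a a'; have ? := proof_irrelevance _ b b'.
have ? := proof_irrelevance _ p p'; have ? := proof_irrelevance _ q q'.
by subst.
Qed.
End ChangeOfIdeal.

Lemma coalg_bihptors_map_forget :
  comp_map BiHPTors_forget coalg_bihptors_map = PsCoalg_forget Omega_comonad.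
Proof.
apply: map2_eq.
- exact: coalg_bihptors_forget.
- move=> A B G; have eA := coalg_null A; have eB := coalg_null B.
  case: A eA B eB G => [[C N cl k c] la na ca ia x1 x2 x3] eA
    [[D M dl l d] lb nb cb ib y1 y2 y3] eB [[F a b] G2 i z1 z2].
  apply change_ideal1; [exact eA|exact eB].
- move=> A B G H t; have eA := coalg_null A; have eB := coalg_null B.
  case: A eA B eB G H t => [[C N cl k c] la na ca ia x1 x2 x3] eA
    [[D M dl l d] lb nb cb ib y1 y2 y3] eB [[F a b] G2 i z1 z2]
    [[F' a' b'] G2' i' z1' z2'] [t tP].
  apply change_ideal2; [exact eA|exact eB].
Qed.

Theorem theorem3p9 :
  exists M : pseudo_comonad epsilon delta,
    identity_counit_comparisons M /\
    exists Phi : map2 (PsCoalg M) BiHPTors,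
      is_2isomorphism Phi /\
      comp_map BiHPTors_forget Phi = PsCoalg_forget M.
Proof.
exists Omega_comonad; split; first exact: Omega_comonad_counit.
exists coalg_bihptors_map; split; last exact: coalg_bihptors_map_forget.
apply: (bijective_2isomorphism coalg_bihptors_2functor).
- exact: coalg_bihptors_inj.
- exact: coalg_bihptors_surj.
- exact: coalg_bihptors_hom_inj.
- exact: coalg_bihptors_hom_surj.
- move=> A B G H; exact: coalg_cell_eq.
- by move=> A B G H a; exists (exist _ _ (nattrans_is_coalg_cell a)).
Qed.
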